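(* Let $G$ be a group and let $H$ be a subgroup of $G$. Then, for every commutative ring $R$ such that $\mathrm{sfli}\,R<\infty$, we have $\widetilde{\mathrm{Gcd}}_R H\le\widetilde{\mathrm{Gcd}}_R G$.
   Context: Rings are associative and unital; modules are left modules unless stated otherwise. A module over a ring $S$ is projectively coresolved Gorenstein flat (PGF) if it is a syzygy (image of a differential) of an acyclic (unbounded) complex $\mathbf{P}$ of projective $S$-modules such that $I\otimes_S\mathbf{P}$ is acyclic for every injective right $S$-module $I$. $\mathrm{PGF\text{-}dim}_S M\in\mathbb{N}\cup\{\infty\}$ is the length of a shortest resolution of $M$ by PGF modules ($\infty$ if there is no finite one). For a commutative ring $R$ and a group $G$, $\widetilde{\mathrm{Gcd}}_R G:=\mathrm{PGF\text{-}dim}_{RG}R$, where $R$ is the trivial $RG$-module. $\mathrm{sfli}\,R$ is the supremum of the flat dimensions of injective $R$-modules. *)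

(* Defs.v *)
From HB Require Import structures.
From mathcomp Require Import all_boot all_order all_algebra.
From mathcomp Require Import finmap boolp.
From mathcomp.multinomials Require Import monalg.

Set Implicit Arguments.
Unset Strict Implicit.
Unset Printing Implicit Defensive.

Import Order.TTheory GRing.Theory.
Local Open Scope fset_scope.
Local Open Scope ring_scope.
Local Open Scope quotient_scope.

(* The ordered set of extended naturals; None is infinity. *)
Definition natinf : Type := option nat.
HB.instance Definition _ := Choice.on natinf.

Definition infty : natinf := None.

Definition natinf_le (a b : natinf) : bool :=
  match a, b with
  | _, None => true
  | None, Some _ => false
  | Some m, Some n => (m <= n)%N
  end.

Fact natinf_le_refl : reflexive natinf_le.
Proof. by case=> [n|] //=. Qed.
Fact natinf_le_anti : antisymmetric natinf_le.
Proof. by case=> [m|] [n|] //= /anti_leq ->. Qed.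
Fact natinf_le_trans : transitive natinf_le.
Proof. by case=> [m|] [n|] [p|] //=; apply: leq_trans. Qed.
Fact natinf_le_total : total natinf_le.
Proof. by case=> [m|] [n|] //=; apply: leq_total. Qed.

Fact natinf_display : Order.disp_t. Proof. exact: (Order.Disp tt tt). Qed.
HB.instance Definition _ := Order.Le_isPOrder.Build natinf_display natinf
  natinf_le_refl natinf_le_anti natinf_le_trans.
HB.instance Definition _ :=
  Order.POrder_isTotal.Build natinf_display natinf natinf_le_total.

Definition infn (P : nat -> Prop) : natinf :=
  match pselect (exists n, `[< P n >]) with
  | left exP => Some (ex_minn exP)
  | right _ => infty
  end.

(* Least upper bound; in particular the supremum of the empty set is 0. *)
Definition supn (A : natinf -> Prop) : natinf :=
  infn (fun n => forall a, A a -> (a <= (Some n : natinf))%O).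

(* Universal extension of a function to the free abelian group on its domain. *)
Section FreeAbelian.
Variables (K : choiceType) (A : zmodType) (f : K -> A).

Definition free_lift (x : {malg int[K]}) : A := \sum_(k <- msupp x) f k *~ x@_k.

Lemma free_liftEw (D : {fset K}) x : msupp x `<=` D ->
  free_lift x = \sum_(k <- D) f k *~ x@_k.
Proof.
by move=> le; apply: big_fset_incl => // k _ /mcoeff_outdom ->; rewrite mulr0z.
Qed.

Lemma free_liftU k : free_lift << k >> = f k.
Proof. by rewrite (free_liftEw msuppU_le) big_seq_fset1 mcoeffUU. Qed.

Lemma free_liftB : {morph free_lift : x y / x - y}.
Proof.
move=> x y; rewrite (free_liftEw (msuppB_le x y)).
rewrite (free_liftEw (fsubsetUl (msupp x) (msupp y))).
rewrite (free_liftEw (fsubsetUr (msupp x) (msupp y))) -sumrB.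
by apply: eq_bigr => k _; rewrite mcoeffB mulrzBr.
Qed.

End FreeAbelian.

(* A right S-module is a left module over the converse ring S^c. *)
Section Tensor.
Variables (S : pzRingType) (M : lmodType S^c) (N : lmodType S).

Inductive tensor_rel : {malg int[(M * N)%type]} -> Prop :=
| tensor_rel0 : tensor_rel 0
| tensor_relB x y : tensor_rel x -> tensor_rel y -> tensor_rel (x - y)
| tensor_relDl m1 m2 n :
    tensor_rel (<< (m1 + m2, n) >> - << (m1, n) >> - << (m2, n) >>)
| tensor_relDr m n1 n2 :
    tensor_rel (<< (m, n1 + n2) >> - << (m, n1) >> - << (m, n2) >>)
| tensor_relZ m (s : S) n :
    tensor_rel (<< ((s : S^c) *: m, n) >> - << (m, s *: n) >>).

Definition tensor_rel_pred : {pred {malg int[(M * N)%type]}} :=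
  fun x => `[< tensor_rel x >].

Fact tensor_rel_zmod_closed : zmod_closed tensor_rel_pred.
Proof.
split=> [|x y]; rewrite !unfold_in; first by apply/asboolP; constructor.
by move=> /asboolP rx /asboolP ry; apply/asboolP; constructor.
Qed.

HB.instance Definition _ :=
  GRing.isZmodClosed.Build _ tensor_rel_pred tensor_rel_zmod_closed.

Definition tensor : zmodType := @Quotient.quot _ tensor_rel_pred.

Definition pure (m : M) (n : N) : tensor :=
  \pi_(@Quotient.quot _ tensor_rel_pred) << (m, n) >>.

End Tensor.

Section TensorLift.
Variables (S : pzRingType) (M : lmodType S^c) (N : lmodType S) (A : zmodType).

Definition balanced (b : M -> N -> A) : Prop :=
  [/\ forall m1 m2 n, b (m1 + m2) n = b m1 n + b m2 n,
      forall m n1 n2, b m (n1 + n2) = b m n1 + b m n2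
    & forall m (s : S) n, b ((s : S^c) *: m) n = b m (s *: n)].

Definition tensor_lift (b : M -> N -> A) (x : tensor M N) : A :=
  free_lift (fun p => b p.1 p.2) (repr x).

Variable b : M -> N -> A.
Hypothesis b_bal : balanced b.

Lemma tensor_lift_pi x :
  tensor_lift b (\pi_(@Quotient.quot _ (@tensor_rel_pred S M N)) x)
    = free_lift (fun p => b p.1 p.2) x.
Proof.
have [bDl bDr bZ] := b_bal.
have rel0 y : tensor_rel y -> free_lift (fun p => b p.1 p.2) y = 0.
  elim=> [|u v _ u0 _ v0|m1 m2 n|m n1 n2|m s n].
  - by rewrite /free_lift msupp0 big_seq_fset0.
  - by rewrite free_liftB u0 v0 subrr.
  - by rewrite !free_liftB !free_liftU /= bDl -addrA -opprD subrr.
  - by rewrite !free_liftB !free_liftU /= bDr -addrA -opprD subrr.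
  - by rewrite !free_liftB !free_liftU /= bZ subrr.
apply/eqP; rewrite -subr_eq0 -free_liftB; apply/eqP/rel0/asboolP.
suff: repr (\pi_(@Quotient.quot _ (@tensor_rel_pred S M N)) x) - x
        \in @tensor_rel_pred S M N by [].
by rewrite Quotient.idealrBE reprK.
Qed.

Lemma tensor_lift_pure m n : tensor_lift b (pure m n) = b m n.
Proof. by rewrite tensor_lift_pi free_liftU. Qed.

Lemma tensor_liftB : {morph tensor_lift b : x y / x - y}.
Proof.
move=> x y; rewrite -[x]reprK -[y]reprK -raddfB !tensor_lift_pi.
exact: free_liftB.
Qed.

End TensorLift.

Definition tensor_map (S : pzRingType) (M M' : lmodType S^c) (N N' : lmodType S)
    (f : {linear M -> M'}) (g : {linear N -> N'}) : tensor M N -> tensor M' N' :=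
  tensor_lift (fun m n => pure (f m) (g n)).

Lemma pure_balanced (S : pzRingType) (M : lmodType S^c) (N : lmodType S) :
  balanced (@pure S M N).
Proof.
have eqr x y : tensor_rel (x - y) ->
    \pi_(@Quotient.quot _ (@tensor_rel_pred S M N)) x = \pi y.
  by move=> rxy; apply/eqP; rewrite -Quotient.idealrBE; apply/asboolP.
split=> [m1 m2 n|m n1 n2|m s n].
- by rewrite /pure -raddfD; apply: eqr; rewrite opprD addrA; apply: tensor_relDl.
- by rewrite /pure -raddfD; apply: eqr; rewrite opprD addrA; apply: tensor_relDr.
- by apply: eqr; apply: tensor_relZ.
Qed.

Section TensorMap.
Variables (S : pzRingType) (M M' : lmodType S^c) (N N' : lmodType S).
Variables (f : {linear M -> M'}) (g : {linear N -> N'}).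

Fact tensor_map_balanced : balanced (fun m n => pure (f m) (g n)).
Proof.
have [pDl pDr pZ] := @pure_balanced S M' N'.
split=> [m1 m2 n|m n1 n2|m s n].
- by rewrite raddfD pDl.
- by rewrite raddfD pDr.
- by rewrite !linearZ pZ.
Qed.

Lemma tensor_map_pure m n : tensor_map f g (pure m n) = pure (f m) (g n).
Proof. exact: (tensor_lift_pure tensor_map_balanced). Qed.

Lemma tensor_mapB : {morph tensor_map f g : x y / x - y}.
Proof. exact: (tensor_liftB tensor_map_balanced). Qed.

End TensorMap.

Section Modules.
Variable S : pzRingType.

Definition projective_module (P : lmodType S) : Prop :=
  forall (A B : lmodType S) (p : {linear A -> B}) (f : {linear P -> B}),
    (forall b, exists a, p a = b) ->
    exists h : {linear P -> A}, forall x, p (h x) = f x.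

Definition injective_module (I : lmodType S) : Prop :=
  forall (A B : lmodType S) (i : {linear A -> B}) (f : {linear A -> I}),
    injective i -> exists h : {linear B -> I}, forall x, h (i x) = f x.

End Modules.

Section Dimensions.
Variable S : pzRingType.

Definition flat_module (F : lmodType S) : Prop :=
  forall (A B : lmodType S^c) (i : {linear A -> B}),
    injective i -> injective (tensor_map i (idfun : {linear F -> F})).

Definition exact_at (A B C : zmodType) (f : A -> B) (g : B -> C) : Prop :=
  forall b, g b = 0 <-> exists a, f a = b.

Record complex := Complex {
  ob : int -> lmodType S;
  diff : forall n : int, {linear ob (n + 1) -> ob n};
  diff_diff : forall (n : int) x, diff n (diff (n + 1) x) = 0
}.

Definition acyclic (P : complex) : Prop :=
  forall n : int, exact_at (diff P (n + 1)) (diff P n).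

Definition tensor_acyclic (I : lmodType S^c) (P : complex) : Prop :=
  forall n : int, exact_at
    (tensor_map (idfun : {linear I -> I}) (diff P (n + 1)))
    (tensor_map (idfun : {linear I -> I}) (diff P n)).

Definition syzygy (M : lmodType S) (P : complex) : Prop :=
  exists (n : int) (i : {linear M -> ob P n}), injective i /\
    forall x, (exists m, i m = x) <-> (exists y, diff P n y = x).

Definition PGF (M : lmodType S) : Prop :=
  exists P : complex,
    [/\ forall n, projective_module (ob P n), acyclic P,
        forall I : lmodType S^c, injective_module I -> tensor_acyclic I P
      & syzygy M P].

(* An exact sequence 0 -> X n -> ... -> X 0 -> M -> 0 with all X i in C. *)
Definition has_resolution (C : lmodType S -> Prop) (M : lmodType S) (n : nat) :
    Prop :=
  exists (X : nat -> lmodType S) (d : forall i, {linear X i.+1 -> X i})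
         (e : {linear X 0 -> M}),
    [/\ forall i, (i <= n)%N -> C (X i),
        forall i, (n < i)%N -> forall x : X i, x = 0,
        forall m, exists x, e x = m,
        exact_at (d 0%N) e
      & forall i, exact_at (d i.+1) (d i)].

Definition resolution_dim (C : lmodType S -> Prop) (M : lmodType S) : natinf :=
  infn (has_resolution C M).

Definition flat_dim : lmodType S -> natinf := resolution_dim flat_module.

Definition PGF_dim : lmodType S -> natinf := resolution_dim PGF.

Definition sfli : natinf :=
  supn (fun a => exists I : lmodType S, injective_module I /\ a = flat_dim I).

End Dimensions.

(* The group ring RG.  The library's product on {malg R[K]} is only available *)
(* for monoids K without nontrivial units, hence the alias.                   *)
Definition group_ring (R : comPzRingType) (G : groupType) : Type := {malg R[G]}.

Section GroupRing.
Variables (R : comPzRingType) (G : groupType).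

HB.instance Definition _ := GRing.Zmodule.on (group_ring R G).

Implicit Types x y z : group_ring R G.

Definition gr_elt (r : R) (g : G) : group_ring R G := mkmalgU g r.

Definition gr_one : group_ring R G := gr_elt 1 1%g.

Definition gr_mul x y : group_ring R G :=
  \sum_(g <- msupp x) \sum_(h <- msupp y) gr_elt (x@_g * y@_h) (g * h)%g.

Definition augmentation x : R := \sum_(g <- msupp x) x@_g.

Lemma gr_eltD g : {morph gr_elt ^~ g : r s / r + s}.
Proof. by move=> r s; apply: monalgUD. Qed.

Lemma gr_elt0 g : gr_elt 0 g = 0.
Proof. exact: monalgU0. Qed.

Lemma gr_sumE x : x = \sum_(g <- msupp x) gr_elt x@_g g.
Proof. exact: monalgE. Qed.

Lemma gr_ind (P : group_ring R G -> Prop) : P 0 ->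
  (forall r g x, P x -> P (gr_elt r g + x)) -> forall x, P x.
Proof.
move=> P0 PD x; rewrite [x]gr_sumE.
by elim/big_rec: _ => // g y _; apply: PD.
Qed.

Lemma gr_mulEw (D E : {fset G}) x y : msupp x `<=` D -> msupp y `<=` E ->
  gr_mul x y = \sum_(g <- D) \sum_(h <- E) gr_elt (x@_g * y@_h) (g * h)%g.
Proof.
move=> leD leE; rewrite /gr_mul (big_fset_incl _ leD) /=; last first.
  by move=> g _ /mcoeff_outdom xg; rewrite big1 // => h _; rewrite xg mul0r gr_elt0.
apply: eq_bigr => g _; apply: big_fset_incl => // h _ /mcoeff_outdom ->.
by rewrite mulr0 gr_elt0.
Qed.

Lemma gr_mulUU r g s h : gr_mul (gr_elt r g) (gr_elt s h) = gr_elt (r * s) (g * h)%g.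
Proof. by rewrite (gr_mulEw msuppU_le msuppU_le) !big_seq_fset1 !mcoeffUU. Qed.

Fact gr_mulDl : left_distributive gr_mul +%R.
Proof.
move=> x y z; set E := msupp z.
rewrite (@gr_mulEw _ E (x + y) z (msuppD_le x y) (fsubset_refl _)).
rewrite (@gr_mulEw _ E x z (fsubsetUl _ (msupp y)) (fsubset_refl _)).
rewrite (@gr_mulEw _ E y z (fsubsetUr (msupp x) _) (fsubset_refl _)) -big_split /=.
apply: eq_bigr => g _; rewrite -big_split /=; apply: eq_bigr => h _.
by rewrite mcoeffD mulrDl gr_eltD.
Qed.

Fact gr_mulDr : right_distributive gr_mul +%R.
Proof.
move=> z x y; set E := msupp z.
rewrite (@gr_mulEw E _ z (x + y) (fsubset_refl _) (msuppD_le x y)).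
rewrite (@gr_mulEw E _ z x (fsubset_refl _) (fsubsetUl _ (msupp y))).
rewrite (@gr_mulEw E _ z y (fsubset_refl _) (fsubsetUr (msupp x) _)) -big_split /=.
apply: eq_bigr => g _; rewrite -big_split /=; apply: eq_bigr => h _.
by rewrite mcoeffD mulrDr gr_eltD.
Qed.

Fact gr_mul0l : left_zero 0 gr_mul.
Proof. by move=> x; rewrite /gr_mul msupp0 big_seq_fset0. Qed.

Fact gr_mul0r : right_zero 0 gr_mul.
Proof.
by move=> x; rewrite /gr_mul big1 // => g _; rewrite msupp0 big_seq_fset0.
Qed.

Fact gr_mulA : associative gr_mul.
Proof.
move=> x y z; elim/gr_ind: x => [|r g x IHx]; first by rewrite !gr_mul0l.
rewrite !gr_mulDl IHx; congr (_ + _).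
elim/gr_ind: y {x IHx} => [|s h y IHy]; first by rewrite gr_mul0l gr_mul0r gr_mul0l.
rewrite gr_mulDl !gr_mulDr gr_mulDl IHy; congr (_ + _).
elim/gr_ind: z {y IHy} => [|t k z IHz]; first by rewrite !gr_mul0r.
by rewrite !gr_mulDr IHz !gr_mulUU mulrA mulgA.
Qed.

Fact gr_mul1l : left_id gr_one gr_mul.
Proof.
elim/gr_ind=> [|r g x IHx]; first by rewrite gr_mul0r.
by rewrite gr_mulDr IHx gr_mulUU mul1r mul1g.
Qed.

Fact gr_mul1r : right_id gr_one gr_mul.
Proof.
elim/gr_ind=> [|r g x IHx]; first by rewrite gr_mul0l.
by rewrite gr_mulDl IHx gr_mulUU mulr1 mulg1.
Qed.

HB.instance Definition _ := GRing.Zmodule_isPzRing.Build (group_ring R G)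
  gr_mulA gr_mul1l gr_mul1r gr_mulDl gr_mulDr.

Lemma augmentationEw (D : {fset G}) x : msupp x `<=` D ->
  augmentation x = \sum_(g <- D) x@_g.
Proof. by move=> le; apply: big_fset_incl => // g _ /mcoeff_outdom. Qed.

Lemma augmentationU r g : augmentation (gr_elt r g) = r.
Proof. by rewrite (augmentationEw msuppU_le) big_seq_fset1 mcoeffUU. Qed.

Lemma augmentationD : {morph augmentation : x y / x + y}.
Proof.
move=> x y; rewrite (augmentationEw (msuppD_le x y)).
rewrite (augmentationEw (fsubsetUl (msupp x) (msupp y))).
rewrite (augmentationEw (fsubsetUr (msupp x) (msupp y))) -big_split /=.
by apply: eq_bigr => g _; rewrite mcoeffD.
Qed.

Lemma augmentation0 : augmentation 0 = 0.
Proof. by rewrite /augmentation msupp0 big_seq_fset0. Qed.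

Lemma augmentation1 : augmentation 1 = 1.
Proof. exact: augmentationU. Qed.

Lemma augmentationM : {morph augmentation : x y / x * y}.
Proof.
move=> x y; elim/gr_ind: x => [|r g x IHx]; first by rewrite !(mul0r, augmentation0).
rewrite mulrDl !augmentationD IHx mulrDl; congr (_ + _).
elim/gr_ind: y {x IHx} => [|s h y IHy]; first by rewrite !(mulr0, augmentation0).
rewrite mulrDr !augmentationD IHy mulrDr; congr (_ + _).
by rewrite [X in augmentation X]gr_mulUU !augmentationU.
Qed.

End GroupRing.

(* R with every element of G acting as the identity. *)
Definition trivial_module (R : comPzRingType) (G : groupType) : Type := R.

Section TrivialModule.
Variables (R : comPzRingType) (G : groupType).

HB.instance Definition _ := GRing.Zmodule.on (trivial_module R G).

Definition trivial_scale (x : group_ring R G) (r : trivial_module R G) :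
  trivial_module R G := augmentation x * (r : R).

Fact trivial_scaleA x y r :
  trivial_scale x (trivial_scale y r) = trivial_scale (x * y) r.
Proof. by rewrite /trivial_scale augmentationM mulrA. Qed.

Fact trivial_scale1 : left_id 1 trivial_scale.
Proof. by move=> r; rewrite /trivial_scale augmentation1 mul1r. Qed.

Fact trivial_scaleDr : right_distributive trivial_scale +%R.
Proof. by move=> x r s; rewrite /trivial_scale mulrDr. Qed.

Fact trivial_scaleDl r : {morph trivial_scale^~ r : x y / x + y}.
Proof. by move=> x y; rewrite /trivial_scale augmentationD mulrDl. Qed.

HB.instance Definition _ :=
  GRing.Zmodule_isLmodule.Build (group_ring R G) (trivial_module R G)
    trivial_scaleA trivial_scale1 trivial_scaleDr trivial_scaleDl.

End TrivialModule.

Definition Gcd_tilde (R : comPzRingType) (G : groupType) : natinf :=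
  PGF_dim (trivial_module R G : lmodType (group_ring R G)).

(* Main.v *)
(** Write [Lam (x) I] for the diagonal tensor product over [R].  A resolution of
    the trivial module [R] by PGF [RG]-modules restricts to [RH]; the point is
    that a PGF [RG]-module restricts to a PGF [RH]-module, that is, that
    [I (x)_RH P] is exact for every acyclic complex [P] of projective
    [RG]-modules and every injective right [RH]-module [I].

    We may assume that the PGF dimension of [R] over [RG] is finite.  Then [R]
    embeds in an [RG]-module [Lam] of finite projective dimension such that
    [Tor^R(Lam/R, V) = 0] for all [V] of finite flat dimension; this uses
    [Ext^1(X, W) = 0] for [X] PGF and [W] projective.  The restriction of [I] to
    [R] is injective, hence of finite flat dimension, so [I] embeds in
    [Lam (x) I], and the embedding splits because [I] is injective.  It remains
    to see that [(Lam (x) I) (x)_RH P] is exact.  By dimension shifting [Lam] may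
    be taken projective, and then
    [(Lam (x) I) (x)_RH P = (P (x) I) (x)_RH Lam] is exact because [P (x) I] is
    exact and [Lam] is flat.

    For the vanishing of [Ext^1], testing the complex of [X] against products of
    character modules yields a finitary form of exactness of its [W]-dual: a
    functional vanishing on enough boundaries is a coboundary on a given finite
    set.  Solutions on finite sets are patched along countable chains by a
    Mittag-Leffler argument, and the countable pieces are glued by Zorn's lemma.
    *)
Require Import Defs.
From HB Require Import structures.
From mathcomp Require Import all_boot all_order all_algebra.
From mathcomp Require Import finmap boolp classical_sets.
From mathcomp.multinomials Require Import monalg.

Set Implicit Arguments.
Unset Strict Implicit.
Unset Printing Implicit Defensive.

Import GRing.Theory Num.Theory.
Local Open Scope fset_scope.
Local Open Scope ring_scope.
Local Open Scope quotient_scope.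

(** * Linear maps and short exact sequences *)

(** The obstacle: [PGF] over [RG] tests against injective right [RG]-modules, whereas [I (x)_RH P]
    is [(I (x)_RH RG) (x)_RG P], and for a subgroup of infinite index the induced module
    [I (x)_RH RG] need not be injective. The condition over [RH] therefore comes from one auxiliary
    module [Lam], built from the given resolution of [R], which then serves every [P] and every [I].

    Two properties are carried along cosyzygies of PGF modules. Orthogonality to projectives extends
    maps into projectives, and so turns a finite resolution on the left of [R] into an embedding of
    [R] with a controlled cokernel. Tor-acyclicity over [R] holds for PGF modules by induction on
    the flat dimension of the test module, each step moving to the next cosyzygy. Both properties
    are closed under extensions, so [Lam/R] inherits them.

    The map [x |-> 1 (x) x] from [I] to [Lam (x) I] is [RH]-linear because the image of [1] in [Lam]
    is fixed by the group, and injective because [Tor^R(Lam/R, I) = 0]. *)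

Section LinearMaps.
Variables (S : pzRingType) (A B : lmodType S).

Section Mk.
Variables (f : A -> B) (fD : forall x y, f (x + y) = f x + f y).
Variable (fZ : forall s x, f (s *: x) = s *: f x).

Fact lin_linear : linear f.
Proof. by move=> a u v; rewrite fD fZ. Qed.

Definition lin : {linear A -> B} :=
  HB.pack f (GRing.isLinear.Build S A B *:%R f lin_linear).

End Mk.

End LinearMaps.

Definition surj (A B : Type) (f : A -> B) := forall b, exists a, f a = b.

Lemma choose_fun (A B : Type) (P : A -> B -> Prop) :
  (forall a, exists b, P a b) -> exists f : A -> B, forall a, P a (f a).
Proof. by move=> h; exists (fun a => projT1 (cid (h a))) => a; case: cid. Qed.

Definition ses (S : pzRingType) (A B C : lmodType S)
    (i : {linear A -> B}) (p : {linear B -> C}) : Prop :=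
  [/\ injective i, surj p & exact_at i p].

Section Modules.
Variable S : pzRingType.
Implicit Types A B C : lmodType S.

Lemma lin_inj A B (f : {linear A -> B}) :
  (forall x, f x = 0 -> x = 0) -> injective f.
Proof.
by move=> h x y /eqP; rewrite -subr_eq0 -linearB => /eqP /h /eqP; rewrite subr_eq0 => /eqP.
Qed.

Lemma inj_eq0 A B (f : {linear A -> B}) x : injective f -> f x = 0 -> x = 0.
Proof. by move=> fi; rewrite -[X in _ = X](linear0 f) => /fi. Qed.

Lemma lin_factor A B C (p : {linear B -> C}) (f : {linear B -> A}) :
  surj p -> (forall x, p x = 0 -> f x = 0) ->
  exists g : {linear C -> A}, forall x, g (p x) = f x.
Proof.
move=> ps pf; have [s sK] := choose_fun ps.
have E x y : p x = p y -> f x = f y.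
  by move=> e; apply/eqP; rewrite -subr_eq0 -linearB pf // linearB e subrr.
have gD x y : f (s (x + y)) = f (s x) + f (s y).
  by rewrite -linearD; apply: E; rewrite linearD !sK.
have gZ a x : f (s (a *: x)) = a *: f (s x).
  by rewrite -linearZ; apply: E; rewrite linearZ !sK.
by exists (lin gD gZ) => x /=; apply: E; rewrite sK.
Qed.

Lemma lin_lift A B C (i : {linear B -> C}) (f : {linear A -> C}) :
  injective i -> (forall x, exists y, i y = f x) ->
  exists g : {linear A -> B}, forall x, i (g x) = f x.
Proof.
move=> ii fi; have [s sK] := choose_fun fi.
have gD x y : s (x + y) = s x + s y by apply: ii; rewrite linearD !sK linearD.
have gZ a x : s (a *: x) = a *: s x by apply: ii; rewrite linearZ !sK linearZ.
by exists (lin gD gZ) => x /=; rewrite sK.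
Qed.

Section Kernel.
Variables (A B : lmodType S) (f : {linear A -> B}).

Definition in_ker : {pred A} := fun x => f x == 0.

Fact in_ker_closed : submod_closed in_ker.
Proof.
split=> [|a x y]; rewrite !unfold_in; first by rewrite linear0.
by move=> /eqP fx /eqP fy; rewrite linearP fx fy scaler0 addr0.
Qed.

HB.instance Definition _ := GRing.isSubmodClosed.Build S A in_ker in_ker_closed.

Record kernel := Kernel { ker_val : A; _ : ker_val \in in_ker }.
HB.instance Definition _ := [isSub for ker_val].
HB.instance Definition _ := [Choice of kernel by <:].
HB.instance Definition _ := [SubChoice_isSubLmodule of kernel by <:].

End Kernel.

Lemma kernel_exists A B (f : {linear A -> B}) :
  exists (K : lmodType S) (i : {linear K -> A}), injective i /\ exact_at i f.
Proof.
exists (kernel f), (val : {linear kernel f -> A}); split; first exact: val_inj.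
move=> x; split=> [fx|[y <-]]; last by apply/eqP; case: y.
have xk : x \in in_ker f by rewrite unfold_in fx.
by exists (Kernel xk).
Qed.

Section Cokernel.
Variables (A B : lmodType S) (f : {linear A -> B}).

Definition in_im : {pred B} := fun x => `[< exists y, f y = x >].

Fact in_im_closed : zmod_closed in_im.
Proof.
split=> [|x y]; rewrite !unfold_in; first by apply/asboolP; exists 0; rewrite linear0.
move=> /asboolP [x' <-] /asboolP [y' <-]; apply/asboolP.
by exists (x' - y'); rewrite linearB.
Qed.

HB.instance Definition _ := GRing.isZmodClosed.Build B in_im in_im_closed.

Definition cokernel : Type := @Quotient.quot _ in_im.
HB.instance Definition _ := GRing.Zmodule.on cokernel.

Definition cok_pi (x : B) : cokernel := \pi_(@Quotient.quot _ in_im) x.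

Lemma cok_pi_eq x y : cok_pi x = cok_pi y <-> exists z, f z = x - y.
Proof.
rewrite /cok_pi; split=> [/eqP|h]; first by rewrite -Quotient.idealrBE => /asboolP.
by apply/eqP; rewrite -Quotient.idealrBE; apply/asboolP.
Qed.

Lemma cok_piD x y : cok_pi (x + y) = cok_pi x + cok_pi y.
Proof. exact: raddfD. Qed.

Lemma cok_piK (x : cokernel) : cok_pi (repr x) = x.
Proof. exact: reprK. Qed.

Definition cok_scale (a : S) (x : cokernel) : cokernel := cok_pi (a *: repr x).

Lemma cok_scale_pi a x : cok_scale a (cok_pi x) = cok_pi (a *: x).
Proof.
apply/cok_pi_eq; have /cok_pi_eq [z zE] := cok_piK (cok_pi x).
by exists (a *: z); rewrite linearZ /= zE scalerBr.
Qed.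

Fact cok_scaleA a b x : cok_scale a (cok_scale b x) = cok_scale (a * b) x.
Proof. by rewrite -(cok_piK x) !cok_scale_pi scalerA. Qed.
Fact cok_scale1 : left_id 1 cok_scale.
Proof. by move=> x; rewrite -(cok_piK x) !cok_scale_pi scale1r. Qed.
Fact cok_scaleDr : right_distributive cok_scale +%R.
Proof.
move=> a x y; rewrite -(cok_piK x) -(cok_piK y).
by rewrite -cok_piD !cok_scale_pi -cok_piD scalerDr.
Qed.
Fact cok_scaleDl x : {morph cok_scale^~ x : a b / a + b}.
Proof. by move=> a b; rewrite -(cok_piK x) !cok_scale_pi -cok_piD scalerDl. Qed.

HB.instance Definition _ := GRing.Zmodule_isLmodule.Build S cokernel
  cok_scaleA cok_scale1 cok_scaleDr cok_scaleDl.

End Cokernel.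

Lemma cokernel_exists A B (f : {linear A -> B}) :
  exists (C : lmodType S) (p : {linear B -> C}), surj p /\ exact_at f p.
Proof.
have pZ a x : cok_pi f (a *: x) = a *: cok_pi f x by exact/esym/cok_scale_pi.
exists (cokernel f), (lin (@cok_piD _ _ f) pZ); split=> [x|x] /=.
  by exists (repr x); exact: cok_piK.
have -> : (cok_pi f x = 0) <-> cok_pi f x = cok_pi f 0.
  by have -> : cok_pi f 0 = 0 by exact: raddf0.
by rewrite cok_pi_eq subr0.
Qed.

Lemma ses_cokernel A B (f : {linear A -> B}) : injective f ->
  exists (C : lmodType S) (p : {linear B -> C}), ses f p.
Proof.
move=> fi; have [C [p [ps pe]]] := cokernel_exists f; by exists C, p; split.
Qed.

Lemma ses_kernel A B (f : {linear A -> B}) : surj f ->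
  exists (K : lmodType S) (i : {linear K -> A}), ses i f.
Proof. by move=> fs; have [K [i [ii ie]]] := kernel_exists f; exists K, i; split. Qed.

End Modules.

(** * Tensor products *)

Section Additive.
Variables (A B : zmodType) (f : A -> B) (fB : {morph f : x y / x - y}).

Definition addmap : {additive A -> B} :=
  HB.pack f (GRing.isZmodMorphism.Build A B f fB).

End Additive.

Lemma add_inj (A B : zmodType) (f : {additive A -> B}) :
  (forall x, f x = 0 -> x = 0) -> injective f.
Proof.
by move=> h x y /eqP; rewrite -subr_eq0 -raddfB => /eqP /h /eqP; rewrite subr_eq0 => /eqP.
Qed.

Lemma add_inj0 (A B : zmodType) (f : {additive A -> B}) x :
  injective f -> f x = 0 -> x = 0.
Proof. by move=> fi; rewrite -[X in _ = X](raddf0 f) => /fi. Qed.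

Section TensorTheory.
Variables (S : pzRingType) (M : lmodType S^c) (N : lmodType S).

Lemma tensor_ind (P : tensor M N -> Prop) : P 0 ->
  (forall x y, P x -> P y -> P (x - y)) -> (forall m n, P (pure m n)) ->
  forall x, P x.
Proof.
move=> P0 PB Pp x; rewrite -[x]reprK.
have PN y : P y -> P (- y) by move=> Py; rewrite -[- y]add0r; apply: PB.
have PD y z : P y -> P z -> P (y + z).
  by move=> Py Pz; rewrite -[z]opprK; apply/PB/PN.
have PM y n : P y -> P (y *+ n).
  by move=> Py; elim: n => [|n IH]; rewrite ?mulr0n // mulrS; apply: PD.
rewrite [repr x]monalgE raddf_sum; elim/big_rec: _ => // k y _ Py.
apply: PD Py; case: k => m n; move: (_@_ _) => z.
have -> : (<< z *g (m, n) >> : {malg int[(M * N)%type]}) = << (m, n) >> *~ z.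
  by rewrite -raddfMz /= intz.
by rewrite raddfMz -/(pure m n); case: z => j; [apply: PM|apply/PN/PM]; apply: Pp.
Qed.

Lemma tensor_eq (A : zmodType) (f g : {additive tensor M N -> A}) :
  (forall m n, f (pure m n) = g (pure m n)) -> forall x, f x = g x.
Proof.
move=> fg; elim/tensor_ind=> [|x y fx fy|//]; first by rewrite !raddf0.
by rewrite !raddfB fx fy.
Qed.

Fact tlift_subproof (A : zmodType) (b : M -> N -> A) : balanced b ->
  {f : {additive tensor M N -> A} | forall m n, f (pure m n) = b m n}.
Proof.
move=> bb; exists (addmap (tensor_liftB bb)) => m n; exact: tensor_lift_pure.
Qed.

Definition tlift (A : zmodType) (b : M -> N -> A) (bb : balanced b) :=
  sval (tlift_subproof bb).

Lemma tliftE (A : zmodType) (b : M -> N -> A) (bb : balanced b) m n :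
  tlift bb (pure m n) = b m n.
Proof. exact: (svalP (tlift_subproof bb)). Qed.

Lemma pureDl (m1 m2 : M) (n : N) : pure (m1 + m2) n = pure m1 n + pure m2 n.
Proof. by have [h _ _] := @pure_balanced S M N. Qed.

Lemma pureDr (m : M) (n1 n2 : N) : pure m (n1 + n2) = pure m n1 + pure m n2.
Proof. by have [_ h _] := @pure_balanced S M N. Qed.

Lemma pureZ (m : M) (s : S) (n : N) : pure ((s : S^c) *: m) n = pure m (s *: n).
Proof. by have [_ _ h] := @pure_balanced S M N. Qed.

Fact purel_sub n : {morph (@pure S M N)^~ n : x y / x - y}.
Proof. by move=> x y; apply/eqP; rewrite -subr_eq opprK -pureDl subrK. Qed.

Fact purer_sub m : {morph @pure S M N m : x y / x - y}.
Proof. by move=> x y; apply/eqP; rewrite -subr_eq opprK -pureDr subrK. Qed.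

HB.instance Definition _ m :=
  GRing.isZmodMorphism.Build N (tensor M N) (@pure S M N m) (purer_sub m).

Definition purel n := addmap (purel_sub n).

Lemma pure0l (n : N) : pure (0 : M) n = 0.
Proof. exact: (raddf0 (purel n)). Qed.

Lemma pure0r (m : M) : pure m (0 : N) = 0.
Proof. exact: raddf0. Qed.

Lemma pure_suml I (r : seq I) (F : I -> M) (n : N) :
  pure (\sum_(i <- r) F i) n = \sum_(i <- r) pure (F i) n.
Proof. exact: (raddf_sum (purel n)). Qed.

Lemma pure_sumr I (r : seq I) (F : I -> N) (m : M) :
  pure m (\sum_(i <- r) F i) = \sum_(i <- r) pure m (F i).
Proof. exact: raddf_sum. Qed.

End TensorTheory.

HB.instance Definition _ (S : pzRingType) (M M' : lmodType S^c) (N N' : lmodType S)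
    (f : {linear M -> M'}) (g : {linear N -> N'}) :=
  GRing.isZmodMorphism.Build (tensor M N) (tensor M' N') (tensor_map f g)
    (tensor_mapB f g).

Section TensorMapTheory.
Variable S : pzRingType.

Lemma tensor_map_comp (M1 M2 M3 : lmodType S^c) (N1 N2 N3 : lmodType S)
    (f : {linear M1 -> M2}) (f' : {linear M2 -> M3}) (f'' : {linear M1 -> M3})
    (g : {linear N1 -> N2}) (g' : {linear N2 -> N3}) (g'' : {linear N1 -> N3}) :
  (forall x, f' (f x) = f'' x) -> (forall x, g' (g x) = g'' x) ->
  forall x, tensor_map f' g' (tensor_map f g x) = tensor_map f'' g'' x.
Proof.
move=> fE gE x; pose h := tensor_map f' g' \o tensor_map f g.
apply: (@tensor_eq _ _ _ _ h (tensor_map f'' g'')) => m n /=.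
by rewrite !tensor_map_pure fE gE.
Qed.

Lemma tensor_map_id (M : lmodType S^c) (N : lmodType S)
    (f : {linear M -> M}) (g : {linear N -> N}) :
  f =1 id -> g =1 id -> tensor_map f g =1 id.
Proof.
move=> fE gE x; apply: (@tensor_eq _ _ _ _ (tensor_map f g) idfun) => m n /=.
by rewrite tensor_map_pure fE gE.
Qed.

(* The kernel of p (x) q is generated by the kernels of p and q: modulo any  *)
(* subgroup U containing them, p (x) q is inverted by lifting each factor.   *)
Lemma tensor_ker (M M' : lmodType S^c) (N N' : lmodType S)
    (p : {linear M -> M'}) (q : {linear N -> N'}) (U : tensor M N -> Prop) :
  surj p -> surj q -> U 0 -> (forall x y, U x -> U y -> U (x - y)) ->
  (forall m n, p m = 0 -> U (pure m n)) -> (forall m n, q n = 0 -> U (pure m n)) ->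
  forall x, tensor_map p q x = 0 -> U x.
Proof.
move=> ps qs U0 UB Up Uq.
pose Ub : {pred tensor M N} := fun x => `[< U x >].
have Uc : zmod_closed Ub.
  split=> [|x y]; rewrite !unfold_in; first exact/asboolP.
  by move=> /asboolP Ux /asboolP Uy; apply/asboolP/UB.
pose UU : zmodClosed (tensor M N) := HB.pack Ub (GRing.isZmodClosed.Build _ Ub Uc).
pose Q := @Quotient.quot _ UU; pose pi (x : tensor M N) : Q := \pi_Q x.
have piE x y : U (x - y) -> pi x = pi y.
  by move=> Uxy; apply/eqP; rewrite -Quotient.idealrBE; apply/asboolP.
have piD x y : pi (x + y) = pi x + pi y by exact: raddfD.
have [s sK] := choose_fun ps; have [t tK] := choose_fun qs.
have El m m' n : p m = p m' -> pi (pure m n) = pi (pure m' n).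
  by move=> e; apply: piE; rewrite -(purel_sub n); apply: Up; rewrite linearB e subrr.
have Er m n n' : q n = q n' -> pi (pure m n) = pi (pure m n').
  by move=> e; apply: piE; rewrite -(purer_sub m); apply: Uq; rewrite linearB e subrr.
have bb : balanced (fun m n => pi (pure (s m) (t n))).
  split=> [m1 m2 n|m n1 n2|m a n].
  - by rewrite -piD -pureDl; apply: El; rewrite linearD !sK.
  - by rewrite -piD -pureDr; apply: Er; rewrite linearD !tK.
  - rewrite (@El _ ((a : S^c) *: s m)); last by rewrite linearZ /= !sK.
    by rewrite pureZ; apply: Er; rewrite linearZ /= !tK.
pose piA : {additive tensor M N -> Q} := \pi_Q.
have liftE x : tlift bb (tensor_map p q x) = piA x.
  apply: (@tensor_eq _ _ _ _ (tlift bb \o tensor_map p q) piA) => m n /=.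
  rewrite tensor_map_pure [LHS]tliftE (@El _ m) ?sK // (@Er _ _ n) ?tK //.
move=> x px0; have : pi x = pi 0.
  by rewrite /pi -/(piA x) -liftE px0 raddf0; exact/esym/(raddf0 piA).
by move/eqP; rewrite -Quotient.idealrBE subr0 => /asboolP.
Qed.

End TensorMapTheory.

Lemma idfun_surj (A : Type) : surj (idfun : A -> A).
Proof. by move=> x; exists x. Qed.

Section Exactness.
Variable S : pzRingType.

Lemma tensor_map_surj (M M' : lmodType S^c) (N N' : lmodType S)
    (p : {linear M -> M'}) (q : {linear N -> N'}) :
  surj p -> surj q -> surj (tensor_map p q).
Proof.
move=> ps qs; elim/tensor_ind=> [|x y [x' <-] [y' <-]|m n].
- by exists 0; rewrite raddf0.
- by exists (x' - y'); rewrite raddfB.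
- have [m' <-] := ps m; have [n' <-] := qs n.
  by exists (pure m' n'); rewrite tensor_map_pure.
Qed.

(** [tensor_ker] is applied with [U] the image of [tensor_map i idfun]: a pure tensor whose left
    factor dies under [p] has that factor in the image of [i]. *)
Lemma tensor_exactl (A B C : lmodType S^c) (i : {linear A -> B})
    (p : {linear B -> C}) (N : lmodType S) : surj p -> exact_at i p ->
  exact_at (tensor_map i (idfun : {linear N -> N}))
           (tensor_map p (idfun : {linear N -> N})).
Proof.
move=> ps ex x; split=> [|[y <-]]; last first.
  rewrite (@tensor_map_comp _ _ _ _ _ _ _ _ _ (\0 : {linear _ -> _}) _ _ idfun) //; last first.
    by move=> z; apply/ex; exists z.
  elim/tensor_ind: y => [|u v hu hv|m n]; rewrite ?raddf0 //.
    by rewrite tensor_mapB hu hv subrr.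
  by rewrite tensor_map_pure /= pure0l.
move: x; apply: tensor_ker => // [|||m n pm|m n /= ->].
- exact: idfun_surj.
- by exists 0; rewrite raddf0.
- by move=> x y [x' <-] [y' <-]; exists (x' - y'); rewrite raddfB.
- by have /ex[a <-] := pm; exists (pure a n); rewrite tensor_map_pure.
- by exists 0; rewrite raddf0 pure0r.
Qed.

Lemma tensor_exactr (M : lmodType S^c) (A B C : lmodType S) (i : {linear A -> B})
    (p : {linear B -> C}) : surj p -> exact_at i p ->
  exact_at (tensor_map (idfun : {linear M -> M}) i)
           (tensor_map (idfun : {linear M -> M}) p).
Proof.
move=> ps ex x; split=> [|[y <-]]; last first.
  rewrite (@tensor_map_comp _ _ _ _ _ _ _ _ _ idfun _ _ (\0 : {linear _ -> _})) //; last first.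
    by move=> z; apply/ex; exists z.
  elim/tensor_ind: y => [|u v hu hv|m n]; rewrite ?raddf0 //.
    by rewrite tensor_mapB hu hv subrr.
  by rewrite tensor_map_pure /= pure0r.
move: x; apply: tensor_ker => // [|||m n /= ->|m n pn].
- exact: idfun_surj.
- by exists 0; rewrite raddf0.
- by move=> x y [x' <-] [y' <-]; exists (x' - y'); rewrite raddfB.
- by exists 0; rewrite raddf0 pure0l.
- by have /ex[a <-] := pn; exists (pure m a); rewrite tensor_map_pure.
Qed.

End Exactness.

(** * Dual bases and flatness *)

(* The library's module structure on {malg S[K]} requires 1 != 0 in S. *)
Definition free_module (S : pzRingType) (K : choiceType) : Type := {malg S[K]}.

Section FreeModule.
Variables (S : pzRingType) (K : choiceType).

HB.instance Definition _ := GRing.Zmodule.on (free_module S K).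

Definition free_scale (c : S) (x : free_module S K) : free_module S K :=
  \sum_(k <- msupp x) << c * x@_k *g k >>.

Lemma free_scaleE c x k : (free_scale c x)@_k = c * x@_k.
Proof.
rewrite {2}[x]monalgE !raddf_sum mulr_sumr.
by apply/eq_bigr=> /= i _; rewrite !mcoeffU mulrnAr.
Qed.

Fact free_scaleA c d x : free_scale c (free_scale d x) = free_scale (c * d) x.
Proof. by apply/malgP=> k; rewrite !free_scaleE mulrA. Qed.
Fact free_scale1 : left_id 1 free_scale.
Proof. by move=> x; apply/malgP=> k; rewrite free_scaleE mul1r. Qed.
Fact free_scaleDr : right_distributive free_scale +%R.
Proof. by move=> c x y; apply/malgP=> k; rewrite !(mcoeffD, free_scaleE) mulrDr. Qed.
Fact free_scaleDl x : {morph free_scale^~ x : c d / c + d}.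
Proof. by move=> c d; apply/malgP=> k; rewrite !(mcoeffD, free_scaleE) mulrDl. Qed.

HB.instance Definition _ := GRing.Zmodule_isLmodule.Build S (free_module S K)
  free_scaleA free_scale1 free_scaleDr free_scaleDl.

Lemma mcoeffZ_free c (x : free_module S K) k : (c *: x)@_k = c * x@_k.
Proof. exact: free_scaleE. Qed.

End FreeModule.

(* sigma p lists the coordinates of p in a generating family indexed by the  *)
(* elements of P themselves.                                                 *)
Definition dual_basis (S : pzRingType) (P : lmodType S)
    (sigma : {linear P -> free_module S P}) : Prop :=
  forall p, p = \sum_(b <- msupp (sigma p)) (sigma p)@_b *: b.

Section DualBasis.
Variables (S : pzRingType) (P : lmodType S).

Section Combination.
Variables (K : choiceType) (V : zmodType) (u : K -> {additive S -> V}).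

(** The coefficients act through additive maps [u k] rather than by scaling vectors, so that [V] may
    be a bare group or a module over another ring, as in [restr_projective] and [gr_lift]. *)
Definition combine (x : free_module S K) : V := \sum_(k <- msupp x) u k x@_k.

Lemma combineEw (D : {fset K}) x : msupp x `<=` D ->
  combine x = \sum_(k <- D) u k x@_k.
Proof.
by move=> le; apply: big_fset_incl => // k _ /mcoeff_outdom ->; rewrite raddf0.
Qed.

Lemma combineB : {morph combine : x y / x - y}.
Proof.
move=> x y; rewrite (combineEw (msuppB_le x y)).
rewrite (combineEw (fsubsetUl (msupp x) (msupp y))).
rewrite (combineEw (fsubsetUr (msupp x) (msupp y))) -sumrB.
by apply: eq_bigr => k _; rewrite mcoeffB raddfB.
Qed.

End Combination.

HB.instance Definition _ (K : choiceType) (V : zmodType) (u : K -> {additive S -> V}) :=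
  GRing.isZmodMorphism.Build (free_module S K) V (combine u) (combineB u).

Section LinComb.
Variables (K : choiceType) (V : lmodType S) (f : K -> V).

Fact scalel_sub (v : V) : {morph (fun s : S => s *: v) : x y / x - y}.
Proof. by move=> x y; rewrite scalerBl. Qed.

Definition lincomb : free_module S K -> V := combine (fun k => addmap (scalel_sub (f k))).

Fact lincombD x y : lincomb (x + y) = lincomb x + lincomb y.
Proof. exact: raddfD. Qed.

Fact lincombZ s x : lincomb (s *: x) = s *: lincomb x.
Proof.
have le : msupp (s *: x) `<=` msupp x.
  apply/fsubsetP => k; rewrite -!mcoeff_neq0 mcoeffZ_free.
  by apply: contra_neq => ->; rewrite mulr0.
rewrite /lincomb (combineEw _ le) /combine scaler_sumr.
by apply: eq_bigr => k _ /=; rewrite mcoeffZ_free scalerA.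
Qed.

Definition lincomb_lin : {linear free_module S K -> V} := lin lincombD lincombZ.

End LinComb.

Lemma lincombU (K : choiceType) (V : lmodType S) (f : K -> V) s k :
  lincomb f (<< s *g k >>) = s *: f k.
Proof. by rewrite /lincomb (combineEw _ msuppU_le) big_seq_fset1 /= mcoeffUU. Qed.

(** [sigma] lifts the identity of [P] through the canonical surjection from the free module on the
    underlying set of [P]. *)
Lemma projective_dual_basis : projective_module P ->
  exists sigma : {linear P -> free_module S P}, dual_basis sigma.
Proof.
move=> /(_ _ _ (lincomb_lin id) idfun) [|sigma sK].
  by move=> b; exists (<< 1 *g b >>); rewrite /= lincombU scale1r.
by exists sigma => p; rewrite -{1}[p]sK.
Qed.

End DualBasis.

Section Flatness.
Variable S : pzRingType.

Section Right.
Variables (P : lmodType S) (sigma : {linear P -> free_module S P}).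
Hypothesis sK : dual_basis sigma.
Variables (A : lmodType S^c).

Fact rcoord_balanced b : balanced (fun (a : A) p => ((sigma p)@_b : S^c) *: a).
Proof.
split=> [a1 a2 p|a p1 p2|a s p].
- by rewrite scalerDr.
- by rewrite linearD mcoeffD scalerDl.
- by rewrite linearZ mcoeffZ_free scalerA.
Qed.

Definition rcoord b : {additive tensor A P -> A} := tlift (rcoord_balanced b).

Lemma rcoordE b a p : rcoord b (pure a p) = ((sigma p)@_b : S^c) *: a.
Proof. exact: tliftE. Qed.

(** Allowing every larger [E] lets two tensors be expanded over a common index set, which the
    induction needs for differences. *)
Lemma rcoord_sum (x : tensor A P) : exists D : {fset P}, forall E, D `<=` E ->
  x = \sum_(b <- E) pure (rcoord b x) b.
Proof.
elim/tensor_ind: x => [|x y [D1 h1] [D2 h2]|a p].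
- by exists fset0 => E _; rewrite big1 // => b _; rewrite raddf0 pure0l.
- exists (D1 `|` D2) => E; rewrite fsubUset => /andP[/h1 e1 /h2 e2].
  by rewrite {1}e1 {1}e2 -sumrB; apply: eq_bigr => b _; rewrite raddfB -purel_sub.
- exists (msupp (sigma p)) => E le.
  rewrite {1}[p]sK (big_fset_incl _ le) /=; last first.
    by move=> b _ /mcoeff_outdom ->; rewrite scale0r.
  by rewrite pure_sumr; apply: eq_bigr => b _; rewrite rcoordE pureZ.
Qed.

Lemma rcoord_eq0 x : (forall b, rcoord b x = 0) -> x = 0.
Proof.
move=> x0; have [D /(_ D (fsubset_refl _)) ->] := rcoord_sum x.
by rewrite big1 // => b _; rewrite x0 pure0l.
Qed.

End Right.

(** The coordinates [rcoord b] commute with [i] and jointly detect zero, so injectivity is inherited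
    coordinate by coordinate. *)
Lemma projective_flat (P : lmodType S) : projective_module P -> flat_module P.
Proof.
move=> /projective_dual_basis [sigma sK] A B i ii.
apply: (@add_inj _ _ (tensor_map i (idfun : {linear P -> P}))) => x x0; apply: (rcoord_eq0 sK) => b; apply: ii.
rewrite linear0 -[RHS](raddf0 (rcoord sigma B b)) -x0.
apply: (@tensor_eq _ _ _ _ (i \o rcoord sigma A b)
  (rcoord sigma B b \o tensor_map i (idfun : {linear P -> P}))) => m n.
by rewrite [LHS]/= [RHS]/= tensor_map_pure !rcoordE linearZ.
Qed.

Section Left.
Variables (P : lmodType S^c) (sigma : {linear P -> free_module S^c P}).
Hypothesis sK : dual_basis sigma.
Variables (A : lmodType S).

Fact lcoord_balanced b : balanced (fun p (a : A) => ((sigma p)@_b : S) *: a).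
Proof.
split=> [p1 p2 a|p a1 a2|p s a].
- by rewrite linearD mcoeffD scalerDl.
- by rewrite scalerDr.
- by rewrite linearZ mcoeffZ_free scalerA.
Qed.

Definition lcoord b : {additive tensor P A -> A} := tlift (lcoord_balanced b).

Lemma lcoordE b a p : lcoord b (pure p a) = ((sigma p)@_b : S) *: a.
Proof. exact: tliftE. Qed.

Lemma lcoord_sum (x : tensor P A) : exists D : {fset P}, forall E, D `<=` E ->
  x = \sum_(b <- E) pure b (lcoord b x).
Proof.
elim/tensor_ind: x => [|x y [D1 h1] [D2 h2]|p a].
- by exists fset0 => E _; rewrite big1 // => b _; rewrite raddf0 pure0r.
- exists (D1 `|` D2) => E; rewrite fsubUset => /andP[/h1 e1 /h2 e2].
  by rewrite {1}e1 {1}e2 -sumrB; apply: eq_bigr => b _; rewrite raddfB -purer_sub.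
- exists (msupp (sigma p)) => E le.
  rewrite {1}[p]sK (big_fset_incl _ le) /=; last first.
    by move=> b _ /mcoeff_outdom ->; rewrite scale0r.
  by rewrite pure_suml; apply: eq_bigr => b _; rewrite lcoordE pureZ.
Qed.

Lemma lcoord_eq0 x : (forall b, lcoord b x = 0) -> x = 0.
Proof.
move=> x0; have [D /(_ D (fsubset_refl _)) ->] := lcoord_sum x.
by rewrite big1 // => b _; rewrite x0 pure0r.
Qed.

End Left.

Lemma projective_lflat (P : lmodType S^c) : projective_module P ->
  forall (A B : lmodType S) (i : {linear A -> B}), injective i ->
    injective (tensor_map (idfun : {linear P -> P}) i).
Proof.
move=> /projective_dual_basis [sigma sK] A B i ii.
apply: (@add_inj _ _ (tensor_map (idfun : {linear P -> P}) i)) => x x0; apply: (lcoord_eq0 sK) => b; apply: ii.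
rewrite linear0 -[RHS](raddf0 (lcoord sigma B b)) -x0.
apply: (@tensor_eq _ _ _ _ (i \o lcoord sigma A b)
  (lcoord sigma B b \o tensor_map (idfun : {linear P -> P}) i)) => m n.
by rewrite [LHS]/= [RHS]/= tensor_map_pure !lcoordE linearZ.
Qed.

End Flatness.

(** * Divisible groups and character modules *)

Lemma zorn (T : Type) (t0 : T) (R : T -> T -> Prop) :
  (forall t, R t t) -> (forall r s t, R r s -> R s t -> R r t) ->
  (forall A : T -> Prop, (exists t, A t) ->
     (forall s t, A s -> A t -> R s t \/ R t s) -> exists t, forall s, A s -> R s t) ->
  exists t, forall s, R t s -> R s t.
Proof.
move=> Rr Rt Ru; pose Rb : rel T := fun s t => `[< R s t >].
have [|||t tmax] := @ZL_preorder T t0 Rb.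
- by move=> t; apply/asboolP.
- by move=> r s t /asboolP rs /asboolP st; apply/asboolP/(Rt _ s).
- move=> A totA; case: (pselect (exists t, A t)) => [neA|A0].
    have [|t tub] := Ru A neA.
      by move=> s t As At; case: (totA s t As At) => /asboolP; [left|right].
    by exists t => s /tub ?; apply/asboolP.
  by exists t0 => s As; case: A0; exists s.
- by exists t => s /asboolP /tmax /asboolP.
Qed.

Section DivisibleExtension.
Variables (B D : zmodType).
Hypothesis D_div : forall n (y : D), exists y', y' *+ n.+1 = y.

(** The graph of an additive map defined on a subgroup of [B]; as relations, partial maps can be
    united along chains. *)
Definition functional_subgroup (G : B -> D -> Prop) : Prop :=
  [/\ G 0 0, forall b c y z, G b y -> G c z -> G (b - c) (y - z)
    & forall y, G 0 y -> y = 0].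

Section Subgroup.
Variables (G : B -> D -> Prop) (fsG : functional_subgroup G).

Lemma fsN b y : G b y -> G (- b) (- y).
Proof. by have [G0 GB _] := fsG; move=> /(GB _ _ _ _ G0); rewrite !sub0r. Qed.

Lemma fsD b c y z : G b y -> G c z -> G (b + c) (y + z).
Proof.
have [_ GB _] := fsG => Gb /fsN Gc.
by rewrite -[c]opprK -[z]opprK; apply: GB.
Qed.

Lemma fsMn b y n : G b y -> G (b *+ n) (y *+ n).
Proof.
move=> Gb; elim: n => [|n IH]; first by case: fsG.
by rewrite !mulrS; apply: fsD.
Qed.

Lemma fs_eq b y z : G b y -> G b z -> y = z.
Proof.
have [_ GB Gf] := fsG => Gy /(GB _ _ _ _ Gy); rewrite subrr => /Gf /eqP.
by rewrite subr_eq0 => /eqP.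
Qed.

(** [y0] is a value at [b] compatible with the partial map. If [n.+1] is the least positive multiple
    of [b] in the domain, it is obtained by dividing the value there by [n.+1]; if there is none,
    [0] serves. *)
Lemma fs_compatible b : exists y0, forall (k : int) y, G (b *~ k) y -> y = y0 *~ k.
Proof.
suff [y0 y0P] : exists y0, forall k y, G (b *+ k) y -> y = y0 *+ k.
  exists y0 => -[k|k] y; first exact: y0P.
  by rewrite !NegzE !mulrNz => /fsN; rewrite opprK => /y0P e; rewrite -[y]opprK e.
case: (pselect (exists n, `[< exists y, G (b *+ n.+1) y >])) => [exn|nex]; last first.
  exists 0 => -[|k] y Gk; first by rewrite mulr0n; case: fsG => _ _; apply; move: Gk; rewrite mulr0n.
  by case: nex; exists k; apply/asboolP; exists y.
case: (ex_minnP exn) => n /asboolP[y1 Gy1] nmin.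
have [y0 y0E] := D_div n y1.
(* The remainder multiple [b *+ r] lies in the domain as well, so minimality forces [r = 0]. *)
exists y0 => k y; rewrite (divn_eq k n.+1); set q := (k %/ _)%N; set r := (k %% _)%N.
rewrite !mulrnDr [(q * _)%N]mulnC !mulrnA y0E => Gk.
have Gr : G (b *+ r) (y - y1 *+ q).
  have [_ GB _] := fsG.
  by have := GB _ _ _ _ Gk (fsMn q Gy1); rewrite addrAC subrr add0r.
have r_lt : (r < n.+1)%N by rewrite ltn_mod.
move: r r_lt Gr {Gk} => [_ Gr|r r_lt Gr].
  move: Gr; rewrite mulr0n; have [_ _ Gf] := fsG => /Gf /eqP.
  by rewrite subr_eq0 addr0 => /eqP.
have : (n <= r)%N by apply: nmin; apply/asboolP; eexists; exact: Gr.
by rewrite leqNgt -ltnS r_lt.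
Qed.

End Subgroup.

(** Baer's argument over the integers: a maximal partial extension is total, since [fs_compatible]
    allows one more element [b] to be adjoined with value [y0]. *)
Lemma divisible_extension (G0 : B -> D -> Prop) : functional_subgroup G0 ->
  exists h : {additive B -> D}, forall b y, G0 b y -> h b = y.
Proof.
move=> fs0.
pose T := {G : B -> D -> Prop | functional_subgroup G /\ forall b y, G0 b y -> G b y}.
pose R (G G' : T) := forall b y, sval G b y -> sval G' b y.
have [||A [t1 AG] totA|[G [fsG leG]] Gmax] :=
    @zorn T (exist _ G0 (conj fs0 (fun _ _ => id))) R.
- by move=> G b y.
- by move=> G G' G'' h h' b y /h /h'.
- pose U b y := exists2 G : T, A G & sval G b y.
  have Uge G b y : A G -> sval G b y -> U b y by move=> ?; exists G.
  have fsU : functional_subgroup U.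
    split=> [|b c y z [G AG1 Gby] [G' AG' Gcz]|y [G AG1]].
    - by apply: (Uge _ _ _ AG); case: (svalP t1) => -[].
    - have [h|h] := totA _ _ AG1 AG'.
        by apply: (Uge _ _ _ AG'); have [[_ GB _] _] := svalP G'; apply: GB (Gcz); apply: h.
      by apply: (Uge _ _ _ AG1); have [[_ GB _] _] := svalP G; apply: GB (Gby) _; apply: h.
    - by have [[_ _ Gf] _] := svalP G; apply: Gf.
  have Ule b y : G0 b y -> U b y by move=> ?; apply: (Uge _ _ _ AG); case: (svalP t1) => _; apply.
  by exists (exist _ U (conj fsU Ule)) => G AG1 b y; apply: Uge.
have tot b : exists y, G b y.
  have [y0 y0P] := fs_compatible fsG b.
  pose G' c z := exists k c' z', [/\ G c' z', c = c' + b *~ k & z = z' + y0 *~ k].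
  have [G00 GB Gf] := fsG.
  have leG' c z : G c z -> G' c z.
    by move=> Gc; exists 0, c, z; rewrite !mulr0z !addr0.
  have fsG' : functional_subgroup G'.
    split; first exact: leG'.
    - move=> _ _ _ _ [k [c [z [Gc -> ->]]]] [k' [c' [z' [Gc' -> ->]]]].
      exists (k - k'), (c - c'), (z - z'); split; first exact: GB.
        by rewrite mulrzBr opprD addrACA.
      by rewrite mulrzBr opprD addrACA.
    - move=> _ [k [c [z [Gc e ->]]]].
      have : G (b *~ k) (- z).
        have -> : b *~ k = - c by apply/eqP; rewrite -addr_eq0 addrC -e.
        exact: fsN.
      by move=> /y0P <-; rewrite subrr.
  have leG0' c z : G0 c z -> G' c z by move/leG/leG'.
  exists y0; apply: (Gmax (exist _ G' (conj fsG' leG0'))); first exact: leG'.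
  by exists 1, 0, 0; rewrite !mulr1z !add0r.
have [h hP] := choose_fun tot.
have hB : {morph h : x y / x - y}.
  move=> x y; apply: (fs_eq fsG) (hP _) _; have [_ GB _] := fsG.
  exact: GB (hP x) (hP y).
by exists (addmap hB) => b y /leG Gb; apply: (fs_eq fsG) (hP b) Gb.
Qed.

End DivisibleExtension.

Definition rat_int : {pred rat} := fun x => `[< exists z : int, x = z%:~R >].

Fact rat_int_closed : zmod_closed rat_int.
Proof.
split=> [|x y]; rewrite !unfold_in; first by apply/asboolP; exists 0.
move=> /asboolP [a ->] /asboolP [b ->]; apply/asboolP.
by exists (a - b); rewrite rmorphB.
Qed.

HB.instance Definition _ := GRing.isZmodClosed.Build rat rat_int rat_int_closed.

Definition QZ : zmodType := @Quotient.quot _ rat_int.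

Lemma QZ_divisible n (y : QZ) : exists y', y' *+ n.+1 = y.
Proof.
exists (\pi_(@Quotient.quot _ rat_int) (repr (y : @Quotient.quot _ rat_int) / n.+1%:R)).
rewrite -raddfMn -[_ *+ _]mulr_natr divfK ?pnatr_eq0 //; exact: (@reprK _ (@Quotient.quot _ rat_int) y).
Qed.

(** The class of [1/(n+2)]; the shift by two keeps this fraction from being an integer. *)
Lemma QZ_torsion n : exists2 y : QZ, y != 0 & y *+ n.+2 = 0.
Proof.
pose pi (x : rat) : QZ := \pi_(@Quotient.quot _ rat_int) x.
have pi0 x : pi x = 0 <-> exists z : int, x = z%:~R.
  have -> : (pi x = 0) <-> pi x == pi 0 by rewrite [pi 0]raddf0; split=> /eqP.
  by rewrite /pi -Quotient.idealrBE subr0; split=> /asboolP.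
exists (pi (n.+2%:R^-1)); last first.
  rewrite /pi -raddfMn; apply/pi0; exists 1.
  by rewrite -[_ *+ _]mulr_natr mulVf // pnatr_eq0.
apply/eqP => /pi0 [z e].
have : z%:~R * n.+2%:R = 1 :> rat by rewrite -e mulVf // pnatr_eq0.
rewrite -[n.+2%:R]/(n.+2%:~R) -intrM => /eqP; rewrite -[1]/(1%:~R) eqr_int => /eqP.
move=> /(congr1 absz); rewrite abszM /= => /eqP; rewrite muln_eq1 => /andP[_ //].
Qed.

(* The right S-module Hom_Z(S, QZ)^K. *)
Section CharacterModule.
Variables (S : pzRingType) (K : Type).

Record charmod := Charmod {
  cm_val : K -> S -> QZ;
  cm_sub : forall k, {morph cm_val k : x y / x - y}
}.

Lemma cm_valDr f k x y : cm_val f k (x + y) = cm_val f k x + cm_val f k y.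
Proof. exact: (raddfD (addmap (cm_sub f k))). Qed.

Lemma cm_val0r f k : cm_val f k 0 = 0.
Proof. exact: (raddf0 (addmap (cm_sub f k))). Qed.

Lemma charmodP (f g : charmod) : (forall k s, cm_val f k s = cm_val g k s) -> f = g.
Proof.
case: f g => [f fB] [g gB] /= fg.
have E : f = g by apply/funext => k; apply/funext => s; apply: fg.
by case: _ / E gB {fg} => gB; congr Charmod; apply: Prop_irrelevance.
Qed.

HB.instance Definition _ := gen_eqMixin charmod.
HB.instance Definition _ := gen_choiceMixin charmod.

Fact cm0_sub (k : K) : {morph (fun _ : S => 0 : QZ) : x y / x - y}.
Proof. by move=> x y; rewrite subrr. Qed.
Definition cm0 := @Charmod (fun _ _ => 0) cm0_sub.

Fact cmN_sub f k : {morph (fun s => - cm_val f k s) : x y / x - y}.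
Proof. by move=> x y; rewrite cm_sub opprD. Qed.
Definition cmN f := @Charmod (fun k s => - cm_val f k s) (cmN_sub f).

Fact cmD_sub f g k : {morph (fun s => cm_val f k s + cm_val g k s) : x y / x - y}.
Proof. by move=> x y; rewrite !cm_sub opprD addrACA. Qed.
Definition cmD f g := @Charmod (fun k s => cm_val f k s + cm_val g k s) (cmD_sub f g).

Fact cmDA : associative cmD.
Proof. by move=> f g h; apply: charmodP => k s /=; rewrite addrA. Qed.
Fact cmDC : commutative cmD.
Proof. by move=> f g; apply: charmodP => k s /=; rewrite addrC. Qed.
Fact cm0D : left_id cm0 cmD.
Proof. by move=> f; apply: charmodP => k s /=; rewrite add0r. Qed.
Fact cmND : left_inverse cm0 cmN cmD.
Proof. by move=> f; apply: charmodP => k s /=; rewrite addNr. Qed.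

HB.instance Definition _ := GRing.isZmodule.Build charmod cmDA cmDC cm0D cmND.

Fact cmZ_sub (s : S^c) f k : {morph (fun t : S => cm_val f k ((s : S) * t)) : x y / x - y}.
Proof. by move=> x y; rewrite mulrBr cm_sub. Qed.
Definition cmZ (s : S^c) f := @Charmod _ (cmZ_sub s f).

Fact cmZA s t f : cmZ s (cmZ t f) = cmZ (s * t) f.
Proof. by apply: charmodP => k u /=; rewrite mulrA. Qed.
Fact cmZ1 : left_id 1 cmZ.
Proof. by move=> f; apply: charmodP => k u /=; rewrite mul1r. Qed.
Fact cmZDr : right_distributive cmZ +%R.
Proof. by move=> s f g; apply: charmodP. Qed.
Fact cmZDl f : {morph cmZ^~ f : s t / s + t}.
Proof.
by move=> s t; apply: charmodP => k u /=; rewrite mulrDl cm_valDr.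
Qed.

HB.instance Definition _ := GRing.Zmodule_isLmodule.Build S^c charmod cmZA cmZ1 cmZDr cmZDl.

Lemma cm_valZ (s : S^c) (f : charmod) k t : cm_val (s *: f) k t = cm_val f k ((s : S) * t).
Proof. by []. Qed.

Fact cm_at_sub k t : {morph (fun f : charmod => cm_val f k t) : x y / x - y}.
Proof. by []. Qed.

Definition cm_at k t : {additive charmod -> QZ} := addmap (cm_at_sub k t).

(** A linear map into [charmod] is determined by the characters obtained on evaluating at [1], one
    for each [k]; these extend along [i] because [QZ] is divisible. *)
Lemma charmod_injective : @injective_module S^c charmod.
Proof.
move=> A B i f ii.
have [h hE] : exists h : K -> {additive B -> QZ},
    forall k a, h k (i a) = cm_val (f a) k 1.
  apply: (@choose_fun K {additive B -> QZ}
           (fun k hk => forall a, hk (i a) = cm_val (f a) k 1)) => k.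
  pose G b y := exists2 a, b = i a & y = cm_val (f a) k 1.
  have fsG : functional_subgroup G.
    split=> [|b c y z [a -> ->] [a' -> ->]|y [a e ->]].
    - by exists 0; rewrite linear0.
    - by exists (a - a'); rewrite linearB.
    - by rewrite (inj_eq0 ii (esym e)) linear0.
  have [h hP] := divisible_extension QZ_divisible fsG.
  by exists h => a; apply: hP; exists a.
have gB b k : {morph (fun t : S => h k ((t : S^c) *: b)) : x y / x - y}.
  by move=> x y; rewrite scalerBl raddfB.
pose g b := Charmod (gB b).
have gD x y : g (x + y) = g x + g y.
  by apply: charmodP => k t /=; rewrite scalerDr raddfD.
have gZ (s : S^c) x : g (s *: x) = s *: g x.
  by apply: charmodP => k t /=; rewrite scalerA.
exists (lin gD gZ) => a; apply: charmodP => k t /=.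
by rewrite -linearZ hE linearZ cm_valZ mulr1.
Qed.

End CharacterModule.

Section CoordinateSeparation.
Variables (S : pzRingType) (r : nat).

(** [QZ] cogenerates abelian groups: the character that is [0] on [M] and [y] at [c] is well defined
    on the subgroup they generate, and extends by divisibility. *)
Lemma separate (M : 'rV[S]_r -> Prop) (c : 'rV[S]_r) :
  M 0 -> (forall x y, M x -> M y -> M (x - y)) -> ~ M c ->
  exists2 h : {additive 'rV[S]_r -> QZ}, forall x, M x -> h x = 0 & h c <> 0.
Proof.
move=> M0 MB Mc.
have MN x : M x -> M (- x) by move=> Mx; rewrite -sub0r; apply: MB.
have MD x y : M x -> M y -> M (x + y).
  by move=> Mx My; rewrite -[y]opprK; apply/MB/MN.
have MMn x n : M x -> M (x *+ n).
  by move=> Mx; elim: n => [|n IH]; rewrite ?mulr0n // mulrS; apply: MD.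
(* The order of [y] must divide the order of [c] modulo [M]. If that order is infinite any torsion
   element will do; otherwise it is at least [2] because [c] is not in [M], which is the range
   covered by [QZ_torsion]. *)
have [y [y0 yP]] : exists y : QZ, y != 0 /\ forall k, M (c *+ k) -> y *+ k = 0.
  case: (pselect (exists n, `[< M (c *+ n.+1) >])) => [exn|nex]; last first.
    have [y y0 _] := QZ_torsion 0; exists y; split=> // -[|k] Mk; first by rewrite mulr0n.
    by case: nex; exists k; apply/asboolP.
  case: (ex_minnP exn) => -[/asboolP|n /asboolP Mn nmin]; first by rewrite mulr1n.
  have [y y0 yn] := QZ_torsion n; exists y; split=> // k.
  rewrite (divn_eq k n.+2); set q := (k %/ _)%N; set t := (k %% _)%N.
  rewrite !mulrnDr [(q * _)%N]mulnC !mulrnA yn mul0rn add0r => Mk.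
  have : M (c *+ t).
    by have := MB _ _ Mk (MMn _ q Mn); rewrite addrAC subrr add0r.
  have t_lt : (t < n.+2)%N by rewrite ltn_mod.
  case: t t_lt {Mk} => [|t] t_lt Mt; first by rewrite mulr0n.
  have : (n.+1 <= t)%N by apply: nmin; apply/asboolP.
  by rewrite leqNgt -ltnS t_lt.
have yP' (k : int) : M (c *~ k) -> y *~ k = 0.
  case: k => k; first exact: yP.
  rewrite -[c *~ _]/(- (c *+ k.+1)) -[y *~ _]/(- (y *+ k.+1)) => /MN.
  by rewrite opprK => /yP ->; rewrite oppr0.
pose G x z := exists k m, [/\ M m, x = m + c *~ k & z = y *~ k].
have fsG : functional_subgroup G.
  split=> [|_ _ _ _ [k [m [Mm -> ->]]] [k' [m' [Mm' -> ->]]]|_ [k [m [Mm e ->]]]].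
  - by exists 0, 0; rewrite !mulr0z addr0.
  - by exists (k - k'), (m - m'); rewrite !mulrzBr opprD addrACA; split=> //; apply: MB.
  - apply: yP'; have -> : c *~ k = - m by apply/eqP; rewrite -addr_eq0 addrC -e.
    exact: MN.
have [h hP] := divisible_extension QZ_divisible fsG.
exists h => [x Mx|]; first by apply: hP; exists 0, x; rewrite !mulr0z addr0.
by rewrite (hP c y); [apply/eqP|exists 1, 0; rewrite !mulr1z add0r].
Qed.

End CoordinateSeparation.

(** * Finitary exactness of the dual of a complex tested by injectives *)

Section LocalExactness.
Variables (S : pzRingType) (P : complex S) (n : int).
Hypothesis P_proj : forall n, projective_module (ob P n).
Hypothesis P_tens : forall I : lmodType S^c, injective_module I -> tensor_acyclic I P.

(** By contradiction: each finite [q] would have a counterexample [phi q]. All of them are packed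
    into one injective module, with one character coordinate for each [q], and into one cycle [x] of
    its tensor product with [P]. A boundary involves only finitely many elements of the complex, and
    the coordinate indexed by these very elements yields the contradiction. *)
Lemma functional_local_exactness (p : seq (ob P (n + 1))) :
  exists q : seq (ob P (n + 1 + 1)), forall phi : {linear ob P (n + 1) -> S^o},
    (forall x, x \in q -> phi (diff P (n + 1) x) = 0) ->
    exists psi : {linear ob P n -> S^o},
      forall x, x \in p -> psi (diff P n x) = phi x.
Proof.
apply: contrapT => nq; pose K := seq (ob P (n + 1 + 1)).
pose r := size p; pose e (i : 'I_r) := nth 0 p i.
have [phi phiP] : exists phi : K -> {linear ob P (n + 1) -> S^o}, forall q,
    (forall x, x \in q -> phi q (diff P (n + 1) x) = 0) /\
    ~ exists psi : {linear ob P n -> S^o}, forall i, psi (diff P n (e i)) = phi q (e i).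
  apply: (@choose_fun K {linear ob P (n + 1) -> S^o} (fun q f =>
    (forall x, x \in q -> f (diff P (n + 1) x) = 0) /\
    ~ exists psi : {linear ob P n -> S^o}, forall i, psi (diff P n (e i)) = f (e i))) => q.
  apply: contrapT => nphi; apply: nq; exists q => phi phi0.
  apply: contrapT => npsi; apply: nphi; exists phi; split=> // -[psi psiE].
  apply: npsi; exists psi => x /(nthP 0)[i ilt <-]; exact: (psiE (Ordinal ilt)).
pose M (v : 'rV[S]_r) := exists psi : {linear ob P n -> S^o},
  forall i, v 0 i = psi (diff P n (e i)).
have M0 : M 0 by exists \0 => i; rewrite mxE.
have MB x y : M x -> M y -> M (x - y).
  by move=> [f fE] [g gE]; exists (f \- g) => i; rewrite !mxE fE gE.
(* Functionals into [S] can be multiplied on the right, so a character killing [M] also kills every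
   right multiple of a coboundary; [dx] needs this for all arguments [t]. *)
have Mmul (psi : {linear ob P n -> S^o}) t : M (\row_i (psi (diff P n (e i)) * t)).
  have gD x y : (psi (x + y) : S) * t = (psi x : S) * t + (psi y : S) * t.
    by rewrite linearD -mulrDl.
  have gZ s x : (psi (s *: x) : S) * t = s * ((psi x : S) * t).
    by rewrite linearZ mulrA.
  by exists (@lin _ _ (S^o) _ gD gZ) => i; rewrite mxE.
pose c q : 'rV[S]_r := \row_i phi q (e i).
have [h hP] : exists h : K -> {additive 'rV[S]_r -> QZ}, forall q,
    (forall x, M x -> h q x = 0) /\ h q (c q) <> 0.
  apply: (@choose_fun K {additive 'rV[S]_r -> QZ} (fun q h =>
    (forall x, M x -> h x = 0) /\ h (c q) <> 0)) => q.
  have [|h h0 hc] := @separate S r M (c q) M0 MB.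
    move=> [psi psiE]; have [_] := phiP q; apply; exists psi => i.
    by rewrite -psiE mxE.
  by exists h.
have jB i q : {morph (fun s : S => h q (s *: delta_mx 0 i)) : x y / x - y}.
  by move=> x y; rewrite scalerBl raddfB.
have deltaE (v : 'rV[S]_r) : v = \sum_i v 0 i *: delta_mx 0 i by rewrite {1}[v]row_sum_delta.
pose j i : charmod S K := Charmod (jB i).
have Jinj := @charmod_injective S K.
pose x : tensor (charmod S K) (ob P (n + 1)) := \sum_i pure (j i) (e i).
have ex := @P_tens _ Jinj n x.
(* Evaluated at [q] and [t], the [b]-th coordinate is [h q] of the row of values of a coordinate
   functional on the [diff P n (e i)], multiplied by [t]. This row lies in [M]. *)
have dx : tensor_map (idfun : {linear charmod S K -> charmod S K}) (diff P n) x = 0.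
  have [sigma sK] := projective_dual_basis (@P_proj n).
  apply: (rcoord_eq0 sK) => b; apply: charmodP => q t.
  have := hP q => -[h0 _].
  pose F := cm_at q t \o rcoord sigma (charmod S K) b \o
    tensor_map (idfun : {linear charmod S K -> charmod S K}) (diff P n).
  have psiD y z : (sigma (y + z))@_b = (sigma y)@_b + (sigma z)@_b.
    by rewrite linearD mcoeffD.
  have psiZ s y : (sigma (s *: y))@_b = s * (sigma y)@_b.
    by rewrite linearZ mcoeffZ_free.
  have := h0 _ (Mmul (@lin _ _ (S^o) _ psiD psiZ) t).
  rewrite [X in h q X]deltaE raddf_sum => hs; rewrite -[RHS]hs.
  have -> : cm_val (rcoord sigma (charmod S K) b (tensor_map idfun (diff P n) x)) q t =
      \sum_i F (pure (j i) (e i)) by exact: (raddf_sum F).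
  apply: eq_bigr => i _; transitivity (cm_val (rcoord sigma (charmod S K) b
      (tensor_map (idfun : {linear charmod S K -> charmod S K}) (diff P n)
        (pure (j i) (e i)))) q t) => //.
  by rewrite tensor_map_pure rcoordE mxE.
have [y yx] := ex.1 dx.
(* [q] lists the right factors occurring in an expression of [y] by pure tensors. *)
have [q qP] : exists q : K, forall f : {additive tensor (charmod S K) (ob P (n + 1)) -> QZ},
    (forall a z, z \in q -> f (pure a (diff P (n + 1) z)) = 0) -> f x = 0.
  have [q qP] : exists q : K, exists a : seq (charmod S K),
     forall f : {additive tensor (charmod S K) (ob P (n + 1 + 1)) -> QZ},
       (forall a z, z \in q -> f (pure a z) = 0) -> f y = 0.
    elim/tensor_ind: y {yx} => [|u v [q [_ qP]] [q' [_ qP']]|a z].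
    - by exists nil, nil => f _; rewrite raddf0.
    - exists (q ++ q'), nil => f f0; rewrite raddfB qP ?qP' ?subrr // => a z zq.
        by apply: f0; rewrite mem_cat zq orbT.
      by apply: f0; rewrite mem_cat zq.
    - by exists [:: z], nil => f; apply; rewrite mem_head.
  exists q => f f0; rewrite -yx; have [_ qP'] := qP.
  apply: (qP' (f \o tensor_map idfun (diff P (n + 1)))) => a z zq /=.
  by rewrite tensor_map_pure f0.
have [h0 hc] := hP q.
(* The resulting functional kills the boundaries of [q], hence kills [x]; but its value at [x] is
   [h q (c q)], which is non-zero. *)
have bal : balanced (fun (f : charmod S K) z => cm_val f q (phi q z : S)).
  split=> [f g z|f y1 y2|f s z].
  - by [].
  - by rewrite linearD cm_valDr.
  - by rewrite linearZ.
apply: hc; rewrite [c q]deltaE raddf_sum -[RHS](qP (tlift bal)).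
  by rewrite /x raddf_sum; apply: eq_bigr => i _; rewrite tliftE /= mxE.
move=> a z zq; rewrite tliftE; have [/(_ z zq) -> _] := phiP q.
exact: cm_val0r.
Qed.

End LocalExactness.

(** * Vanishing of Ext^1 from PGF modules to projective modules *)

Section Extension.
Variables (S : pzRingType) (W : lmodType S) (P : int -> lmodType S).
Variable d : forall i j : int, i = j + 1 -> {linear P i -> P j}.
Variable sigma : forall i, {linear P i -> free_module S (P i)}.
Hypothesis sK : forall i, dual_basis (sigma i).
Hypothesis dd0 : forall i j k (e : i = j + 1) (e' : j = k + 1) x, d e' (d e x) = 0.

Implicit Types (i j k : int).

Lemma lincomb_eq (V : lmodType S) i (f : {linear P i -> V}) (g : P i -> V) x :
  (forall b, b \in msupp (sigma i x) -> g b = f b) -> lincomb g (sigma i x) = f x.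
Proof.
move=> fg; rewrite [in RHS](@sK i x) linear_sum /=; apply: eq_big_seq => b bx.
by rewrite linearZ /= fg.
Qed.

Definition locally_exact i j k (e : i = j + 1) (e' : j = k + 1) (E : seq (P j))
    (G : seq (P i)) : Prop :=
  forall eta : {linear P j -> W}, (forall g, g \in G -> eta (d e g) = 0) ->
  exists theta : {linear P k -> W}, forall x, x \in E -> theta (d e' x) = eta x.

Hypothesis local : forall i j k (e : i = j + 1) (e' : j = k + 1) E,
  exists G, locally_exact e e' E G.

Definition family := forall i, P i -> Prop.

(** The sets [A i] are generating sets, not submodules. [closed_supp] makes the map [rho] below a
    projection onto the span of [A i], so that this span is a direct summand; [closed_local] asks
    that witnesses of local exactness can be found without leaving [A]. *)
Record closed (A : family) : Prop := Closed {
  closed_supp : forall i x b, A i x -> b \in msupp (sigma i x) -> A i b;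
  closed_diff : forall i j (e : i = j + 1) x, A i x -> A j (d e x);
  closed_local : forall i j k (e : i = j + 1) (e' : j = k + 1) E,
    (forall x, x \in E -> A j x) ->
    exists2 G, forall g, g \in G -> A i g & locally_exact e e' E G
}.

Section Projection.
Variable A : family.

Fact rho_subproof i : {f : {linear P i -> P i} |
  forall x, f x = lincomb (fun b => if `[< @A i b >] then b else 0) (sigma i x)}.
Proof. by exists (lincomb_lin (fun b => if `[< @A i b >] then b else 0) \o sigma i). Qed.

Definition rho i := sval (rho_subproof i).

Lemma rhoE i x :
  rho i x = lincomb (fun b => if `[< @A i b >] then b else 0) (sigma i x).
Proof. exact: (svalP (rho_subproof i)). Qed.

Lemma rho_id (cA : closed A) i x : @A i x -> rho i x = x.
Proof.
move=> Ax; rewrite rhoE; apply: (@lincomb_eq _ _ idfun) => b bx.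
by case: asboolP => // nA; case: nA; apply: closed_supp Ax bx.
Qed.

Lemma rho_eq0 (V : lmodType S) i (f : {linear P i -> V}) x :
  (forall b, @A i b -> b \in msupp (sigma i x) -> f b = 0) -> f (rho i x) = 0.
Proof.
move=> f0; rewrite rhoE /lincomb /combine linear_sum big1_seq // => b /andP[_ bx] /=.
by rewrite linearZ /=; case: asboolP => [/f0 ->|_]; rewrite ?linear0 ?scaler0.
Qed.

(** For [x] in [E], [rho i x] is a combination of these elements, so a map vanishing on them
    vanishes at [rho i x]. *)
Definition trace i (E : seq (P i)) : seq (P i) :=
  [seq b <- flatten [seq (msupp (sigma i x) : seq (P i)) | x <- E] | `[< @A i b >]].

Lemma traceA i (E : seq (P i)) b : b \in trace E -> @A i b.
Proof. by rewrite mem_filter => /andP[/asboolP]. Qed.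

Lemma mem_trace i (E : seq (P i)) x b :
  x \in E -> @A i b -> b \in msupp (sigma i x) -> b \in trace E.
Proof.
move=> xE Ab bx; rewrite mem_filter; apply/andP; split; first exact/asboolP.
by apply/flattenP; exists (msupp (sigma i x) : seq (P i)) => //; apply/mapP; exists x.
Qed.

(** Local exactness for the quotient of the complex by the span of [A]. *)
Definition relatively_exact i j k (e : i = j + 1) (e' : j = k + 1) (E : seq (P j))
    (G : seq (P i)) : Prop :=
  forall eta : {linear P j -> W}, (forall x, @A j x -> eta x = 0) ->
  (forall g, g \in G -> eta (d e g) = 0) ->
  exists2 theta : {linear P k -> W}, forall x, @A k x -> theta x = 0
    & forall x, x \in E -> theta (d e' x) = eta x.

(** An absolute solution [psi] is corrected twice. Subtracting [theta \o d e''] makes it vanish on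
    the elements of [A] in the supports of [d e' x], for [x] in [E]; then subtracting its composite
    with [rho] makes it vanish on all of [A], without changing its values at those [d e' x]. *)
Lemma closed_relatively_exact (cA : closed A) i j k (e : i = j + 1) (e' : j = k + 1) E :
  exists G, relatively_exact e e' E G.
Proof.
pose e'' : k = k - 1 + 1 := esym (subrK 1 k).
have [G' AG' G'P] := closed_local cA e' e'' (@traceA _ [seq d e' x | x <- E]).
have [G GP] := local e e' (E ++ G').
exists G => eta eta0 /GP [psi psiE].
have [|theta thetaE] := G'P psi.
  by move=> g gG; rewrite psiE ?mem_cat ?gG ?orbT // eta0 //; apply: AG'.
have [psi' psi'E] : exists f : {linear P k -> W}, forall x, f x = psi x - theta (d e'' x).
  by exists (psi \- (theta \o d e'')).
exists (psi' \- (psi' \o rho k)) => x xP /=; first by rewrite rho_id // subrr.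
rewrite rho_eq0 ?subr0; first by rewrite psi'E dd0 linear0 subr0 psiE // mem_cat xP.
move=> b Ab bx; rewrite psi'E thetaE ?subrr //; apply: mem_trace Ab bx.
exact: map_f.
Qed.

End Projection.

(** One round of closing off: every demand on [E] is met in [E']. A round adds finitely many
    elements in each degree, so countably many rounds suffice. *)
Definition grows (A : family) (E : forall i, seq (P i)) (E' : forall i, seq (P i)) :=
  [/\ forall i x, x \in E i -> x \in E' i,
      forall i x b, x \in E i -> b \in msupp (sigma i x) -> b \in E' i,
      forall i j (e : i = j + 1) x, x \in E i -> d e x \in E' j
    & forall i j k (e : i = j + 1) (e' : j = k + 1), exists2 G,
        forall g, g \in G -> g \in E' i & relatively_exact A e e' (E j) G].

Lemma grows_exists A E : closed A -> exists E', grows A E E'.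
Proof.
move=> cA.
have [Gf GfP] : exists Gf : forall i, seq (P i), forall i,
    relatively_exact A (esym (subrK 1 i)) (esym (subrK 1 (i - 1))) (E (i - 1)) (Gf i).
  pose Q i G := relatively_exact A (esym (subrK 1 i)) (esym (subrK 1 (i - 1))) (E (i - 1)) G.
  have h i : exists G, Q i G by apply: closed_relatively_exact.
  by exists (fun i => projT1 (cid (h i))) => i; case: cid.
(* Degree [i] receives supports from its own degree, boundaries from [i + 1], and from [Gf i] the
   witnesses demanded by [E (i - 1)]. *)
exists (fun i => E i ++ flatten [seq (msupp (sigma i x) : seq (P i)) | x <- E i] ++
  [seq d (erefl (i + 1)) x | x <- E (i + 1)] ++ Gf i).
split=> [i x xE|i x b xE bx|i j e x xE|i j k e e'].
- by rewrite mem_cat xE.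
- rewrite !mem_cat; apply/orP; right; apply/orP; left.
  by apply/flattenP; exists (msupp (sigma i x) : seq (P i)) => //; apply/mapP; exists x.
- by subst i; rewrite !mem_cat map_f // !orbT.
- have ej : j = i - 1 by rewrite e addrK.
  have ek : k = i - 1 - 1 by rewrite -ej e' addrK.
  move: e e'; rewrite ek ej => e e'; exists (Gf i) => [g gG|]; first by rewrite !mem_cat gG !orbT.
  by rewrite (eq_irrelevance e (esym (subrK 1 i))) (eq_irrelevance e' (esym (subrK 1 (i - 1)))).
Qed.

Section Chain.
Variables (A : family) (cA : closed A) (E : nat -> forall i, seq (P i)).
Hypothesis E_grows : forall m, grows A (E m) (E m.+1).

Lemma chain_le m n i x : (m <= n)%N -> x \in E m i -> x \in E n i.
Proof.
move=> /subnKC <-; elim: (n - m)%N => [|q IH]; rewrite ?addn0 // addnS => /IH.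
by have [+ _ _ _] := E_grows (m + q); apply.
Qed.

Definition chain_union : family := fun i x => @A i x \/ exists m, x \in E m i.

Lemma chain_union_seq i (F : seq (P i)) : (forall x, x \in F -> chain_union x) ->
  exists m, forall x, x \in F -> @A i x \/ x \in E m i.
Proof.
elim: F => [|y F IH] AF; first by exists 0%N.
have [m mP] : exists m, forall x, x \in F -> @A i x \/ x \in E m i.
  by apply: IH => x xF; apply: AF; rewrite inE xF orbT.
have [Ay|[n yn]] := AF y (mem_head _ _).
  by exists m => x; rewrite inE => /predU1P [->|/mP]; [left|].
exists (maxn m n) => x; rewrite inE => /predU1P [->|/mP [Ax|xm]]; [right|by left|right].
  by apply: chain_le yn; rewrite leq_maxr.
by apply: chain_le xm; rewrite leq_maxl.
Qed.

Lemma chain_union_closed : closed chain_union.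
Proof.
split=> [i x b|i j e x|i j k e e' F FA].
- move=> [Ax|[m xm]] bx; first by left; apply: closed_supp Ax bx.
  by right; exists m.+1; have [_ + _ _] := E_grows m; apply; [exact: xm|].
- move=> [Ax|[m xm]]; first by left; apply: closed_diff.
  by right; exists m.+1; have [_ _ + _] := E_grows m; apply.
have [m mP] := chain_union_seq FA.
have [_ _ _ /(_ i j k e e') [G1 G1E G1P]] := E_grows m.
(* First [psi1] solves the problem on [E2], inside [A]; the rest, made to vanish on [A] by means of
   [rho], is solved by [psi2] relative to [A]. The two traces in [E2] ensure that the correction by
   [rho] is invisible both on [F] and on the boundaries of [G1]. *)
pose E2 := [seq x <- F | `[< @A j x >]] ++ trace A F ++ trace A [seq d e g | g <- G1].
have [|G2 AG2 G2P] := closed_local cA e e' (E := E2).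
  move=> x; rewrite !mem_cat => /or3P [|/traceA //|/traceA //].
  by rewrite mem_filter => /andP[/asboolP].
exists (G1 ++ G2) => [g|eta eta0].
  by rewrite mem_cat => /orP[/G1E gE|/AG2]; [right; exists m.+1|left].
have [|psi1 psi1E] := G2P eta.
  by move=> g gG; apply: eta0; rewrite mem_cat gG orbT.
have [phi1 phi1E] : exists f : {linear P j -> W}, forall x, f x = eta x - psi1 (d e' x).
  by exists (eta \- (psi1 \o d e')).
have phi1_0 x : x \in E2 -> phi1 x = 0 by move=> xE; rewrite phi1E psi1E // subrr.
have [phi2 phi2E] : exists f : {linear P j -> W}, forall x,
    f x = phi1 x - phi1 (rho A j x).
  by exists (phi1 \- (phi1 \o rho A j)).
have [||psi2 psi2A psi2E] := G1P phi2.
- by move=> x Ax; rewrite phi2E rho_id // subrr.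
- move=> g gG; rewrite phi2E rho_eq0 ?subr0.
    by rewrite phi1E dd0 linear0 subr0 eta0 // mem_cat gG.
  move=> b Ab bg; apply: phi1_0; rewrite !mem_cat; apply/orP; right; apply/orP; right.
  by apply: mem_trace Ab bg; apply: map_f.
exists (psi1 \+ psi2) => x xF; have [Ax|xm] := mP x xF.
  rewrite [LHS]/= psi1E ?psi2A ?addr0 //; first exact: closed_diff.
  by rewrite mem_cat mem_filter xF andbT; apply/orP; left; apply/asboolP.
rewrite [LHS]/= psi2E // phi2E rho_eq0 ?subr0; first by rewrite phi1E addrC subrK.
move=> b Ab bx; apply: phi1_0; rewrite !mem_cat; apply/orP; right; apply/orP; left.
exact: mem_trace xF Ab bx.
Qed.

(* The local solutions psi_m are corrected by maps theta \o d so that they    *)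
(* stabilize on each E m, as in the Mittag-Leffler argument.                 *)
Lemma chain_solution i j (e : i = j + 1) (phi : {linear P i -> W}) :
  (forall l (f : l = i + 1) x, phi (d f x) = 0) -> (forall x, @A i x -> phi x = 0) ->
  exists2 psi : {linear P j -> W}, forall x, @A j x -> psi x = 0
    & forall x, chain_union x -> psi (d e x) = phi x.
Proof.
move=> phid phiA; pose e' : j = j - 1 + 1 := esym (subrK 1 j).
pose OK m (psi : {linear P j -> W}) := (forall x, @A j x -> psi x = 0) /\
  forall x, x \in E m.+1 i -> psi (d e x) = phi x.
have solve m : exists psi, OK m psi.
  have [G GP] := closed_relatively_exact cA (erefl (i + 1)) e (E m.+1 i).
  by have [//|//|psi psiA psiE] := GP phi; exists psi.
have step (a : nat * {linear P j -> W}) : exists psi' : {linear P j -> W}, OK a.1 a.2 ->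
    OK a.1.+1 psi' /\ forall x, x \in E a.1 j -> psi' x = a.2 x.
  case: a => m psi /=; have [psi' [psi'A psi'E]] := solve m.+1.
  case: (pselect (OK m psi)) => [[psiA psiE]|nOK]; last by exists psi.
  have [_ _ _ /(_ i j (j - 1) e e') [G GE GP]] := E_grows m.
  have [||theta thetaA thetaE] := GP (psi' \- psi).
  - by move=> x Ax /=; rewrite psi'A // psiA // subrr.
  - move=> g /GE gE /=; rewrite psi'E ?psiE ?subrr //.
    by apply: chain_le gE.
  exists (psi' \- (theta \o d e')) => _; split; [split|] => x xP /=.
  - by rewrite psi'A // thetaA ?subr0 //; apply: closed_diff.
  - by rewrite dd0 linear0 subr0 psi'E.
  - by rewrite thetaE //= opprB addrC subrK.
have [next nextP] := choose_fun step; have [psi0 psi0P] := solve 0%N.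
pose psis := fix psis m := if m is n.+1 then next (n, psis n) else psi0.
have psisOK m : OK m (psis m).
  by elim: m => [|m IH] //=; have [] := nextP (m, psis m) IH.
have psisE m n x : (m <= n)%N -> x \in E m j -> psis n x = psis m x.
  move=> /subnKC <-; elim: (n - m)%N => [|q IH] xm; rewrite ?addn0 // addnS.
  have [_ ->] := nextP (_, psis (m + q)%N) (psisOK _); first exact: IH.
  by apply: chain_le xm; rewrite leq_addr.
have [g gP] : exists g : P j -> W, forall b,
    (exists2 m, b \in E m j & g b = psis m b) \/ (g b = 0 /\ forall m, b \notin E m j).
  apply: (@choose_fun _ _ (fun b w => (exists2 m, b \in E m j & w = psis m b) \/
    (w = 0 /\ forall m, b \notin E m j))) => b.
  case: (pselect (exists m, b \in E m j)) => [[m bm]|nb].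
    by exists (psis m b); left; exists m.
  by exists 0; right; split=> // m; apply/negP => bm; apply: nb; exists m.
have gE b m : b \in E m j -> g b = psis m b.
  move=> bm; have [[n bn ->]|[_ /(_ m)]] := gP b; last by rewrite bm.
  by case: (leqP m n) => [mn|/ltnW nm]; [apply: psisE|apply/esym/psisE].
exists (lincomb_lin g \o sigma j) => x.
  move=> Ax; apply: (@lincomb_eq _ _ \0) => b bx.
  have Ab : @A j b by apply: closed_supp Ax bx.
  by have [[n _ ->]|[-> _]] := gP b => //; have [psisA _] := psisOK n; apply: psisA.
move=> [Ax|[m xm]].
  rewrite phiA // ; apply: (@lincomb_eq _ _ \0) => b bx.
  have Ab : @A j b by exact: (closed_supp cA (closed_diff cA e Ax) bx).
  by have [[n _ ->]|[-> _]] := gP b => //; have [psisA _] := psisOK n; apply: psisA.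
(* The boundary of [x] lies in stage [m.+1] and its support in stage [m.+2], where [g] agrees with
   [psis m.+2]. *)
have [_ <-] := psisOK m.+2; last by apply: chain_le xm; rewrite ltnW // ltnW // ltnW.
apply: lincomb_eq => b bx; apply: gE.
have [_ + _ _] := E_grows m.+1; apply; last exact: bx.
by have [_ _ + _] := E_grows m; apply.
Qed.

End Chain.

(** The successor step for Zorn's lemma: one element is closed off over [A] by a countable chain,
    along which [chain_solution] applies. *)
Lemma closed_extend (A : family) i j (e : i = j + 1) (phi : {linear P i -> W}) (x0 : P i) :
  closed A -> (forall l (f : l = i + 1) x, phi (d f x) = 0) ->
  (forall x, A i x -> phi x = 0) ->
  exists A' : family, [/\ closed A', forall l x, A l x -> A' l x, A' i x0
    & exists2 psi : {linear P j -> W}, forall x, A j x -> psi x = 0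
      & forall x, A' i x -> psi (d e x) = phi x].
Proof.
move=> cA phid phiA.
have [next nextP] := choose_fun (fun E => @grows_exists A E cA).
(* The chain starts from [x0] in degree [i] and from nothing in every other degree. *)
pose E0 l : seq (P l) := if pselect (i = l) is left f then [:: eq_rect i P x0 l f] else [::].
have x0E0 : x0 \in E0 i.
  rewrite /E0; case: pselect => // f.
  by rewrite (eq_irrelevance f erefl) /= mem_head.
pose E m := iter m next E0.
have Eg m : grows A (E m) (E m.+1) by exact: nextP.
exists (chain_union A E); split.
- exact: chain_union_closed.
- by left.
- by right; exists 0%N.
- exact: chain_solution.
Qed.

(** Zorn's lemma on pairs of a closed family and a map solving the equation on it; a larger pair
    must keep the values of the map on the smaller family. *)
Theorem coboundary i j (e : i = j + 1) (phi : {linear P i -> W}) :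
  (forall l (f : l = i + 1) x, phi (d f x) = 0) ->
  exists psi : {linear P j -> W}, forall x, psi (d e x) = phi x.
Proof.
move=> phid.
pose good (t : family * {linear P j -> W}) :=
  closed t.1 /\ forall x, t.1 i x -> t.2 (d e x) = phi x.
pose R (s t : {t | good t}) := (forall l x, (sval s).1 l x -> (sval t).1 l x) /\
  forall x, (sval s).1 j x -> (sval t).2 x = (sval s).2 x.
have good0 : good ((fun _ _ => False) : family, (\0 : {linear P j -> W})).
  split=> //; split=> // l k m f f' F F0; exists [::] => // eta _.
  by exists \0 => x /F0.
have [||C [t0 Ct0] totC|[[A psi] /= [cA psiE]] tmax] := @zorn _ (exist _ _ good0) R.
- by move=> t; split.
- move=> r s t [rs rsE] [st stE]; split=> [l x /rs /st //|x rx].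
  by rewrite stE ?rsE //; apply: rs.
(* The members of the chain have maps on all of [P j] that agree only on the families. The glued map
   takes the common values at elements of [U] and is spread linearly through [sigma j]; closure
   under supports gives agreement on each family. *)
- pose U : family := fun l x => exists2 t, C t & (sval t).1 l x.
  have [g gP] : exists g : P j -> W, forall b, U j b ->
      exists t, [/\ C t, (sval t).1 j b & g b = (sval t).2 b].
    apply: (@choose_fun _ _ (fun b w => U j b ->
      exists t, [/\ C t, (sval t).1 j b & w = (sval t).2 b])) => b.
    case: (pselect (U j b)) => [[t Ct tb]|nU]; last by exists 0.
    by exists ((sval t).2 b) => _; exists t.
  have [psiU psiUg] : exists f : {linear P j -> W}, forall x, f x = lincomb g (sigma j x).
    by exists (lincomb_lin g \o sigma j).
  have psiUE t x : C t -> (sval t).1 j x -> psiU x = (sval t).2 x.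
    move=> Ct tx; rewrite psiUg; apply: lincomb_eq => b bx.
    have tb : (sval t).1 j b by case: (svalP t) => ct _; apply: closed_supp tx bx.
    have [|s [Cs sb ->]] := gP b; first by exists t.
    by have [[_ st]|[_ ts]] := totC _ _ Cs Ct; [rewrite st|rewrite ts].
  have Useq l (F : seq (P l)) : (forall x, x \in F -> U l x) ->
      exists2 t, C t & forall x, x \in F -> (sval t).1 l x.
    elim: F => [|y F IH] FU; first by exists t0.
    have [|t Ct tP] := IH; first by move=> x xF; apply: FU; rewrite inE xF orbT.
    have [s Cs sy] := FU y (mem_head _ _).
    have [[st _]|[ts _]] := totC _ _ Cs Ct; [exists t|exists s] => // x;
      rewrite inE => /predU1P[->|/tP] //; first exact: st.
    exact: ts.
  have goodU : good (U, psiU).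
    split; [split|] => /=.
    - move=> l x b [t Ct tx] bx; exists t => //.
      by case: (svalP t) => ct _; apply: closed_supp tx bx.
    - move=> l k f x [t Ct tx]; exists t => //.
      by case: (svalP t) => ct _; apply: closed_diff.
    - move=> l k m f f' F /Useq [t Ct tF]; case: (svalP t) => ct _.
      have [G tG GP] := closed_local ct f f' tF.
      by exists G => // y /tG ty; exists t.
    - move=> x [t Ct tx]; case: (svalP t) => ct tE.
      by rewrite (psiUE t) //; [apply: tE|apply: closed_diff].
  exists (exist _ _ goodU) => t Ct; split=> /= [l x tx|x tx]; first by exists t.
  exact: psiUE.
(* What remains of [phi] after subtracting the current solution is a cocycle vanishing on [A].
   [closed_extend] solves it on a family containing [x0], and maximality puts [x0] into [A]. *)
exists psi => x0.
have [psiA psiAE] : exists f : {linear P j -> W}, forall x, f x = psi (rho A j x).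
  by exists (psi \o rho A j).
have [phi1 phi1E] : exists f : {linear P i -> W}, forall x, f x = phi x - psiA (d e x).
  by exists (phi \- (psiA \o d e)).
have [||A' [cA' AA' A'x0 [psi' psi'A psi'E]]] := @closed_extend A i j e phi1 x0 cA.
- by move=> l f x; rewrite phi1E phid dd0 linear0 subrr.
- move=> x Ax; rewrite phi1E psiAE rho_id //.
    by rewrite psiE // subrr.
  exact: closed_diff.
have good' : good (A', psiA \+ psi' : {linear P j -> W}).
  by split=> //= x A'x; rewrite psi'E // phi1E addrC subrK.
have [|A'A _] := tmax (exist _ _ good').
  split=> //= x Ax; rewrite psi'A // addr0.
  by rewrite psiAE rho_id.
exact: psiE _ (A'A _ _ A'x0).
Qed.

End Extension.

Section Coboundary.
Variables (S : pzRingType) (P : complex S) (W : lmodType S).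
Hypothesis P_proj : forall n, projective_module (ob P n).
Hypothesis P_tens : forall I : lmodType S^c, injective_module I -> tensor_acyclic I P.
Hypothesis W_proj : projective_module W.

(** Coordinates in a dual basis of [W] reduce to functionals. One [q] serves all coordinates, and
    only the finitely many in [D] are non-zero on [p], so the solutions can be summed. *)
Lemma local_exactness n (p : seq (ob P (n + 1))) :
  exists q : seq (ob P (n + 1 + 1)), forall phi : {linear ob P (n + 1) -> W},
    (forall x, x \in q -> phi (diff P (n + 1) x) = 0) ->
    exists psi : {linear ob P n -> W},
      forall x, x \in p -> psi (diff P n x) = phi x.
Proof.
have [tau tK] := projective_dual_basis W_proj.
have [q qP] := functional_local_exactness P_proj P_tens p.
exists q => phi phi0.
have [psi psiE] : exists psi : W -> {linear ob P n -> S^o}, forall b,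
    forall x, x \in p -> psi b (diff P n x) = (tau (phi x))@_b.
  apply: (@choose_fun _ {linear ob P n -> S^o} (fun b psi =>
    forall x, x \in p -> psi (diff P n x) = (tau (phi x))@_b)) => b.
  have fD x y : (tau (phi (x + y)))@_b = (tau (phi x))@_b + (tau (phi y))@_b.
    by rewrite !linearD mcoeffD.
  have fZ s x : (tau (phi (s *: x)))@_b = s * (tau (phi x))@_b.
    by rewrite !linearZ /= mcoeffZ_free.
  have [|f fE] := qP (@lin _ _ (S^o) _ fD fZ).
    by move=> x xq /=; rewrite phi0 // linear0 mcoeff0.
  by exists f => x xp; rewrite fE.
have [D DP] : exists D : {fset W}, forall x, x \in p -> msupp (tau (phi x)) `<=` D.
  elim: (p) => [|x s [D DP]]; first by exists fset0.
  exists (msupp (tau (phi x)) `|` D) => y; rewrite inE => /predU1P[->|/DP yD].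
    exact: fsubsetUl.
  exact: fsubset_trans yD (fsubsetUr _ _).
pose f y := \sum_(b <- D) (psi b y : S) *: b.
have fD x y : f (x + y) = f x + f y.
  by rewrite /f -big_split; apply: eq_bigr => b _; rewrite linearD scalerDl.
have fZ s x : f (s *: x) = s *: f x.
  by rewrite /f scaler_sumr; apply: eq_bigr => b _; rewrite linearZ scalerA.
exists (lin fD fZ) => x xp; rewrite [LHS]/= /f [RHS](tK (phi x)).
rewrite (big_fset_incl _ (DP x xp)) /=; last first.
  by move=> b _ /mcoeff_outdom ->; rewrite scale0r.
by apply: eq_bigr => b _; rewrite psiE.
Qed.

(** In [int], [j - 1 + 1] and [j] are only provably equal; linking degrees by an equation lets the
    extension argument descend a degree without transporting elements. *)
Definition diff_to i j (e : i = j + 1) : {linear ob P i -> ob P j} :=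
  match esym e in _ = i return {linear ob P i -> ob P j} with erefl => diff P j end.

Lemma diff_toE n (e : n + 1 = n + 1) : diff_to e = diff P n.
Proof. by rewrite (eq_irrelevance e erefl). Qed.

Theorem complex_coboundary n (phi : {linear ob P (n + 1) -> W}) :
  (forall x, phi (diff P (n + 1) x) = 0) ->
  exists psi : {linear ob P n -> W}, forall x, psi (diff P n x) = phi x.
Proof.
move=> phi0.
have hs i : exists sigma : {linear ob P i -> free_module S (ob P i)}, dual_basis sigma.
  exact: projective_dual_basis.
pose sigma i := projT1 (cid (hs i)).
have sK i : dual_basis (sigma i) by rewrite /sigma; case: cid.
have dd0 i j k (e : i = j + 1) (e' : j = k + 1) x : diff_to e' (diff_to e x) = 0.
  by subst j; subst i; rewrite !diff_toE diff_diff.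
have loc i j k (e : i = j + 1) (e' : j = k + 1) E :
    exists G, @locally_exact S W (ob P) diff_to i j k e e' E G.
  subst j; subst i; have [G GP] := local_exactness E.
  by exists G => eta; rewrite !diff_toE; apply: GP.
have [l f x|psi] := @coboundary S W (ob P) diff_to sigma sK dd0 loc (n + 1) n erefl phi.
  by subst l; rewrite diff_toE.
by rewrite diff_toE; exists psi.
Qed.

End Coboundary.

(** * Orthogonality to projectives and finite projective coresolutions *)

Section CoresolvedModules.
Variable S : pzRingType.
Implicit Types A B C L M Q : lmodType S.

Lemma ses_comp0 A B C (i : {linear A -> B}) (p : {linear B -> C}) x :
  ses i p -> p (i x) = 0.
Proof. by move=> [_ _ ex]; apply/ex; exists x. Qed.

(* Ext^1(L, W) = 0 for all projective W. *)
Definition proj_orthogonal L : Prop :=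
  forall (W A B : lmodType S) (i : {linear A -> B}) (p : {linear B -> L}),
    projective_module W -> ses i p ->
    forall f : {linear A -> W}, exists g : {linear B -> W}, forall x, g (i x) = f x.

Definition ext_closed (C : lmodType S -> Prop) : Prop :=
  forall L1 L L2 (i : {linear L1 -> L}) (p : {linear L -> L2}),
    ses i p -> C L1 -> C L2 -> C L.

(** [B'] is the preimage of [L1] in [B]. The inclusion of [A] in [B] thus splits into two steps with
    quotients [L1] and [L2], and properties tested on extensions pass from these to [L]. *)
Lemma ses_pullback A B L1 L L2 (i : {linear A -> B}) (p : {linear B -> L})
    (j : {linear L1 -> L}) (q : {linear L -> L2}) : ses i p -> ses j q ->
  exists (B' : lmodType S) (i' : {linear A -> B'}) (p' : {linear B' -> L1})
    (k : {linear B' -> B}) (r : {linear B -> L2}),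
    [/\ ses i' p', ses k r & forall x, k (i' x) = i x].
Proof.
move=> sip sjq; have [ii ps ipx] := sip; have [ji qs jqx] := sjq.
pose r : {linear B -> L2} := q \o p.
have [B' [k [ki kx]]] := kernel_exists r.
have [|i' i'E] := @lin_lift _ A B' B k i ki.
  by move=> x; apply/kx; rewrite /= (ses_comp0 x sip) linear0.
have [|p' p'E] := @lin_lift _ B' L1 L j (p \o k) ji.
  by move=> x; apply/jqx; apply/kx; exists x.
exists B', i', p', k, r; split=> //; split=> //.
- by apply: lin_inj => x x0; apply: (inj_eq0 ii); rewrite -i'E x0 linear0.
- move=> y; have [b pb] := ps (j y).
  have [|b' kb'] := (kx b).1; first by rewrite /= pb (ses_comp0 y sjq).
  by exists b'; apply: ji; rewrite p'E /= kb'.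
- move=> x; split=> [px0|[a <-]].
    have /ipx [a ia] : p (k x) = 0 by rewrite -[p (k x)]p'E px0 linear0.
    by exists a; apply: ki; rewrite i'E.
  by apply: ji; rewrite p'E /= i'E (ses_comp0 a sip) linear0.
- by move=> y; have [l <-] := qs y; have [b <-] := ps l; exists b.
Qed.

Lemma proj_orthogonal_ext : ext_closed proj_orthogonal.
Proof.
move=> L1 L L2 j q sjq o1 o2 W A B i p Wp sip f.
have [B' [i' [p' [k [r [s' skr kE]]]]]] := ses_pullback sip sjq.
have [g gE] := o1 _ _ _ _ _ Wp s' f; have [h hE] := o2 _ _ _ _ _ Wp skr g.
by exists h => x; rewrite -kE hE.
Qed.

Variable good : lmodType S -> Prop.
Hypothesis good_ext : ext_closed good.

(** Only [n] cosyzygies are demanded, so closure under extensions is an ordinary induction; [good]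
    is a further property to be kept at every stage, later Tor-acyclicity over [R]. *)
Fixpoint coresolved n L : Prop :=
  [/\ proj_orthogonal L, good L & if n is m.+1 then
    exists Q L1 (i : {linear L -> Q}) (p : {linear Q -> L1}),
      [/\ projective_module Q, ses i p & coresolved m L1] else True].

Lemma coresolved_good n L : coresolved n L -> good L.
Proof. by case: n => [|n] []. Qed.

Lemma lin_pair A B C (f : {linear A -> B}) (g : {linear A -> C}) :
  exists h : {linear A -> (B * C)%type}, forall x, h x = (f x, g x).
Proof.
have D x y : (f (x + y), g (x + y)) = (f x, g x) + (f y, g y) :> (B * C)%type.
  by rewrite !linearD.
have Z s x : (f (s *: x), g (s *: x)) = s *: ((f x, g x) : (B * C)%type).
  by rewrite !linearZ.
by exists (lin D Z).
Qed.

Lemma projective_prod Q1 Q2 : projective_module Q1 -> projective_module Q2 ->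
  projective_module (Q1 * Q2)%type.
Proof.
move=> p1 p2 A B p f ps.
have [inl inlE] := lin_pair (idfun : {linear Q1 -> Q1}) (\0 : {linear Q1 -> Q2}).
have [inr inrE] := lin_pair (\0 : {linear Q2 -> Q1}) (idfun : {linear Q2 -> Q2}).
have [h1 h1E] := p1 _ _ p (f \o inl) ps.
have [h2 h2E] := p2 _ _ p (f \o inr) ps.
exists ((h1 \o fst) \+ (h2 \o snd)) => -[x y] /=.
rewrite linearD h1E h2E /= -linearD inlE inrE; congr (f _).
by congr pair; rewrite /= ?addr0 ?add0r.
Qed.

(** A horseshoe argument: [L] embeds in [Q1 * Q2], and its cokernel is an extension of [C2] by
    [C1]. *)
Lemma coresolved_ext n : ext_closed (coresolved n).
Proof.
elim: n => [|n IH] L1 L L2 j q sjq.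
  move=> [o1 g1 _] [o2 g2 _]; split=> //.
    exact: proj_orthogonal_ext sjq o1 o2.
  exact: good_ext sjq g1 g2.
move=> [o1 g1 [Q1 [C1 [i1 [p1 [Q1p s1 c1]]]]]] [o2 g2 [Q2 [C2 [i2 [p2 [Q2p s2 c2]]]]]].
have [ji qs jx] := sjq; have [i1i p1s x1] := s1; have [i2i p2s x2] := s2.
(* Orthogonality of [L2] replaces the injectivity of [Q1] that the horseshoe would otherwise
   require. *)
have [g gE] := o2 _ _ _ _ _ Q1p sjq i1.
have [i iE] : exists i : {linear L -> (Q1 * Q2)%type}, forall x, i x = (g x, i2 (q x)).
  exact: (lin_pair g (i2 \o q)).
have ii : injective i.
  apply: lin_inj => x; rewrite iE => -[gx /(inj_eq0 i2i) /jx [y yx]].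
  by rewrite -yx; rewrite -yx gE in gx; rewrite (inj_eq0 i1i gx) linear0.
have [C [p sip]] := ses_cokernel ii; have [_ ps px] := sip.
split; first exact: proj_orthogonal_ext sjq o1 o2.
  exact: good_ext sjq g1 g2.
exists (Q1 * Q2)%type, C, i, p; split=> //; first exact: projective_prod.
have [inl inlE] := lin_pair (idfun : {linear Q1 -> Q1}) (\0 : {linear Q1 -> Q2}).
have [|c cE] := lin_factor (f := p \o inl) p1s.
  move=> x /x1 [y <-] /=; apply/px; exists (j y).
  by rewrite iE gE inlE /= (ses_comp0 y sjq) linear0.
have [|c' c'E] := lin_factor (f := p2 \o snd) ps.
  by move=> x /px [y <-]; rewrite iE /=; apply/x2; exists (q y).
apply: (IH _ _ _ c c' _ c1 c2); split.
- apply: lin_inj => y; have [x <-] := p1s y; rewrite cE => /px [z]; rewrite iE inlE.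
  move=> [gz /(inj_eq0 i2i) /jx [t tz]]; apply/x1; exists t.
  by rewrite -gz -tz gE.
- move=> y; have [x <-] := p2s y; exists (p (0, x)); exact: c'E.
- move=> y; have [[u v] <-] := ps y; rewrite c'E /=; split=> [/x2 [t tv]|[z]].
    have [z zt] := qs t; exists (p1 (u - g z)); rewrite cE [LHS]/= inlE.
    apply/eqP; rewrite eq_sym -subr_eq0 -linearB; apply/eqP/px; exists z.
    rewrite iE zt tv; transitivity (u - (u - g z), v - 0 : Q2); last by [].
    by rewrite subKr subr0.
  have [x <-] := p1s z; rewrite cE => /eqP; rewrite eq_sym -subr_eq0 -linearB.
  move=> /eqP /px [t]; rewrite iE => -[_ /= e]; apply/x2; exists (q t).
  by rewrite e inlE /= subr0.
Qed.

End CoresolvedModules.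

(** * Embedding into a module of finite projective dimension *)

Section Resolutions.
Variables (S : pzRingType) (C : lmodType S -> Prop).

Lemma resolution0 M : has_resolution C M 0 ->
  exists (X : lmodType S) (f : {linear X -> M}), [/\ C X, injective f & surj f].
Proof.
move=> [X [d [e [CX X0 es ex exd]]]]; exists (X 0%N), e; split=> //; first exact: CX.
apply: lin_inj => x /ex [y <-].
by rewrite (X0 1%N (ltn0Sn 0) y) linear0.
Qed.

Lemma resolutionS M n : has_resolution C M n.+1 ->
  exists (X K : lmodType S) (i : {linear K -> X}) (p : {linear X -> M}),
    [/\ C X, ses i p & has_resolution C K n].
Proof.
move=> [X [d [e [CX X0 es ex exd]]]].
have [K [i sie]] := ses_kernel es; have [ii _ ix] := sie.
have [|e' e'E] := @lin_lift _ (X 1%N) K (X 0%N) i (d 0%N) ii.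
  by move=> x; apply/ix/ex; exists x.
exists (X 0%N), K, i, e; split=> //; first exact: CX.
exists (fun m => X m.+1), (fun m => d m.+1), e'; split.
- by move=> m mn; apply: CX.
- by move=> m nm; apply: X0.
- move=> k; have /ex [x xE] : e (i k) = 0 by rewrite (ses_comp0 k sie).
  by exists x; apply: ii; rewrite e'E.
- move=> x; rewrite -(exd 0%N x) -e'E; split=> [->|]; first by rewrite linear0.
  exact: (inj_eq0 ii).
- by move=> m; apply: exd.
Qed.

End Resolutions.

Inductive finite_pd (S : pzRingType) : lmodType S -> Prop :=
| finite_pd_proj (Q : lmodType S) : projective_module Q -> finite_pd Q
| finite_pd_ses (Z Q N : lmodType S) (i : {linear Z -> Q}) (p : {linear Q -> N}) :
    ses i p -> projective_module Q -> finite_pd Z -> finite_pd N.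

Section Embedding.
Variables (S : pzRingType) (good : lmodType S -> Prop).
Hypothesis good_ext : ext_closed good.

(** Induction on the resolution. With [M = X/K] and [K] embedded in [Lam'], the new [Lam] is the
    cokernel of [Lam'] in [Q0 * Q'], where [Q0] contains [X] and [Q'] contains [Lam'/K]. It has
    finite projective dimension, receives [M] through [Q0], and the quotient is an extension of the
    two cosyzygies [L''] and [X1]. *)
Lemma embedding n k (M : lmodType S) :
  has_resolution (fun X => forall m, coresolved good m X) M n ->
  exists (Lam L : lmodType S) (i : {linear M -> Lam}) (p : {linear Lam -> L}),
    [/\ ses i p, finite_pd Lam & coresolved good k L].
Proof.
elim: n k M => [|n IH] k M.
  move=> /resolution0 [X [f [/(_ k.+1) [_ _ [Q [L [i [p [Qp sip cL]]]]]] fi fs]]].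
  have [ii ps ipx] := sip.
  have [|j jE] := lin_factor (f := i) fs.
    by move=> x /(inj_eq0 fi) ->; rewrite linear0.
  exists Q, L, j, p; split=> //; last exact: finite_pd_proj.
  split=> //.
    apply: lin_inj => y; have [x <-] := fs y; rewrite jE => /(inj_eq0 ii) ->.
    by rewrite linear0.
  move=> y; rewrite (ipx y); split=> [[x <-]|[z <-]]; first by exists (f x).
  by have [x <-] := fs z; exists x.
move=> /resolutionS [X [K [a [b [cX sab resK]]]]].
(* One more stage is requested because the cosyzygy of [L'] is taken once. *)
have [Lam' [L' [a' [b' [sab' pd' [oL' _ cL']]]]]] := IH k.+1 K resK.
move: cL' => [Q' [L'' [i' [p' [Q'p s' cL'']]]]].
have [_ _ [Q0 [X1 [i0 [p0 [Q0p s0 cX1]]]]]] := cX k.+1.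
have [g gE] := oL' _ _ _ _ _ Q0p sab' (i0 \o a).
have [ai bs abx] := sab; have [a'i b's abx'] := sab'.
have [i0i p0s x0] := s0; have [i'i p's x'] := s'.
have [j jE] : exists j : {linear Lam' -> (Q0 * Q')%type}, forall x, j x = (g x, i' (b' x)).
  exact: (lin_pair g (i' \o b')).
have [inl inlE] := lin_pair (idfun : {linear Q0 -> Q0}) (\0 : {linear Q0 -> Q'}).
(* The image of [Lam'] meets [Q0] exactly in the image of [K]; hence both [j] and the map from
   [M = X/K] are injective. *)
have j_inl l u : j l = inl u -> exists2 x, l = a' x & u = i0 (a x).
  rewrite jE inlE => -[gu /(inj_eq0 i'i) /abx' [x xl]]; exists x => //.
  by rewrite -gu -xl gE.
have ji : injective j.
  apply: lin_inj => l l0; have [|x -> e] := @j_inl l 0; first by rewrite l0 linear0.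
  by rewrite (inj_eq0 ai (inj_eq0 i0i (esym e))) linear0.
have [Lam [pi sjpi]] := ses_cokernel ji; have [_ pis jpix] := sjpi.
have [|m mE] := lin_factor (f := pi \o inl \o i0) bs.
  move=> x /abx [y <-] /=; apply/jpix; exists (a' y).
  by rewrite jE inlE gE (ses_comp0 y sab') linear0.
have mi : injective m.
  apply: lin_inj => y; have [x <-] := bs y; rewrite mE => /jpix [l /j_inl [z _ /i0i ->]].
  exact: (ses_comp0 z sab).
have [L [rr smr]] := ses_cokernel mi; have [_ rs mrx] := smr.
exists Lam, L, m, rr; split=> //.
  by apply: finite_pd_ses sjpi _ pd'; apply: projective_prod.
have [|c cE] := lin_factor (f := rr \o pi \o inl) p0s.
  by move=> q /x0 [x <-]; apply/mrx; exists (b x); rewrite mE.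
have [|t tE] := lin_factor (f := p' \o snd) pis.
  by move=> y /jpix [l <-]; rewrite jE; apply/x'; exists (b' l).
have [|c' c'E] := lin_factor (f := t) rs.
  move=> y /mrx [z <-]; have [x <-] := bs z; rewrite mE /= tE inlE /=.
  exact: linear0.
apply: (@coresolved_ext S good good_ext k _ _ _ c c' _ cX1 cL''); split.
- apply: lin_inj => y; have [q <-] := p0s y; rewrite cE => /mrx [z].
  have [x <-] := bs z; rewrite mE => /= e.
  have /jpix [l] : pi (inl (i0 x - q)) = 0 by rewrite !linearB e subrr.
  move=> /j_inl [w _ ew]; apply/x0; exists (x - a w).
  by rewrite linearB -ew opprB addrC subrK.
- move=> y; have [v <-] := p's y; exists (rr (pi (0, v))); rewrite c'E; exact: tE.
- move=> y; have [w <-] := rs y; have [[u v] <-] := pis w.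
  rewrite c'E tE; split=> [/x' [l' l'v]|[z]].
    have [l ll'] := b's l'; exists (p0 (u - g l)); rewrite cE [LHS]/=.
    apply/eqP; rewrite eq_sym -subr_eq0 -!linearB; apply/eqP.
    rewrite (_ : pi _ = 0) ?linear0 //; apply/jpix; exists l.
    rewrite jE inlE ll' l'v; transitivity (u - (u - g l), v - 0 : Q'); last by [].
    by rewrite subKr subr0.
  have [q <-] := p0s z; rewrite cE => /= e.
  have : c' (rr (pi (inl q))) = c' (rr (pi (u, v))) by rewrite e.
  by rewrite !c'E !tE inlE /= linear0 => <-.
Qed.

End Embedding.

(** * Cosyzygies and orthogonality of PGF modules *)

Section GorensteinFlat.
Variable S : pzRingType.

(** The same complex serves: by acyclicity the quotient of its term by [M] is the image of the next
    differential. *)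
Lemma PGF_cosyzygy (M : lmodType S) : PGF M ->
  exists (Q L : lmodType S) (i : {linear M -> Q}) (p : {linear Q -> L}),
    [/\ projective_module Q, ses i p & PGF L].
Proof.
move=> [P [Pp Pa Pt [n [i [ii ix]]]]].
have [m e] : exists m, n = m + 1 by exists (n - 1); rewrite subrK.
subst n; have [L [p sip]] := ses_cokernel ii; have [_ ps px] := sip.
exists (ob P (m + 1)), L, i, p; split=> //; exists P; split=> //.
have ker_d x : diff P m x = 0 <-> p x = 0.
  split=> [/Pa /ix /px //|/px /ix [y <-]]; exact: diff_diff.
have [|f fE] := lin_factor (f := diff P m) ps; first by move=> x /ker_d.
exists m, f; split.
  by apply: lin_inj => y; have [x <-] := ps y; rewrite fE => /ker_d.
move=> x; split=> [[y <-]|[y <-]]; last by exists (p y).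
by have [z <-] := ps y; exists z; rewrite fE.
Qed.

(** Lifting the start of the complex into the extension produces the cocycle [f \o k] that
    represents the obstruction. Written as a coboundary [psi \o d], it makes [f] and [psi] agree on
    the kernel of the surjection from [A * P] to [B], so together they descend to [B]. *)
Lemma PGF_orthogonal (M : lmodType S) : PGF M -> proj_orthogonal M.
Proof.
move=> [P [Pp Pa Pt [n [i [ii ix]]]]] W A B j p Wp sjp f.
have [ji ps jpx] := sjp.
have [|h hE] := @lin_lift _ (ob P (n + 1)) M (ob P n) i (diff P n) ii.
  by move=> x; apply/ix; exists x.
have [|l lE] := @Pp (n + 1) B M p h; first exact: ps.
have [|k kE] := @lin_lift _ (ob P (n + 1 + 1)) A B j (l \o diff P (n + 1)) ji.
  move=> x; apply/jpx; rewrite /= lE; apply: ii; rewrite hE diff_diff.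
  by rewrite linear0.
have [|psi psiE] := complex_coboundary Pp Pt Wp (phi := f \o k).
  move=> x /=; rewrite (inj_eq0 ji (x := k _)) ?linear0 //.
  by rewrite kE /= diff_diff linear0.
have [jl jlE] : exists g : {linear (A * ob P (n + 1))%type -> B},
    forall x, g x = j x.1 + l x.2 by exists ((j \o fst) \+ (l \o snd)).
have jls : surj jl.
  move=> b; have /ix [y yE] : exists m, i m = i (p b) by exists (p b).
  have /jpx [a ab] : p (b - l y) = 0.
    by rewrite linearB lE; apply: ii; rewrite linearB hE yE subrr linear0.
  by exists (a, y); rewrite jlE /= ab subrK.
have [|g gE] := lin_factor (f := (f \o fst) \+ (psi \o snd)) jls.
  move=> [a y]; rewrite jlE /= => e.
  have hy : h y = 0 by rewrite -lE -[l y]add0r -(subrr (j a)) addrAC e sub0r linearN (ses_comp0 a sjp) oppr0.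
  have /Pa [z zy] : diff P n y = 0 by rewrite -hE hy linear0.
  rewrite -zy psiE /= -linearD -[RHS](linear0 f); congr (f _).
  by apply: ji; rewrite linearD kE /= zy e linear0.
by exists g => x; have := gE (x, 0); rewrite jlE /= !linear0 !addr0.
Qed.

Lemma PGF_coresolved (good : lmodType S -> Prop) n (M : lmodType S) :
  (forall M, PGF M -> good M) -> PGF M -> coresolved good n M.
Proof.
move=> PGF_good; elim: n M => [|n IH] M PM.
  by split=> //; [exact: PGF_orthogonal|exact: PGF_good].
split; [exact: PGF_orthogonal|exact: PGF_good|].
have [Q [L [i [p [Qp sip PL]]]]] := PGF_cosyzygy PM.
by exists Q, L, i, p; split=> //; apply: IH.
Qed.

End GorensteinFlat.

(** * Vanishing of Tor and restriction of scalars *)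

Section TorVanishing.
Variable S : pzRingType.
Implicit Types (V F : lmodType S) (N Q : lmodType S^c).

(* Tor_1(N, V) = 0. *)
Definition tor1_zero V N : Prop :=
  forall (A B : lmodType S^c) (i : {linear A -> B}) (p : {linear B -> N}),
    ses i p -> injective (tensor_map i (idfun : {linear V -> V})).

Definition left_flat Q : Prop :=
  forall (A B : lmodType S) (i : {linear A -> B}), injective i ->
    injective (tensor_map (idfun : {linear Q -> Q}) i).

Lemma tensor_map_swap (A B : lmodType S^c) (X Y : lmodType S)
    (f : {linear A -> B}) (g : {linear X -> Y}) x :
  tensor_map f idfun (tensor_map idfun g x) = tensor_map idfun g (tensor_map f idfun x).
Proof.
transitivity (tensor_map f g x); first exact: tensor_map_comp.
exact/esym/tensor_map_comp.
Qed.

Lemma tor1_zero_flat V N : flat_module V -> tor1_zero V N.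
Proof. by move=> Vf A B i p [ii _ _]; apply: Vf. Qed.

Lemma tor1_zero_projective V N : projective_module N -> tor1_zero V N.
Proof.
move=> Np A B i p sip; have [ii ps ipx] := sip.
have [s sE] := Np _ _ p idfun ps.
have [|r rE] := @lin_lift _ B A B i (idfun \- (s \o p)) ii.
  by move=> b; apply/ipx; rewrite /= linearB sE subrr.
apply: (@add_inj _ _ (tensor_map i (idfun : {linear V -> V}))) => x x0.
have rr : r \o i =1 id.
  by move=> a /=; apply: ii; rewrite rE /= (ses_comp0 a sip) linear0 subr0.
have := congr1 (tensor_map r (idfun : {linear V -> V})) x0.
rewrite (@tensor_map_comp _ _ _ _ _ _ _ _ r (r \o i) _ _ idfun) // raddf0.
by rewrite (@tensor_map_id _ _ _ (r \o i) idfun).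
Qed.

Lemma tor1_zero_ext V N1 N N2 (j : {linear N1 -> N}) (q : {linear N -> N2}) :
  ses j q -> tor1_zero V N1 -> tor1_zero V N2 -> tor1_zero V N.
Proof.
move=> sjq t1 t2 A B i p sip.
have [B' [i' [p' [k [r [s' skr kE]]]]]] := ses_pullback sip sjq.
move=> x y; rewrite -!(@tensor_map_comp _ _ _ _ _ _ _ i' k i idfun idfun idfun) //.
by move=> /(t2 _ _ _ _ skr) /(t1 _ _ _ _ s').
Qed.

(* Tor_1(Z, V) = Tor_2(N, V) = Tor_1(N, V'). *)
Lemma tor1_zero_shift (V' F V : lmodType S) (a : {linear V' -> F}) (b : {linear F -> V})
    (Z Q N : lmodType S^c) (j : {linear Z -> Q}) (q : {linear Q -> N}) :
  ses a b -> flat_module F -> ses j q -> left_flat Q ->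
  tor1_zero V' N -> tor1_zero V Z.
Proof.
move=> sab Ff sjq Qf tN A B i p sip.
have [ai bs abx] := sab; have [ji qs jqx] := sjq; have [ii ps ipx] := sip.
apply: (@add_inj _ _ (tensor_map i (idfun : {linear V -> V}))) => x x0.
have [y yx] := tensor_map_surj (@idfun_surj A) bs x.
have e1 : tensor_map idfun b (tensor_map i idfun y) = 0.
  by rewrite -tensor_map_swap yx.
have [w wE] := (tensor_exactr (M := B) bs abx _).1 e1.
(* It suffices to test in [Q (x) F]: [j (x) V'] is injective as [Tor_1(N, V') = 0], and [Q (x) a] as
   [Q] is flat. There the image of [w] comes from [A (x) F] through [p \o i = 0]. *)
have w0 : tensor_map p (idfun : {linear V' -> V'}) w = 0.
  apply: (add_inj0 (f := tensor_map j (idfun : {linear V' -> V'}))).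
    exact: tN sjq.
  apply: (add_inj0 (f := tensor_map (idfun : {linear Q -> Q}) a)).
    exact: Qf.
  rewrite -[LHS]/(tensor_map idfun a (tensor_map j idfun (tensor_map p idfun w))).
  rewrite -!tensor_map_swap wE.
  rewrite (_ : tensor_map p idfun _ = 0) ?raddf0 //.
  by apply/(tensor_exactl (N := F) ps ipx); exists y.
have [v vE] := (tensor_exactl (N := V') ps ipx _).1 w0.
rewrite -yx (_ : y = tensor_map idfun a v).
  by apply/(tensor_exactr (M := A) bs abx); exists v.
by apply: (Ff _ _ i ii); rewrite -wE -vE tensor_map_swap.
Qed.

Inductive finite_fd : lmodType S -> Prop :=
| finite_fd_flat V : flat_module V -> finite_fd V
| finite_fd_ses V' F V (a : {linear V' -> F}) (b : {linear F -> V}) :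
    ses a b -> flat_module F -> finite_fd V' -> finite_fd V.

Lemma flat_iso F V (f : {linear F -> V}) : injective f -> surj f ->
  flat_module F -> flat_module V.
Proof.
move=> fi fs Ff A B i ii.
have [|g gE] := lin_factor (f := (idfun : {linear F -> F})) fs.
  by move=> x /(inj_eq0 fi).
have gK : cancel g f by move=> v; have [u <-] := fs v; rewrite gE.
have gi : injective (tensor_map (idfun : {linear A -> A}) g).
  apply: can_inj (tensor_map (idfun : {linear A -> A}) f) _ => x.
  rewrite (@tensor_map_comp _ _ _ _ _ _ _ _ _ idfun _ _ (f \o g)) //.
  by rewrite (@tensor_map_id _ _ _ idfun (f \o g)).
move=> x y e; apply/gi/(Ff _ _ _ ii).
by rewrite !tensor_map_swap e.
Qed.

Lemma resolution_finite_fd V n : has_resolution (@flat_module S) V n -> finite_fd V.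
Proof.
elim: n V => [|n IH] V.
  by move=> /resolution0 [X [f [Xf fi fs]]]; apply/finite_fd_flat/(flat_iso fi fs).
move=> /resolutionS [X [K [i [p [Xf sip /IH Kf]]]]].
exact: finite_fd_ses sip Xf Kf.
Qed.

Definition tor_acyclic N : Prop := forall V, finite_fd V -> tor1_zero V N.

Lemma tor_acyclic_projective N : projective_module N -> tor_acyclic N.
Proof. by move=> Np V _; apply: tor1_zero_projective. Qed.

Lemma tor_acyclic_ext N1 N N2 (j : {linear N1 -> N}) (q : {linear N -> N2}) :
  ses j q -> tor_acyclic N1 -> tor_acyclic N2 -> tor_acyclic N.
Proof.
by move=> sjq t1 t2 V Vf; apply: tor1_zero_ext sjq (t1 V Vf) (t2 V Vf).
Qed.

Lemma tor_acyclic_syzygy (Z Q N : lmodType S^c) (j : {linear Z -> Q})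
    (q : {linear Q -> N}) :
  ses j q -> left_flat Q -> tor_acyclic N -> tor_acyclic Z.
Proof.
move=> sjq Qf tN V [{}V Vf|V' F {}V a b sab Ff V'f]; first exact: tor1_zero_flat.
exact: tor1_zero_shift sab Ff sjq Qf (tN _ V'f).
Qed.

End TorVanishing.

(** * Restriction of scalars *)

Definition restr (A B : pzRingType) (f : {rmorphism A -> B}) (M : lmodType B) : Type := M.

Section Restriction.
Variables (A B : pzRingType) (f : {rmorphism A -> B}).

Section Module.
Variable M : lmodType B.

HB.instance Definition _ := GRing.Zmodule.on (restr f M).

Definition restr_scale (a : A) (m : restr f M) : restr f M := f a *: (m : M).

Fact restr_scaleA a b m : restr_scale a (restr_scale b m) = restr_scale (a * b) m.
Proof. by rewrite /restr_scale scalerA rmorphM. Qed.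
Fact restr_scale1 : left_id 1 restr_scale.
Proof. by move=> m; rewrite /restr_scale rmorph1 scale1r. Qed.
Fact restr_scaleDr : right_distributive restr_scale +%R.
Proof. by move=> a m n; rewrite /restr_scale scalerDr. Qed.
Fact restr_scaleDl m : {morph restr_scale^~ m : a b / a + b}.
Proof. by move=> a b; rewrite /restr_scale rmorphD scalerDl. Qed.

HB.instance Definition _ := GRing.Zmodule_isLmodule.Build A (restr f M)
  restr_scaleA restr_scale1 restr_scaleDr restr_scaleDl.

Lemma restrZ a (m : restr f M) : a *: m = f a *: (m : M).
Proof. by []. Qed.

End Module.

Section Map.
Variables (M N : lmodType B) (g : {linear M -> N}).

Fact restr_mapD (x y : restr f M) : g (x + y : restr f M) = g x + g y :> restr f N.
Proof. exact: linearD. Qed.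
Fact restr_mapZ a (x : restr f M) : g (a *: x : restr f M) = a *: (g x : restr f N).
Proof. by rewrite !restrZ linearZ. Qed.

Definition restr_map : {linear restr f M -> restr f N} := lin restr_mapD restr_mapZ.

End Map.

Lemma ses_restr (M N L : lmodType B) (i : {linear M -> N}) (p : {linear N -> L}) :
  ses i p -> ses (restr_map i) (restr_map p).
Proof. by []. Qed.

(** For each [b] the map [t |-> g (t *: b)] from [B] lifts, since [B] is projective over [A]; a dual
    basis of [P] assembles these lifts. *)
Lemma restr_projective (P : lmodType B) :
  projective_module (restr f (B^o : lmodType B)) ->
  projective_module P -> projective_module (restr f P).
Proof.
move=> Bp /projective_dual_basis [sigma sK] X Y p g ps.
have ub_exists (b : P) : exists u : {linear restr f (B^o : lmodType B) -> X},
    forall t : B, p (u t) = g (t *: b : P).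
  have gD (s t : restr f (B^o : lmodType B)) :
      g (((s + t : B) *: b : P) : restr f P) = g ((s : B) *: b : P) + g ((t : B) *: b : P).
    by rewrite scalerDl -linearD.
  have gZ a (t : restr f (B^o : lmodType B)) :
      g ((((a *: t : restr f (B^o : lmodType B)) : B) *: b : P) : restr f P)
      = a *: g ((t : B) *: b : P).
    rewrite -[RHS](linearZ_LR g); congr (g _).
    exact/esym/(scalerA (f a) (t : B) b).
  by have [u uE] := Bp _ _ p (lin gD gZ) ps; exists u => t; rewrite uE.
have [u uE] := choose_fun ub_exists.
pose v b : {additive B -> X} := u b.
pose h (x : restr f P) := combine v (sigma x).
have hD x y : h (x + y) = h x + h y by rewrite /h linearD raddfD.
have hZ a x : h (a *: x) = a *: h x.
  have le : msupp (f a *: sigma x) `<=` msupp (sigma x).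
    apply/fsubsetP => k; rewrite -!mcoeff_neq0 mcoeffZ_free.
    by apply: contra_neq => ->; rewrite mulr0.
  rewrite /h restrZ linearZ (combineEw _ le) /combine scaler_sumr.
  by apply: eq_bigr => k _; rewrite mcoeffZ_free -linearZ.
exists (lin hD hZ) => x.
rewrite [in RHS](sK x) [LHS]/= /h /combine linear_sum.
rewrite (_ : g _ = \sum_(b <- msupp (sigma x)) g ((sigma x)@_b *: b : P)).
  by apply: eq_bigr => b _; rewrite -uE.
exact: (linear_sum g).
Qed.

End Restriction.

(** * Group rings *)

Section RingMorphism.
Variables (A B : pzRingType) (f : A -> B) (fB : {morph f : x y / x - y}).
Variable fM : monoid_morphism f.

Definition ring_map : {rmorphism A -> B} :=
  HB.pack f (GRing.isZmodMorphism.Build A B f fB) (GRing.isMonoidMorphism.Build A B f fM).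

End RingMorphism.

Section GroupRingMaps.
Variables (R : comPzRingType) (G : groupType).
Implicit Types (r s : R) (g h : G).

Lemma gr_eltM r s g h :
  gr_elt r g * gr_elt s h = gr_elt (r * s) (g * h)%g :> group_ring R G.
Proof. exact: gr_mulUU. Qed.

Lemma gr_elt1 : gr_elt 1 1%g = 1 :> group_ring R G.
Proof. by []. Qed.

Fact gr_elt_sub g : {morph (fun r => gr_elt r g : group_ring R G) : x y / x - y}.
Proof. by move=> x y; apply: monalgUB. Qed.

Fact const_l_morph : monoid_morphism (fun r : R^c => gr_elt (r : R) 1%g : group_ring R G).
Proof. by split=> // x y; rewrite gr_eltM mulg1 mulrC. Qed.

(** In a tensor product over [R] the left factor is a module over [R^c] and the right one over [R].
    So left [RG]-modules are restricted along this map and right ones along [const_r]; both are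
    multiplicative because [R] is commutative. *)
Definition const_l : {rmorphism R^c -> group_ring R G} :=
  @ring_map R^c (group_ring R G) _ (gr_elt_sub 1%g) const_l_morph.

Fact const_r_morph :
  monoid_morphism (fun r : R => gr_elt (r : R) 1%g : (group_ring R G)^c).
Proof.
split=> // x y; transitivity (gr_elt y 1%g * gr_elt x 1%g : group_ring R G) => //.
by rewrite gr_eltM mulg1 mulrC.
Qed.

Definition const_r : {rmorphism R -> (group_ring R G)^c} :=
  @ring_map R (group_ring R G)^c _ (gr_elt_sub 1%g) const_r_morph.

Fact gr_lift_subproof (X : zmodType) (w : G -> {additive R -> X}) :
  {f : {additive group_ring R G -> X} | forall r g, f (gr_elt r g) = w g r}.
Proof.
have fB : {morph (fun x : group_ring R G => combine w x) : x y / x - y}.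
  exact: combineB.
exists (addmap fB) => r g; rewrite /= (combineEw _ msuppU_le) big_seq_fset1.
by rewrite mcoeffUU.
Qed.

Definition gr_lift (X : zmodType) (w : G -> {additive R -> X}) := sval (gr_lift_subproof w).

Lemma gr_liftE (X : zmodType) (w : G -> {additive R -> X}) r g :
  gr_lift w (gr_elt r g) = w g r.
Proof. exact: (svalP (gr_lift_subproof w)). Qed.

Lemma gr_additive_eq (X : zmodType) (f1 f2 : {additive group_ring R G -> X}) :
  (forall r g, f1 (gr_elt r g) = f2 (gr_elt r g)) -> forall x, f1 x = f2 x.
Proof.
move=> f12; elim/gr_ind=> [|r g x IH]; first by rewrite !raddf0.
by rewrite !raddfD IH f12.
Qed.

Lemma group_ring_projective :
  projective_module (restr const_l ((group_ring R G)^o : lmodType (group_ring R G))).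
Proof.
move=> X Y p f ps; have [a aE] := choose_fun (fun g => ps (f (gr_elt 1 g))).
have wB g : {morph (fun r : R => (r : R^c) *: a g) : x y / x - y}.
  by move=> x y; rewrite scalerBl.
pose w g := addmap (wB g).
have hZ (r : R) (x : group_ring R G) :
    gr_lift w (gr_elt r 1%g * x) = (r : R^c) *: gr_lift w x.
  elim/gr_ind: x => [|s g x IH]; first by rewrite mulr0 raddf0 scaler0.
  rewrite mulrDr gr_eltM mul1g !(raddfD (gr_lift w)) IH scalerDr; congr (_ + _).
  by rewrite !gr_liftE /= scalerA mulrC.
have hD x y : gr_lift w (x + y) = gr_lift w x + gr_lift w y by exact: raddfD.
exists (@lin _ (restr const_l ((group_ring R G)^o : lmodType (group_ring R G))) X _ hD hZ).
have fB : {morph (fun x : group_ring R G => f x) : x y / x - y} by exact: (linearB f).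
apply: (gr_additive_eq (f1 := p \o gr_lift w) (f2 := addmap fB)) => r g /=.
rewrite gr_liftE linearZ /= aE.
by rewrite -linearZ restrZ; congr (f _); rewrite [LHS]gr_eltM mulr1 mul1g.
Qed.

End GroupRingMaps.

Section Subgroup.
Variables (R : comPzRingType) (G H : groupType) (phi : H -> G).
Hypothesis phi_inj : injective phi.
Hypothesis phiM : forall x y, phi (x * y)%g = (phi x * phi y)%g.
Hypothesis phi1 : phi 1%g = 1%g.

Definition gr_map_fun : {additive group_ring R H -> group_ring R G} :=
  gr_lift (fun h => addmap (gr_elt_sub (phi h))).

Fact gr_map_morph : monoid_morphism gr_map_fun.
Proof.
split=> [|x y]; first by rewrite -gr_elt1 gr_liftE /= phi1.
elim/gr_ind: x => [|r g x IHx]; first by rewrite !(mul0r, raddf0).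
rewrite mulrDl !raddfD mulrDl IHx; congr (_ + _).
elim/gr_ind: y {x IHx} => [|s h y IHy]; first by rewrite !(mulr0, raddf0).
rewrite mulrDr !raddfD mulrDr IHy; congr (_ + _).
by rewrite gr_eltM !gr_liftE /= gr_eltM phiM.
Qed.

Definition gr_map : {rmorphism group_ring R H -> group_ring R G} :=
  ring_map (raddfB gr_map_fun) gr_map_morph.

Lemma gr_mapE r h : gr_map (gr_elt r h) = gr_elt r (phi h).
Proof. exact: gr_liftE. Qed.

(** [choose] depends only on the extension of its predicate, so it selects the same element
    throughout a right coset; injectivity of [phi] then makes the [H]-part equivariant. *)
Lemma coset_representative : exists (rep : G -> G) (eta : G -> H),
  (forall g, g = (phi (eta g) * rep g)%g) /\
  forall h g, rep (phi h * g)%g = rep g /\ eta (phi h * g)%g = (h * eta g)%g.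
Proof.
pose coset (g : G) : pred G := fun g' => `[< exists h, g' = (phi h * g)%g >].
have cosetE h g : coset (phi h * g)%g =1 coset g.
  move=> x; apply/asboolP/asboolP => -[k ->].
    by exists (k * h)%g; rewrite phiM mulgA.
  by exists (k * h^-1)%g; rewrite phiM -mulgA [(phi _ * (phi h * _))%g]mulgA -phiM mulVg phi1 mul1g.
pose rep g := choose (coset g) g.
have repE h g : rep (phi h * g)%g = rep g.
  rewrite /rep (eq_choose (cosetE h g)); apply: choose_id; apply/asboolP.
    by exists h.
  by exists 1%g; rewrite phi1 mul1g.
have [eta etaE] : exists eta : G -> H, forall g, g = (phi (eta g) * rep g)%g.
  apply: (@choose_fun _ _ (fun g h => g = (phi h * rep g)%g)) => g.
  have /asboolP [h hE] : coset g (rep g).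
    by apply: chooseP; apply/asboolP; exists 1%g; rewrite phi1 mul1g.
  by exists (h^-1)%g; rewrite hE mulgA -phiM mulVg phi1 mul1g.
exists rep, eta; split=> // h g; split=> //.
apply: phi_inj; apply: (@mulIg _ (rep g)).
by rewrite -{1}(repE h) -etaE phiM -mulgA -etaE.
Qed.

(** [RG] is free over [RH] on the coset representatives, so lifts need choosing only there;
    [gr_elt r g] is sent to [gr_elt r (eta g) *: a (rep g)]. *)
Lemma group_ring_projective_sub :
  projective_module (restr gr_map ((group_ring R G)^o : lmodType (group_ring R G))).
Proof.
move=> X Y p f ps; have [a aE] := choose_fun (fun g => ps (f (gr_elt 1 g))).
have [rep [eta [etaE repE]]] := coset_representative.
have wB g : {morph (fun r : R => (gr_elt r (eta g) : group_ring R H) *: a (rep g)) : x y / x - y}.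
  by move=> x y; rewrite -scalerBl gr_elt_sub.
pose w g := addmap (wB g).
have hZ (s : group_ring R H) (x : group_ring R G) : gr_lift w (gr_map s * x) = s *: gr_lift w x.
  elim/gr_ind: s => [|r h s IHs]; first by rewrite !(raddf0, mul0r, scale0r).
  rewrite rmorphD mulrDl (raddfD (gr_lift w)) IHs scalerDl; congr (_ + _) => {s IHs}.
  elim/gr_ind: x => [|s g x IH]; first by rewrite mulr0 raddf0 scaler0.
  rewrite mulrDr !(raddfD (gr_lift w)) IH scalerDr; congr (_ + _).
  rewrite gr_mapE gr_eltM !gr_liftE /=; have [-> ->] := repE h g.
  by rewrite scalerA gr_eltM.
have hD x y : gr_lift w (x + y) = gr_lift w x + gr_lift w y by exact: raddfD.
exists (@lin _ (restr gr_map ((group_ring R G)^o : lmodType (group_ring R G))) X _ hD hZ).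
have fB : {morph (fun x : group_ring R G => f x) : x y / x - y} by exact: (linearB f).
apply: (gr_additive_eq (f1 := p \o gr_lift w) (f2 := addmap fB)) => r g /=.
rewrite gr_liftE linearZ /= aE.
rewrite -linearZ restrZ gr_mapE; congr (f _).
by rewrite [LHS]gr_eltM mulr1 -etaE.
Qed.

End Subgroup.

Section GroupRingModules.
Variables (R : comPzRingType) (H : groupType).
Notation RH := (group_ring R H).
Notation resl := (restr (@const_l R H)).
Notation resr := (restr (@const_r R H)).

Section Induced.
Variable A : lmodType R.

Notation RHl := (resl (RH^o : lmodType RH)).

Definition induced : Type := tensor RHl A.
HB.instance Definition _ := GRing.Zmodule.on induced.

Fact rmulD (s : RH) (x y : RHl) : (x + y : RH) * s = (x : RH) * s + (y : RH) * s :> RHl.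
Proof. exact: mulrDl. Qed.
Fact rmulZ (s : RH) (a : R^c) (x : RHl) :
  ((a *: x : RHl) : RH) * s = a *: ((x : RH) * s : RHl).
Proof. by rewrite !restrZ; apply/esym/mulrA. Qed.

Definition rmul s : {linear RHl -> RHl} := lin (@rmulD s) (@rmulZ s).

Definition ind_scale (s : RH^c) (t : induced) : induced := tensor_map (rmul s) idfun t.

Fact ind_scaleA s t x : ind_scale s (ind_scale t x) = ind_scale (s * t) x.
Proof. by apply: tensor_map_comp => // y /=; rewrite -mulrA. Qed.
Fact ind_scale1 : left_id 1 ind_scale.
Proof. by apply: tensor_map_id => // x /=; exact: mulr1. Qed.
Fact ind_scaleDr : right_distributive ind_scale +%R.
Proof. by move=> s x y; apply: raddfD. Qed.
Fact ind_scaleDl x : {morph ind_scale^~ x : s t / s + t}.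
Proof.
move=> s t; pose f (u : RH^c) := tensor_map (rmul u) (idfun : {linear A -> A}).
apply: (tensor_eq (f := f (s + t)) (g := f s \+ f t)) => y a.
rewrite -[LHS]/(f (s + t) (pure y a)) -[RHS]/(f s (pure y a) + f t (pure y a)) /f !tensor_map_pure -pureDl.
exact: (congr1 (fun z : RHl => pure z a) (@mulrDr RH y s t)).
Qed.

HB.instance Definition _ := GRing.Zmodule_isLmodule.Build RH^c induced
  ind_scaleA ind_scale1 ind_scaleDr ind_scaleDl.

Lemma indZ (s : RH^c) (t : induced) : s *: t = tensor_map (rmul s) idfun t.
Proof. by []. Qed.

End Induced.

Lemma RHl_left_flat : left_flat (resl (RH^o : lmodType RH)).
Proof. by apply: projective_lflat; apply: group_ring_projective. Qed.

(* Restriction has the exact left adjoint A |-> RH (x) A.                     *)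
Lemma restr_injective (I : lmodType RH^c) : injective_module I -> injective_module (resr I).
Proof.
move=> Iinj A B i f ii.
pose F (X : lmodType R) := induced X.
pose iF := tensor_map (idfun : {linear resl (RH^o : lmodType RH) -> _}) i.
have iFD (x y : F A) : iF (x + y) = iF x + iF y :> F B by exact: raddfD.
have iFZ (s : RH^c) (x : F A) : iF (s *: x) = s *: (iF x : F B).
  by rewrite !indZ /iF tensor_map_swap.
have bal : balanced (fun (t : resl (RH^o : lmodType RH)) (a : A) => (t : RH^c) *: (f a : I) : I).
  split=> [t1 t2 a|t a1 a2|t r a].
  - exact: scalerDl.
  - by rewrite linearD scalerDr.
  - rewrite linearZ /= !restrZ; apply/esym; exact: scalerA.
have [fF fFE] : exists fF : {additive F A -> I}, forall (t : resl (RH^o : lmodType RH)) a,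
    fF (pure t a) = (t : RH^c) *: (f a : I).
  by exists (tlift bal); apply: (tliftE bal).
have fFD (x y : F A) : fF (x + y) = fF x + fF y by exact: raddfD.
have fFZ (s : RH^c) (x : F A) : fF (s *: x) = s *: fF x.
  elim/tensor_ind: x => [|x y IHx IHy|t a].
  - by rewrite scaler0 raddf0 scaler0.
  - by rewrite scalerBr !(raddfB fF) IHx IHy scalerBr.
  - rewrite (@indZ A s (pure t a)) tensor_map_pure.
    apply: (etrans (fFE (rmul s t) a)); rewrite (fFE t a).
    exact: (esym (scalerA (s : RH^c) (t : RH^c) (f a : I))).
have [|h hE] := Iinj (F A) (F B) (lin iFD iFZ) (lin fFD fFZ).
  exact: RHl_left_flat.
pose one : resl (RH^o : lmodType RH) := (1 : RH).
(* The extension over the induced module is pulled back along the unit [b |-> 1 (x) b] of the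
   adjunction. *)
pose g (b : B) : resr I := h (pure one b).
have gD x y : g (x + y) = g x + g y by rewrite /g pureDr; exact: linearD.
have gZ r x : g (r *: x) = r *: g x.
  rewrite /g -pureZ restrZ.
  have e : pure ((r : R^c) *: one) x = (const_r R H r : RH^c) *: (pure one x : F B).
    rewrite (@indZ B _ (pure one x)) tensor_map_pure.
    apply: (congr1 (fun z : resl (RH^o : lmodType RH) => pure z x)).
    exact: (etrans (mulr1 (const_l R H r)) (esym (mul1r (const_l R H r)))).
  rewrite e.
  exact: (linearZ_LR h (const_r R H r : RH^c) (pure one x : F B)).
exists (lin gD gZ) => a.
transitivity (h (iF (pure one a))); first by rewrite /iF tensor_map_pure.
by rewrite (hE (pure one a : F A)); apply: (etrans (fFE one a)); exact: scale1r.
Qed.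

(* Lam (x)_R I as a right RH-module, with (l (x) i) h = h^-1 l (x) i h.      *)
Section Diagonal.
Variables (Lam : lmodType RH) (I : lmodType RH^c).

Definition diag : Type := tensor (resl Lam) (resr I).
HB.instance Definition _ := GRing.Zmodule.on diag.

Fact grl_linear h : scalable (fun l : resl Lam => (gr_elt 1 h : RH) *: (l : Lam) : resl Lam).
Proof.
move=> a l.
have e : @gr_elt R H 1 h * @gr_elt R H a 1%g = @gr_elt R H a 1%g * @gr_elt R H 1 h :> RH.
  by rewrite !gr_eltM mulg1 mul1g mulrC.
exact: (etrans (scalerA (@gr_elt R H 1 h : RH) (@gr_elt R H a 1%g) (l : Lam))
  (etrans (congr1 (fun z : RH => z *: (l : Lam)) e)
    (esym (scalerA (@gr_elt R H a 1%g : RH) (@gr_elt R H 1 h) (l : Lam))))).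
Qed.

Fact grl_additive h (x y : resl Lam) : (@gr_elt R H 1 h : RH) *: (x + y : Lam) =
  (@gr_elt R H 1 h : RH) *: (x : Lam) + (@gr_elt R H 1 h : RH) *: (y : Lam) :> Lam.
Proof. exact: scalerDr. Qed.

Definition grl h : {linear resl Lam -> resl Lam} :=
  @lin _ (resl Lam) (resl Lam) (fun l : resl Lam => (@gr_elt R H 1 h : RH) *: (l : Lam))
    (@grl_additive h) (@grl_linear h).

Fact grr_linear r h :
  scalable (fun i : resr I => (gr_elt r h : RH^c) *: (i : I) : resr I).
Proof.
move=> a i.
have e : (@gr_elt R H r h : RH^c) * (@gr_elt R H a 1%g : RH^c) =
    (@gr_elt R H a 1%g : RH^c) * (@gr_elt R H r h : RH^c) :> RH^c.
  transitivity (@gr_elt R H a 1%g * @gr_elt R H r h : RH) => //.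
  transitivity (@gr_elt R H r h * @gr_elt R H a 1%g : RH) => //.
  by rewrite !gr_eltM mul1g mulg1 mulrC.
exact: (etrans (scalerA (@gr_elt R H r h : RH^c) (@gr_elt R H a 1%g : RH^c) (i : I))
  (etrans (congr1 (fun z : RH^c => z *: (i : I)) e)
    (esym (scalerA (@gr_elt R H a 1%g : RH^c) (@gr_elt R H r h : RH^c) (i : I))))).
Qed.

Fact grr_additive r h (x y : resr I) : (@gr_elt R H r h : RH^c) *: (x + y : I) =
  (@gr_elt R H r h : RH^c) *: (x : I) + (@gr_elt R H r h : RH^c) *: (y : I) :> I.
Proof. exact: scalerDr. Qed.

Definition grr r h : {linear resr I -> resr I} :=
  @lin _ (resr I) (resr I) (fun i : resr I => (@gr_elt R H r h : RH^c) *: (i : I))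
    (@grr_additive r h) (@grr_linear r h).

Definition act_elt r h : {additive diag -> diag} := tensor_map (grl h^-1%g) (grr r h).

Lemma act_elt_pure r h (l : resl Lam) (i : resr I) : act_elt r h (pure l i) =
  pure ((gr_elt 1 h^-1%g : RH) *: (l : Lam) : resl Lam)
       ((gr_elt r h : RH^c) *: (i : I) : resr I).
Proof. exact: tensor_map_pure. Qed.

Fact act_elt_sub h (t : diag) : {morph (fun r => act_elt r h t) : x y / x - y}.
Proof.
move=> x y; apply: (tensor_eq (f := act_elt (x - y) h) (g := act_elt x h \- act_elt y h)).
move=> l i; rewrite [RHS]/= !act_elt_pure -purer_sub.
apply: (congr1 (fun z : resr I => pure _ z)).
by rewrite gr_elt_sub; exact: (@scalerBl RH^c I (@gr_elt R H x h) (@gr_elt R H y h) i).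
Qed.

Definition diag_scale (s : RH^c) (t : diag) : diag :=
  gr_lift (fun h => addmap (act_elt_sub h t)) s.

Lemma diag_scale_elt r h t : diag_scale (gr_elt r h : RH) t = act_elt r h t.
Proof. exact: gr_liftE. Qed.

Lemma diag_scale0 t : diag_scale 0 t = 0.
Proof. exact: raddf0. Qed.

Fact diag_scaleDl t : {morph diag_scale^~ t : r s / r + s}.
Proof. by move=> r s; apply: raddfD. Qed.

Fact diag_scaleDr : right_distributive diag_scale +%R.
Proof.
move=> s x y; elim/gr_ind: s => [|r h s IH]; first by rewrite !diag_scale0 addr0.
by rewrite !diag_scaleDl IH !diag_scale_elt raddfD addrACA.
Qed.

Lemma diag_scale_r0 s : diag_scale s 0 = 0.
Proof. by apply: (addIr (diag_scale s 0)); rewrite -diag_scaleDr !add0r. Qed.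

Fact diag_scale1 : left_id 1 diag_scale.
Proof.
move=> t; rewrite -[1]gr_elt1 diag_scale_elt; apply: tensor_map_id => x /=.
  by rewrite invg1; exact: scale1r.
exact: scale1r.
Qed.

Lemma act_eltM r h s k t : act_elt r h (act_elt s k t) = act_elt (s * r) (k * h)%g t.
Proof.
apply: tensor_map_comp => x /=.
  apply: (etrans (@scalerA RH Lam (@gr_elt R H 1 h^-1%g) (@gr_elt R H 1 k^-1%g) x)).
  apply: (congr1 (fun z : RH => z *: (x : Lam))).
  by rewrite gr_eltM mulr1 invgM.
apply: (etrans (@scalerA RH^c I (@gr_elt R H r h) (@gr_elt R H s k) x)).
apply: (congr1 (fun z : RH^c => z *: (x : I))).
transitivity (@gr_elt R H s k * @gr_elt R H r h : RH) => //.
by rewrite gr_eltM.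
Qed.

Fact diag_scaleA a b t : diag_scale a (diag_scale b t) = diag_scale (a * b) t.
Proof.
rewrite -[a * b]/((b : RH) * (a : RH)).
elim/gr_ind: a => [|r h a IHa]; first by rewrite mulr0 !diag_scale0.
rewrite mulrDr !diag_scaleDl IHa; congr (_ + _) => {a IHa}.
elim/gr_ind: b => [|s k b IHb]; first by rewrite mul0r !diag_scale0 diag_scale_r0.
rewrite mulrDl !diag_scaleDl diag_scaleDr IHb; congr (_ + _).
by rewrite gr_eltM !diag_scale_elt act_eltM.
Qed.

HB.instance Definition _ := GRing.Zmodule_isLmodule.Build RH^c diag
  diag_scaleA diag_scale1 diag_scaleDr diag_scaleDl.

Lemma diagZ_elt r h (t : diag) : (gr_elt r h : RH^c) *: t = act_elt r h t.
Proof. exact: diag_scale_elt. Qed.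

End Diagonal.
End GroupRingModules.

(** * Diagonal tensor products *)

(** [g] factors as the cokernel of [f] followed by an injection; the former is handled by right
    exactness, the latter by flatness. *)
Lemma exact_flat (S : pzRingType) (A B C : lmodType S^c) (f : {linear A -> B})
    (g : {linear B -> C}) (Q : lmodType S) :
  exact_at f g -> flat_module Q ->
  exact_at (tensor_map f (idfun : {linear Q -> Q})) (tensor_map g (idfun : {linear Q -> Q})).
Proof.
move=> ex Qf.
have [Z [p [ps px]]] := cokernel_exists f.
have [|j jE] := lin_factor (f := g) ps; first by move=> x /px /ex.
have ji : injective j.
  by apply: lin_inj => y; have [x <-] := ps y; rewrite jE => /ex /px.
have fac x : tensor_map g (idfun : {linear Q -> Q}) x = tensor_map j idfun (tensor_map p idfun x).
  exact/esym/tensor_map_comp.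
move=> x; rewrite fac; have e := tensor_exactl (N := Q) ps px x.
split=> [h|/e ->]; last exact: raddf0.
by apply/e; apply: (Qf _ _ j ji); rewrite h raddf0.
Qed.

(** The piece [H_2(B) -> H_2(C) -> H_1(A)] of the long exact homology sequence, both outer groups
    being zero. *)
Lemma acyclic_quotient
    (A0 A1 A2 B0 B1 B2 B3 C1 C2 C3 : zmodType)
    (dA0 : {additive A1 -> A0}) (dA1 : {additive A2 -> A1})
    (dB0 : {additive B1 -> B0}) (dB1 : {additive B2 -> B1}) (dB2 : {additive B3 -> B2})
    (dC1 : {additive C2 -> C1}) (dC2 : {additive C3 -> C2})
    (a0 : {additive A0 -> B0}) (a1 : {additive A1 -> B1}) (a2 : {additive A2 -> B2})
    (b1 : {additive B1 -> C1}) (b2 : {additive B2 -> C2}) (b3 : {additive B3 -> C3}) :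
  (forall x, a0 (dA0 x) = dB0 (a1 x)) -> (forall x, a1 (dA1 x) = dB1 (a2 x)) ->
  (forall x, b1 (dB1 x) = dC1 (b2 x)) -> (forall x, b2 (dB2 x) = dC2 (b3 x)) ->
  (forall x, dB0 (dB1 x) = 0) ->
  injective a0 -> exact_at a1 b1 -> (forall x, b2 (a2 x) = 0) -> surj b2 ->
  exact_at dA1 dA0 -> exact_at dB2 dB1 ->
  forall x, dC1 x = 0 -> exists y, dC2 y = x.
Proof.
move=> sA0 sA1 sB1 sB2 dd a0i ex1 ba bs exA exB x x0.
have [y yx] := bs x; have [|w wE] := (ex1 (dB1 y)).1; first by rewrite sB1 yx.
have [|v vE] := (exA w).1.
  by apply: (add_inj0 a0i); rewrite sA0 wE dd.
have [|u uE] := (exB (y - a2 v)).1; first by rewrite raddfB -sA1 vE wE subrr.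
by exists (b3 u); rewrite -sB2 uE raddfB ba subr0.
Qed.

Lemma tensor_map_eq (S : pzRingType) (M M' : lmodType S^c) (N N' : lmodType S)
    (f f' : {linear M -> M'}) (g g' : {linear N -> N'}) :
  f =1 f' -> g =1 g' -> tensor_map f g =1 tensor_map f' g'.
Proof.
move=> ff gg; apply: (tensor_eq (f := tensor_map f g) (g := tensor_map f' g')) => m n.
by rewrite [LHS]tensor_map_pure [RHS]tensor_map_pure ff gg.
Qed.

Lemma tensor_map_comp0 (S : pzRingType) (M1 M2 M3 : lmodType S^c) (N1 N2 N3 : lmodType S)
    (f : {linear M1 -> M2}) (f' : {linear M2 -> M3})
    (g : {linear N1 -> N2}) (g' : {linear N2 -> N3}) :
  (forall x, f' (f x) = 0) \/ (forall x, g' (g x) = 0) ->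
  forall x, tensor_map f' g' (tensor_map f g x) = 0.
Proof.
move=> fg0; pose z : {additive tensor M1 N1 -> tensor M3 N3} := \0.
apply: (tensor_eq (f := tensor_map f' g' \o tensor_map f g) (g := z)) => m n.
transitivity (pure (f' (f m)) (g' (g n))); first by rewrite /= !tensor_map_pure.
by case: fg0 => ->; rewrite ?pure0l ?pure0r.
Qed.

(** Flatness of the terms of [C] turns [0 -> V' -> F -> V -> 0] into a short exact sequence of
    complexes, so acyclicity passes to the quotient. *)
Lemma finite_fd_acyclic (S : pzRingType) (C : complex S^c) (V : lmodType S) :
  (forall n, left_flat (ob C n)) -> acyclic C -> finite_fd V ->
  forall n, exact_at (tensor_map (diff C (n + 1)) (idfun : {linear V -> V}))
                     (tensor_map (diff C n) (idfun : {linear V -> V})).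
Proof.
move=> Cf Ca; elim=> [{}V Vf|V' F {}V a b sab Ff _ IH] n; first exact: exact_flat.
have [m e] : exists m, n = m + 1 by exists (n - 1); rewrite subrK.
subst n; have [ai bs abx] := sab.
move=> x; split=> [|[y <-]]; last first.
  by apply: tensor_map_comp0; left => z; apply: diff_diff.
move: x; apply: (@acyclic_quotient _ _ _ _ _ _ _ _ _ _
  (tensor_map (diff C m) (idfun : {linear V' -> V'}))
  (tensor_map (diff C (m + 1)) (idfun : {linear V' -> V'}))
  (tensor_map (diff C m) (idfun : {linear F -> F}))
  (tensor_map (diff C (m + 1)) (idfun : {linear F -> F}))
  (tensor_map (diff C (m + 1 + 1)) (idfun : {linear F -> F}))
  (tensor_map (diff C (m + 1)) (idfun : {linear V -> V}))
  (tensor_map (diff C (m + 1 + 1)) (idfun : {linear V -> V}))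
  (tensor_map (idfun : {linear ob C m -> ob C m}) a)
  (tensor_map (idfun : {linear ob C (m + 1) -> ob C (m + 1)}) a)
  (tensor_map (idfun : {linear ob C (m + 1 + 1) -> ob C (m + 1 + 1)}) a)
  (tensor_map (idfun : {linear ob C (m + 1) -> ob C (m + 1)}) b)
  (tensor_map (idfun : {linear ob C (m + 1 + 1) -> ob C (m + 1 + 1)}) b)
  (tensor_map (idfun : {linear ob C (m + 1 + 1 + 1) -> ob C (m + 1 + 1 + 1)}) b)).
- by move=> x; apply/esym/tensor_map_swap.
- by move=> x; apply/esym/tensor_map_swap.
- by move=> x; apply/esym/tensor_map_swap.
- by move=> x; apply/esym/tensor_map_swap.
- by move=> x; apply: tensor_map_comp0; left => z; apply: diff_diff.
- exact: Cf.
- exact: tensor_exactr.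
- by move=> x; apply: tensor_map_comp0; right => z; apply: (ses_comp0 z sab).
- by apply: tensor_map_surj => //; apply: idfun_surj.
- exact: IH.
- exact: exact_flat.
Qed.

Section RestrictedComplex.
Variables (A B : pzRingType) (f : {rmorphism A -> B}) (P : complex B).

Fact restr_diff_diff (n : int) x :
  restr_map f (diff P n) (restr_map f (diff P (n + 1)) x) = 0.
Proof. exact: diff_diff. Qed.

Definition restr_complex : complex A :=
  @Complex A (fun n => restr f (ob P n)) (fun n => restr_map f (diff P n)) restr_diff_diff.

End RestrictedComplex.

(* K stands for the group ring of H over R, with elt r h = r h; cl and cr are *)
(* the two versions of R -> K.                                               *)
Section DiagonalTheory.
Variables (R : comPzRingType) (H : groupType) (K : pzRingType) (elt : R -> H -> K).
Hypothesis eltM : forall r s g h, elt r g * elt s h = elt (r * s) (g * h)%g.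
Hypothesis elt1 : elt 1 1%g = 1.
Hypothesis elt_ind : forall P : K -> Prop, P 0 ->
  (forall r g x, P x -> P (elt r g + x)) -> forall x, P x.
Variables (cl : {rmorphism R^c -> K}) (cr : {rmorphism R -> K^c}).
Hypothesis clE : forall r : R, cl r = elt r 1%g.
Hypothesis crE : forall r : R, cr r = elt r 1%g.

Notation resl := (restr cl).
Notation resr := (restr cr).
Implicit Types L N : lmodType K.

(** The action is recorded only on pure tensors and generators of [K], which determine it. The
    construction of [diag] stays hidden behind two inverse additive maps. *)
Record diagonal_module (I : lmodType K^c) L := Diagonal {
  diag_sort : lmodType K^c;
  diag_into : {additive tensor (resl L) (resr I) -> diag_sort};
  diag_from : {additive diag_sort -> tensor (resl L) (resr I)};
  diag_intoK : cancel diag_into diag_from;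
  diag_fromK : cancel diag_from diag_into;
  diag_elt : forall r h (l : L) (i : I),
    (elt r h : K^c) *: diag_into (@pure R (resl L) (resr I) l i) =
    diag_into (@pure R (resl L) (resr I) (elt 1 h^-1%g *: l) ((elt r h : K^c) *: i))
}.

Variables (I : lmodType K^c) (D : forall L, diagonal_module I L).
Notation T L := (tensor (resl L) (resr I)).

Definition diagm L : lmodType K^c := diag_sort (D L).
Definition to_diagm L : {additive T L -> diagm L} := diag_into (D L).
Definition of_diagm L : {additive diagm L -> T L} := diag_from (D L).

Lemma to_diagmK L : cancel (to_diagm L) (of_diagm L).
Proof. exact: diag_intoK. Qed.

Lemma of_diagmK L : cancel (of_diagm L) (to_diagm L).
Proof. exact: diag_fromK. Qed.

Definition dpure L (l : L) (i : I) : diagm L := to_diagm L (@pure R (resl L) (resr I) l i).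

Lemma diagZ_pure L r h (l : L) (i : I) : (elt r h : K^c) *: dpure l i =
  dpure ((elt 1 h^-1%g : K) *: l) ((elt r h : K^c) *: i).
Proof. exact: diag_elt. Qed.

Lemma diagZ_const L r (l : L) (i : I) :
  (elt r 1%g : K^c) *: dpure l i = dpure l ((elt r 1%g : K^c) *: i).
Proof.
apply: (etrans (diagZ_pure r 1%g l i)); apply: (congr1 (fun z : L => dpure z _)).
by rewrite invg1 elt1 scale1r.
Qed.

Lemma dpure_const L r (l : L) (i : I) :
  dpure ((elt r 1%g : K) *: l) i = dpure l ((elt r 1%g : K^c) *: i).
Proof.
have := @pureZ R (resl L) (resr I) l r i.
rewrite (@restrZ _ _ cl L r l) clE (@restrZ _ _ cr I r i) crE => e.
exact: (congr1 (to_diagm L) e).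
Qed.

Lemma dpureDl L (l l' : L) i : dpure (l + l') i = dpure l i + dpure l' i.
Proof.
rewrite /dpure -raddfD; apply: (congr1 (to_diagm L)); exact: (@pureDl R (resl L) (resr I)).
Qed.

Lemma dpureDr L (l : L) i i' : dpure l (i + i') = dpure l i + dpure l i'.
Proof.
rewrite /dpure -raddfD; apply: (congr1 (to_diagm L)); exact: (@pureDr R (resl L) (resr I)).
Qed.

Lemma diag_ind L (P : diagm L -> Prop) : P 0 -> (forall x y, P x -> P y -> P (x - y)) ->
  (forall l i, P (dpure l i)) -> forall x, P x.
Proof.
move=> P0 PB Pp x; rewrite -[x]of_diagmK; elim/tensor_ind: (of_diagm L x) => [|y z Py Pz|l i].
- by rewrite raddf0.
- by rewrite raddfB; apply: PB.
- exact: Pp.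
Qed.

Lemma diag_eq L (A : zmodType) (f g : {additive diagm L -> A}) :
  (forall l i, f (dpure l i) = g (dpure l i)) -> forall x, f x = g x.
Proof.
move=> fg; elim/diag_ind=> [|x y fx fy|//]; first by rewrite !raddf0.
by rewrite !raddfB fx fy.
Qed.

Lemma elt_eq (A : zmodType) (f g : {additive K -> A}) :
  (forall r h, f (elt r h) = g (elt r h)) -> forall x, f x = g x.
Proof.
move=> fg; elim/elt_ind=> [|r h x fx]; first by rewrite !raddf0.
by rewrite !raddfD fx fg.
Qed.

Section Map.
Variables (L L' : lmodType K) (f : {linear L -> L'}).

Definition diag_tmap : {additive T L -> T L'} :=
  tensor_map (restr_map cl f) (idfun : {linear resr I -> resr I}).

Definition diag_fun : {additive diagm L -> diagm L'} := to_diagm L' \o diag_tmap \o of_diagm L.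

Lemma diag_fun_into t : diag_fun (to_diagm L t) = to_diagm L' (diag_tmap t).
Proof. by rewrite /= to_diagmK. Qed.

Lemma diag_fun_pure l i : diag_fun (dpure l i) = dpure (f l) i.
Proof. by rewrite diag_fun_into [diag_tmap _]tensor_map_pure. Qed.

Fact diag_funZ s x : diag_fun (s *: x) = s *: diag_fun x.
Proof.
elim/elt_ind: s => [|r h s IH].
  by rewrite (@scale0r K^c (diagm L) x) (@scale0r K^c (diagm L')) raddf0.
rewrite (@scalerDl K^c (diagm L)) (@scalerDl K^c (diagm L')) (raddfD diag_fun) IH.
congr (_ + _).
elim/diag_ind: x {IH} => [|x y IHx IHy|l i].
- by rewrite scaler0 raddf0 scaler0.
- by rewrite scalerBr !(raddfB diag_fun) IHx IHy scalerBr.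
- rewrite (@diagZ_pure L r h l i) !diag_fun_pure (@diagZ_pure L' r h (f l) i).
  by rewrite linearZ.
Qed.

Definition diag_map : {linear diagm L -> diagm L'} := lin (raddfD diag_fun) diag_funZ.

Lemma diag_mapE x : diag_map x = diag_fun x.
Proof. by []. Qed.

Lemma diag_map_pure l i : diag_map (dpure l i) = dpure (f l) i.
Proof. exact: diag_fun_pure. Qed.

End Map.

Section Swap.
Variables L N : lmodType K.

Fact swap_inner_balanced (n : N) :
  @balanced R (resl L) (resr I) _ (fun l i => pure (dpure n i) (l : L)).
Proof.
split=> [l1 l2 i|l i1 i2|l r i].
- exact: pureDr.
- by rewrite dpureDr pureDl.
- rewrite (@restrZ _ _ cl L r l) clE (@restrZ _ _ cr I r i) crE.
  have e := @pureZ K (diagm N) L (dpure n i) (elt r 1%g) l.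
  rewrite (@diagZ_const N r n i) in e; exact: esym e.
Qed.

Fact swap_inner_subproof (n : N) : {f : {additive diagm L -> tensor (diagm N) L} |
  forall l i, f (dpure l i) = pure (dpure n i) l}.
Proof.
exists (tlift (swap_inner_balanced n) \o of_diagm L) => l i /=.
by rewrite /dpure to_diagmK; exact: (tliftE (swap_inner_balanced n)).
Qed.

Definition swap_inner n := sval (swap_inner_subproof n).

Lemma swap_innerE n l i : swap_inner n (dpure l i) = pure (dpure n i) l.
Proof. exact: (svalP (swap_inner_subproof n)). Qed.

Lemma swap_innerD n1 n2 y : swap_inner (n1 + n2) y = swap_inner n1 y + swap_inner n2 y.
Proof.
apply: (diag_eq (f := swap_inner (n1 + n2)) (g := swap_inner n1 \+ swap_inner n2)) => l i.
apply: (etrans (swap_innerE _ l i)); rewrite dpureDl pureDl.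
exact: (esym (congr2 +%R (swap_innerE n1 l i) (swap_innerE n2 l i))).
Qed.

(** Balancedness on generators. The factor [h^-1] put on [l] moves across the outer tensor product
    and acts diagonally on [n (x) i], as [h] on [n] and as [h^-1] on [i]; there it cancels [h] and
    leaves the constant [r], which then passes to [n]. *)
Lemma swap_elt r h l i n :
  swap_inner n ((elt r h : K^c) *: dpure l i) = pure (dpure (elt r h *: n) i) l.
Proof.
rewrite diagZ_pure; apply: (etrans (swap_innerE n _ _)).
apply: (etrans (esym (pureZ (dpure n ((elt r h : K^c) *: i)) (elt 1 h^-1%g) l))).
apply: (congr1 (fun z : diagm N => pure z l)).
rewrite diagZ_pure invgK.
have -> : (elt 1 h^-1%g : K^c) *: ((elt r h : K^c) *: i) = (elt r 1%g : K^c) *: i.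
  apply: (etrans (@scalerA K^c I (elt 1 h^-1%g) (elt r h) i)).
  apply: (congr1 (fun z : K^c => z *: i)).
  transitivity (elt r h * elt 1 h^-1%g); first by [].
  by rewrite eltM mulr1 mulgV.
by rewrite -dpure_const scalerA eltM mulr1 mul1g.
Qed.

Lemma swap_innerZ (s : K) y n : swap_inner n ((s : K^c) *: y) = swap_inner (s *: n) y.
Proof.
have sB : {morph (fun y : diagm L => (s : K^c) *: y) : x y / x - y} by move=> ? ?; apply: scalerBr.
apply: (diag_eq (f := swap_inner n \o addmap sB) (g := swap_inner (s *: n))) => l i.
apply: etrans (esym (swap_innerE (s *: n) l i)).
have f1B : {morph (fun t : K => (t : K^c) *: dpure l i) : x y / x - y}.
  by move=> ? ?; apply: scalerBl.
have f2B : {morph (fun t : K => dpure (t *: n) i) : x y / x - y}.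
  move=> t u; apply/eqP; rewrite scalerBl -subr_eq opprK -dpureDl; apply/eqP.
  by rewrite subrK.
apply: (elt_eq (f := swap_inner n \o addmap f1B) (g := purel (diagm N) l \o addmap f2B)).
move=> r h; exact: swap_elt.
Qed.

Fact swap_balanced : balanced (fun (y : diagm L) n => swap_inner n y).
Proof.
split=> [y1 y2 n|y n1 n2|y s n]; first exact: raddfD.
  exact: swap_innerD.
exact: swap_innerZ.
Qed.

Definition swap : {additive tensor (diagm L) N -> tensor (diagm N) L} := tlift swap_balanced.

Lemma swapE l i n : swap (pure (dpure l i) n) = pure (dpure n i) l.
Proof. by rewrite /swap tliftE swap_innerE. Qed.

End Swap.

Lemma diag_tensor_eq L N (A : zmodType) (f g : {additive tensor (diagm L) N -> A}) :
  (forall l i n, f (pure (dpure l i) n) = g (pure (dpure l i) n)) -> forall x, f x = g x.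
Proof.
move=> fg; apply: tensor_eq => y n.
elim/diag_ind: y => [|x y IHx IHy|l i]; first by rewrite pure0l !raddf0.
  by rewrite purel_sub !raddfB IHx IHy.
exact: fg.
Qed.

Lemma swapK L N x : swap N L (swap L N x) = x.
Proof.
apply: (diag_tensor_eq (f := swap N L \o swap L N) (g := idfun)) => l i n.
by rewrite /= !swapE.
Qed.

Lemma swap_natural L L' N N' (f : {linear L -> L'}) (g : {linear N -> N'}) x :
  swap L' N' (tensor_map (diag_map f) g x) = tensor_map (diag_map g) f (swap L N x).
Proof.
apply: (diag_tensor_eq (f := swap L' N' \o tensor_map (diag_map f) g)
  (g := tensor_map (diag_map g) f \o swap L N)) => l i n.
transitivity (pure (dpure (g n) i) (f l)).
  apply: (etrans (congr1 (swap L' N') (tensor_map_pure (diag_map f) g (dpure l i) n))).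
  rewrite diag_map_pure; exact: swapE.
apply: (etrans _ (esym (congr1 (tensor_map (diag_map g) f) (swapE l i n)))).
by rewrite tensor_map_pure diag_map_pure.
Qed.

Lemma diag_map_inj L L' (f : {linear L -> L'}) :
  injective (diag_tmap f) -> injective (diag_map f).
Proof.
move=> fi x y; rewrite !diag_mapE -[x]of_diagmK -[y]of_diagmK !diag_fun_into.
by move=> /(can_inj (@to_diagmK L')) /fi ->.
Qed.

Lemma diag_map_surj L L' (f : {linear L -> L'}) :
  surj (diag_tmap f) -> surj (diag_map f).
Proof.
move=> fs y; have [x xy] := fs (of_diagm L' y); exists (to_diagm L x).
by rewrite diag_mapE diag_fun_into xy of_diagmK.
Qed.

Lemma diag_map_exact L L' L'' (f : {linear L -> L'}) (g : {linear L' -> L''}) :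
  exact_at (diag_tmap f) (diag_tmap g) -> exact_at (diag_map f) (diag_map g).
Proof.
move=> ex y; rewrite diag_mapE -[y]of_diagmK diag_fun_into.
split=> [e|[x xE]].
  have /ex [x xy] : diag_tmap g (of_diagm L' y) = 0.
    by apply: (can_inj (@to_diagmK L'')); rewrite e raddf0.
  by exists (to_diagm L x); rewrite diag_mapE diag_fun_into xy.
have /ex -> : exists x, diag_tmap f x = of_diagm L' y.
  by exists (of_diagm L x); rewrite -[of_diagm L' y]to_diagmK -xE diag_mapE /= to_diagmK.
by rewrite raddf0.
Qed.

Variable P : complex K.
Hypothesis P_proj : forall n, projective_module (ob P n).
Hypothesis P_acyclic : acyclic P.
Hypothesis restr_proj : forall Q : lmodType K, projective_module Q -> projective_module (resl Q).
Hypothesis I_fd : finite_fd (resr I).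

Lemma diag_diff_exact n : exact_at (diag_map (diff P (n + 1))) (diag_map (diff P n)).
Proof.
apply: diag_map_exact.
apply: (@finite_fd_acyclic R (restr_complex cl P) (resr I) _ _ I_fd n) => m.
  by apply: projective_lflat; apply: restr_proj.
exact: P_acyclic.
Qed.

Lemma diag_map_id L : diag_map (idfun : {linear L -> L}) =1 id.
Proof.
apply: (diag_eq (f := diag_map idfun) (g := idfun)) => l i; exact: diag_map_pure.
Qed.

Lemma swap_diff Q n x :
  swap Q (ob P n) (tensor_map (idfun : {linear diagm Q -> diagm Q}) (diff P n) x) =
  tensor_map (diag_map (diff P n)) (idfun : {linear Q -> Q}) (swap Q (ob P (n + 1)) x).
Proof.
rewrite -swap_natural; apply: (congr1 (swap Q (ob P n))).
apply: tensor_map_eq => // y; exact/esym/diag_map_id.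
Qed.

Lemma projective_diag_acyclic Q : projective_module Q -> tensor_acyclic (diagm Q) P.
Proof.
move=> Qp n x; have ex := exact_flat (@diag_diff_exact n) (projective_flat Qp).
split=> [e|[y <-]]; last by apply: tensor_map_comp0; right => z; apply: diff_diff.
have /ex [y yE] : tensor_map (diag_map (diff P n)) (idfun : {linear Q -> Q})
    (swap Q (ob P (n + 1)) x) = 0.
  by rewrite -swap_diff e; exact: raddf0.
exists (swap (ob P (n + 1 + 1)) Q y).
have sK : cancel (swap Q (ob P (n + 1))) (swap (ob P (n + 1)) Q) by move=> z; apply: swapK.
apply: (can_inj sK); rewrite -yE swap_diff; congr (tensor_map _ _ _); exact: swapK.
Qed.

(** Tor-acyclicity passes down to the syzygy [Z], and keeps the sequence exact on the left after
    tensoring with [I]; acyclicity then passes from [Z] and [Q] to the quotient. *)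
Lemma finite_pd_diag_acyclic Lam : finite_pd Lam -> tor_acyclic (resl Lam) ->
  tensor_acyclic (diagm Lam) P.
Proof.
elim=> [Q Qp _|Z Q N i p sip Qp _ IH tN]; first exact: projective_diag_acyclic.
have srip := ses_restr cl sip; have [_ ps ipx] := srip.
have tZ : tor_acyclic (resl Z).
  by apply: tor_acyclic_syzygy srip _ tN; apply: projective_lflat; apply: restr_proj.
have aZ := IH tZ; have aQ := projective_diag_acyclic Qp.
have yi : injective (diag_map i).
  by apply: diag_map_inj; apply: (tN _ I_fd _ _ _ _ srip).
have yp : surj (diag_map p).
  by apply: diag_map_surj; apply: tensor_map_surj => //; apply: idfun_surj.
have yx : exact_at (diag_map i) (diag_map p).
  by apply: diag_map_exact; apply: tensor_exactl.
move=> n x; split=> [|[y <-]]; last first.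
  by apply: tensor_map_comp0; right => z; apply: diff_diff.
have [m e] : exists m, n = m + 1 by exists (n - 1); rewrite subrK.
subst n; move: x; apply: (@acyclic_quotient _ _ _ _ _ _ _ _ _ _
  (tensor_map (idfun : {linear diagm Z -> diagm Z}) (diff P m))
  (tensor_map (idfun : {linear diagm Z -> diagm Z}) (diff P (m + 1)))
  (tensor_map (idfun : {linear diagm Q -> diagm Q}) (diff P m))
  (tensor_map (idfun : {linear diagm Q -> diagm Q}) (diff P (m + 1)))
  (tensor_map (idfun : {linear diagm Q -> diagm Q}) (diff P (m + 1 + 1)))
  (tensor_map (idfun : {linear diagm N -> diagm N}) (diff P (m + 1)))
  (tensor_map (idfun : {linear diagm N -> diagm N}) (diff P (m + 1 + 1)))
  (tensor_map (diag_map i) (idfun : {linear ob P m -> ob P m}))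
  (tensor_map (diag_map i) (idfun : {linear ob P (m + 1) -> ob P (m + 1)}))
  (tensor_map (diag_map i) (idfun : {linear ob P (m + 1 + 1) -> ob P (m + 1 + 1)}))
  (tensor_map (diag_map p) (idfun : {linear ob P (m + 1) -> ob P (m + 1)}))
  (tensor_map (diag_map p) (idfun : {linear ob P (m + 1 + 1) -> ob P (m + 1 + 1)}))
  (tensor_map (diag_map p) (idfun : {linear ob P (m + 1 + 1 + 1) -> ob P (m + 1 + 1 + 1)}))).
- by move=> x; apply: tensor_map_swap.
- by move=> x; apply: tensor_map_swap.
- by move=> x; apply: tensor_map_swap.
- by move=> x; apply: tensor_map_swap.
- by move=> x; apply: tensor_map_comp0; right => z; apply: diff_diff.
- by apply: projective_flat yi.
- exact: tensor_exactl.
- by move=> x; apply: tensor_map_comp0; left => z; apply/yx; exists z.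
- by apply: tensor_map_surj => //; apply: idfun_surj.
- exact: aZ.
- exact: aQ.
Qed.

(** Since [l0] is fixed by [H], the diagonal action on [l0 (x) i] moves only [i], so
    [i |-> l0 (x) i] is [K]-linear. It splits, and a retract of an acyclic complex is acyclic. *)
Lemma tensor_acyclic_retract (Lam : lmodType K) (l0 : Lam) : injective_module I ->
  (forall h, elt 1 h *: l0 = l0) -> injective (fun i : resr I => @pure R (resl Lam) (resr I) l0 i) ->
  tensor_acyclic (diagm Lam) P -> tensor_acyclic I P.
Proof.
move=> Iinj l0P l0i aL.
pose j i := dpure l0 i.
have jD x y : j (x + y) = j x + j y by exact: dpureDr.
have jB : {morph j : x y / x - y}.
  by move=> x y; apply/eqP; rewrite -subr_eq opprK -jD subrK.
have jZ (s : K^c) i : j (s *: i) = s *: j i.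
  have f1B : {morph (fun t : K => j ((t : K^c) *: i)) : x y / x - y}.
    by move=> t u; rewrite -jB; congr j; apply: scalerBl.
  have f2B : {morph (fun t : K => (t : K^c) *: j i) : x y / x - y}.
    by move=> t u; apply: scalerBl.
  apply: (elt_eq (f := addmap f1B) (g := addmap f2B)) => r h.
  by rewrite [RHS](diagZ_pure r h l0 i) l0P.
have ji : injective (lin jD jZ).
  by move=> x y /(can_inj (@to_diagmK Lam)) /l0i.
have [q qE] := Iinj _ _ (lin jD jZ) idfun ji.
move=> n x; split=> [e|[y <-]]; last first.
  by apply: tensor_map_comp0; right => z; apply: diff_diff.
have /aL [y yE] : tensor_map (idfun : {linear diagm Lam -> diagm Lam}) (diff P n)
    (tensor_map (lin jD jZ) idfun x) = 0.
  by rewrite -tensor_map_swap e raddf0.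
exists (tensor_map q idfun y); rewrite -tensor_map_swap yE.
rewrite (@tensor_map_comp _ _ _ _ _ _ _ _ _ (q \o lin jD jZ) _ _ idfun) //.
by apply: tensor_map_id.
Qed.

End DiagonalTheory.

(** * The restriction theorem *)

Section Infima.
Variable P : nat -> Prop.

Lemma infn_some n : infn P = Some n -> P n.
Proof.
rewrite /infn; case: pselect => // exP [<-].
by case: ex_minnP => m /asboolP.
Qed.

Lemma infn_le n : P n -> exists2 m, infn P = Some m & (m <= n)%N.
Proof.
move=> Pn; rewrite /infn; case: pselect => [exP|nP]; last first.
  by case: nP; exists n; apply/asboolP.
by case: ex_minnP => m _ mmin; exists m => //; apply/mmin/asboolP.
Qed.

End Infima.

Lemma sfli_finite_fd (R : pzRingType) (I : lmodType R) :
  (sfli R < infty)%O -> injective_module I -> finite_fd I.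
Proof.
move=> sf Iinj; move: sf; rewrite /sfli /supn.
case E : (infn _) => [n|] // _.
have := infn_some E (flat_dim I) (ex_intro _ I (conj Iinj erefl)).
rewrite /flat_dim /resolution_dim; case F : (infn _) => [m|] // _.
exact: resolution_finite_fd (infn_some F).
Qed.

Lemma finite_pd_restr (A B : pzRingType) (f : {rmorphism A -> B}) (M : lmodType B) :
  projective_module (restr f (B^o : lmodType B)) ->
  finite_pd M -> finite_pd (restr f M).
Proof.
move=> Bp; elim=> [Q Qp|Z Q N i p sip Qp _ IH].
  by apply: finite_pd_proj; apply: restr_projective.
by apply: finite_pd_ses (ses_restr f sip) _ IH; apply: restr_projective.
Qed.

Section Restriction.
Variables (R : comPzRingType) (G H : groupType) (phi : H -> G).
Hypothesis phi_inj : injective phi.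
Hypothesis phiM : forall x y, phi (x * y)%g = (phi x * phi y)%g.
Hypothesis phi1 : phi 1%g = 1%g.
Notation RG := (group_ring R G).
Notation RH := (group_ring R H).
Notation gmap := (@gr_map R G H phi phiM phi1).
Notation down M := (restr (@const_l R H) (restr gmap M)).

Lemma restr_sub_projective (Q : lmodType RG) :
  projective_module Q -> projective_module (restr gmap Q).
Proof. by apply: restr_projective; apply: group_ring_projective_sub. Qed.

Lemma restr_const_projective (Q : lmodType RH) :
  projective_module Q -> projective_module (restr (@const_l R H) Q).
Proof. by apply: restr_projective; apply: group_ring_projective. Qed.

Definition down_acyclic (M : lmodType RG) : Prop := tor_acyclic (down M).

Lemma down_acyclic_ext : ext_closed down_acyclic.
Proof.
move=> L1 L L2 i p sip; apply: tor_acyclic_ext.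
exact: (ses_restr (@const_l R H) (ses_restr gmap sip)).
Qed.

(** With [L] the cosyzygy of [M] and [V'] the syzygy of [V], [Tor_1(M, V) = Tor_1(L, V')]. The
    induction is on [V] for all PGF modules at once, as [M] is replaced by [L] at each step. *)
Lemma PGF_down_acyclic (M : lmodType RG) : PGF M -> down_acyclic M.
Proof.
move=> PM V Vf; elim: Vf M PM => [{}V Vf M _|V' F {}V a b sab Ff _ IH M PM].
  exact: tor1_zero_flat.
have [Q [L [i [p [Qp sip PL]]]]] := PGF_cosyzygy PM.
apply: tor1_zero_shift sab Ff (ses_restr (@const_l R H) (ses_restr gmap sip)) _ (IH L PL).
by apply/projective_lflat/restr_const_projective/restr_sub_projective.
Qed.

Lemma down_trivial_projective :
  projective_module (down (trivial_module R G : lmodType RG)).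
Proof.
move=> A B p f ps; have [a aE] := ps (f (1 : R)).
have hZ (r : R^c) (x : down (trivial_module R G : lmodType RG)) :
    ((r *: x : R) : R^c) *: a = r *: (((x : R) : R^c) *: a).
  rewrite scalerA; apply: (congr1 (fun z : R^c => z *: a)).
  transitivity (augmentation (gmap (gr_elt (r : R) 1%g)) * (x : R)); first by [].
  by rewrite gr_mapE augmentationU mulrC.
have hD (x y : down (trivial_module R G : lmodType RG)) :
    (((x : R) + (y : R) : R) : R^c) *: a = ((x : R) : R^c) *: a + ((y : R) : R^c) *: a.
  exact: scalerDl.
exists (@lin _ (down (trivial_module R G : lmodType RG)) A _ hD hZ) => x.
rewrite [LHS](linearZ_LR p) aE -linearZ; congr (f _).
transitivity (augmentation (gmap (gr_elt (x : R) 1%g)) * 1 : R); first by [].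
by rewrite gr_mapE augmentationU mulr1.
Qed.

Lemma diag_diagonal (I : lmodType RH^c) (L : lmodType RH) :
  diagonal_module (@gr_elt R H) (@const_l R H) (@const_r R H) I L.
Proof.
pose T := tensor (restr (@const_l R H) L) (restr (@const_r R H) I).
pose idf : {additive T -> T} := idfun.
apply: (@Diagonal R H RH (@gr_elt R H) (@const_l R H) (@const_r R H) I L (diag L I) idf idf) => //.
move=> r h l i; apply: (etrans (diagZ_elt r h _)); exact: act_elt_pure.
Qed.

Hypothesis sfli_fin : (sfli R < infty)%O.

Section FiniteDimension.
Variable n : nat.
Hypothesis res : has_resolution (@PGF RG) (trivial_module R G : lmodType RG) n.

Lemma trivial_embedding : exists (Lam L : lmodType RG)
    (i : {linear trivial_module R G -> Lam}) (p : {linear Lam -> L}),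
  [/\ ses i p, finite_pd Lam, down_acyclic L & down_acyclic Lam].
Proof.
have [|Lam [L [i [p [sip pdL cL]]]]] :=
    (* Level [0] is enough: of the cokernel [L] only Tor-acyclicity is extracted. *)
    @embedding RG down_acyclic down_acyclic_ext n 0 (trivial_module R G).
  have [X [d [e [CX X0 es ex exd]]]] := res.
  exists X, d, e; split=> // m mn k; apply: PGF_coresolved; last exact: CX.
  exact: PGF_down_acyclic.
exists Lam, L, i, p; split=> //; first exact: coresolved_good cL.
apply: down_acyclic_ext sip _ (coresolved_good cL).
exact: tor_acyclic_projective down_trivial_projective.
Qed.

Lemma restr_tensor_acyclic (P : complex RG) (I : lmodType RH^c) :
  (forall m, projective_module (ob P m)) -> acyclic P -> injective_module I ->
  tensor_acyclic I (restr_complex gmap P).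
Proof.
move=> Pp Pa Iinj; have [Lam [L [i [p [sip pdL aL aLam]]]]] := trivial_embedding.
have I_fd : finite_fd (restr (@const_r R H) I).
  by apply: sfli_finite_fd => //; apply: restr_injective.
have Pp' m : projective_module (ob (restr_complex gmap P) m).
  exact: restr_sub_projective.
pose one : trivial_module R G := (1 : R).
pose l0 : restr gmap Lam := i one.
apply: (tensor_acyclic_retract (@gr_ind R H) (D := diag_diagonal I) (l0 := l0) Iinj).
- move=> h; rewrite restrZ gr_mapE -linearZ; congr (i _).
  transitivity (augmentation (gr_elt (1 : R) (phi h)) * 1 : R); first by [].
  by rewrite augmentationU mulr1.
(* Tor-vanishing for [L] makes [R (x) I -> Lam (x) I] injective, and [x |-> 1 (x) x] has the
   multiplication map [R (x) I -> I], given by [bal], as a left inverse. *)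
- have ri := aL _ I_fd _ _ _ _ (ses_restr (@const_l R H) (ses_restr gmap sip)).
  have bal : balanced (fun (r : down (trivial_module R G : lmodType RG))
      (x : restr (@const_r R H) I) => (r : R) *: x).
    split=> [r s x|r x y|r s x].
    + exact: scalerDl.
    + exact: scalerDr.
    + rewrite scalerA; apply: (congr1 (fun z : R => z *: x)).
      transitivity (augmentation (gmap (gr_elt (s : R) 1%g)) * (r : R)); first by [].
      by rewrite gr_mapE augmentationU mulrC.
  move=> x y e; pose pure1 z :=
    @pure R (down (trivial_module R G : lmodType RG)) (restr (@const_r R H) I) one z.
  pose ii := restr_map (@const_l R H) (restr_map gmap i).
  pose idI : {linear restr (@const_r R H) I -> restr (@const_r R H) I} := idfun.
  have e1 : pure1 x = pure1 y.
    apply: ri; exact: (etrans (tensor_map_pure ii idI one x)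
      (etrans e (esym (tensor_map_pure ii idI one y)))).
  have e2 := etrans (esym (tliftE bal one x))
    (etrans (congr1 (tlift bal) e1) (tliftE bal one y)).
  by rewrite -(scale1r x) -(scale1r y); exact: e2.
- apply: (finite_pd_diag_acyclic (@gr_eltM R H) (@gr_elt1 R H) (@gr_ind R H)) => //.
  + exact: restr_const_projective.
  + by apply: finite_pd_restr pdL; apply: group_ring_projective_sub.
Qed.

Lemma restr_PGF (M : lmodType RG) : PGF M -> PGF (restr gmap M).
Proof.
move=> [P [Pp Pa Pt [m [i [ii ix]]]]]; exists (restr_complex gmap P); split.
- by move=> k; apply: restr_sub_projective.
- exact: Pa.
- by move=> I Iinj; apply: restr_tensor_acyclic.
- by exists m, (restr_map gmap i).
Qed.

(** The trivial module of [G] restricts to that of [H] because [gmap] preserves augmentations, so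
    the augmented resolution is kept as it stands. *)
Lemma restr_resolution :
  has_resolution (@PGF RH) (trivial_module R H : lmodType RH) n.
Proof.
have [X [d [e [CX X0 es ex exd]]]] := res.
have eD (x y : restr gmap (X 0%N)) : (e (x + y) : R) = (e x : R) + (e y : R).
  exact: (linearD e).
have eZ (s : RH) (x : restr gmap (X 0%N)) :
    (e (s *: x) : trivial_module R H) = s *: (e x : trivial_module R H).
  rewrite restrZ linearZ.
  transitivity (augmentation (gmap s) * (e x : R)); first by [].
  transitivity (augmentation s * (e x : R)); last by [].
  congr (_ * _); elim/gr_ind: s => [|r h s IH]; first by rewrite rmorph0 !augmentation0.
  by rewrite rmorphD !augmentationD IH gr_mapE !augmentationU.
exists (fun i => restr gmap (X i)), (fun i => restr_map gmap (d i)),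
  (@lin RH (restr gmap (X 0%N)) (trivial_module R H) _ eD eZ); split=> //.
by move=> i im; apply: restr_PGF; apply: CX.
Qed.

End FiniteDimension.

Lemma Gcd_tilde_restr : (Gcd_tilde R H <= Gcd_tilde R G)%O.
Proof.
rewrite [Gcd_tilde R G]/Gcd_tilde /PGF_dim /resolution_dim.
case E : (infn _) => [n|]; last by case: (Gcd_tilde R H).
have [m mE mn] := infn_le (restr_resolution (infn_some E)).
by rewrite /Gcd_tilde /PGF_dim /resolution_dim mE.
Qed.

End Restriction.

Theorem proposition3p8 (G : groupType) (S : pred G) (H : subGroupType S)
  (R : comPzRingType) (sfli_fin : (sfli R < infty)%O) :
  (Gcd_tilde R H <= Gcd_tilde R G)%O.
Proof.
apply: (@Gcd_tilde_restr R G H \val) => //.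
- exact: val_inj.
- by move=> x y; rewrite gmulfM.
- by rewrite gmulf1.
Qed.
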